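(* Let $\underline{\nu}>0$, $\nu\ge\underline{\nu}$, and let $f\in H$ (time-independent) satisfy $|f|\le\frac{\nu^2}{2c_L}$. Let $u_*\in D(A)$ be the unique solution of $\nu Au_*+B(u_*,u_* )=f$. Then there exist $\rho_*>0$ and $N_f>0$ such that the following holds for all $\rho\le\rho_*$ and $N\ge N_f$. Let $\nu,\hat\nu\in\mathscr{A}=[\underline{\nu},(1+\rho)\underline{\nu}]$ and let $\mu>0$. Let $u$ be the strong solution of $\partial_tu+\nu Au+B(u,u)=f$, $u(0)=u_0\in V$, let $v$ be the strong solution of $\partial_tv+\hat\nu Av+B(v,v)=f-\mu P_Nv+\mu P_Nu$, $v(0)=v_0\in V$, let $v_*\in D(A)$, $v_*\neq0$, solve $\hat\nu Av_*+B(v_*,v_* )+\mu P_Nv_*=f+\mu P_Nu_*$, and let $\hat v_*$ solve $\hat\nu A\hat v_*+\mu P_N\hat v_*+DB(v_* )\hat v_*=-Av_*$. Suppose that $$\mu\ge\frac{2c_L^2V_1^2}{\underline{\nu}},\quad N\ge\frac{2c_LV_1}{\underline{\nu}};\qquad \mu\ge\frac{20c_L^2V_1^2}{\underline{\nu}},\quad N\ge\frac{4\sqrt2c_LV_1}{\underline{\nu}};\qquad \mu\ge\frac{2c_A^2|Au_*|^2}{\underline{\nu}},\quad N^2\ge\frac{2\sqrt2c_A|Au_*|}{\underline{\nu}};$$ $$\mu\ge\max\left\{\frac{32c_L^2\|v_*\|^2}{\hat\nu},\frac{16c_{BG}^2\|v_*\|^2}{\hat\nu}\left[1+\log\frac{|Av_*|}{|v_*|}\right]\right\},\quad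 N\ge\max\left\{\frac{8c_L\|v_*\|}{\hat\nu},\frac{4c_{BG}\|v_*\|}{\hat\nu}\left[1+\log\frac{|Av_*|}{|v_*|}\right]^{1/2}\right\}.$$ Then, with $\mathsf{P}_*(\hat\nu):=-(Av_*,\hat v_* )$, $$\mathsf{P}_*(\hat\nu)\gtrsim\frac{|Au_*|^2}{\mu}\qquad\text{whenever }\mu\sim\hat\nu N^2,$$ i.e. for every $K\ge1$ there is $c>0$ depending only on $K$ such that $K^{-1}\hat\nu N^2\le\mu\le K\hat\nu N^2$ implies $\mathsf{P}_*(\hat\nu)\ge c|Au_*|^2/\mu$.
   Context: Setting: $\mathbb{T}^2=[0,2\pi]^2$ with periodic boundary conditions. $H$ is the space of mean-free, divergence-free vector fields in $L^2(\mathbb{T}^2)$ with inner product $(\cdot,\cdot)$ and norm $|\cdot|$; $V=H^1\cap H$ with norm $\|u\|=|\nabla u|$; $P_\sigma$ is the Leray projection, $A=P_\sigma(-\Delta)=-\Delta$ with domain $D(A)=H^2\cap V$; $B(u,v)=P_\sigma((u\cdot\nabla)v)$; $DB(v)\phi=B(v,\phi)+B(\phi,v)$. $P_N$ is the $L^2$-orthogonal projection onto Fourier wavenumbers $|k|\le N$. Constants: $|\phi|_{L^4}^2\le c_L\|\phi\||\phi|$ (Ladyzhenskaya), $|\phi|_{L^\infty}\le c_A|A\phi|^{1/2}|\phi|^{1/2}$ (Agmon), $|\phi|_{L^\infty}\le c_{BG}\|\phi\|[1+\log(|A\phi|/\|\phi\|)]^{1/2}$ (Brézis–Gallouet). $V_1$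 is the supremum of $\|v(t)\|$ along the assimilated trajectory over the time interval under consideration, here $V_1=\sup_{t\ge0}\|v(t)\|$. Under $|f|\le\nu^2/(2c_L)$ the stationary Navier–Stokes solution $u_*$ exists and is unique. *)

(* Defs.v *)
From mathcomp Require Export all_boot all_order all_algebra.
From mathcomp Require Export all_classical all_reals all_analysis.

Set Implicit Arguments.
Unset Strict Implicit.
Unset Printing Implicit Defensive.

Export Order.TTheory GRing.Theory Num.Theory.
Export numFieldNormedType.Exports.

Local Open Scope classical_set_scope.
Local Open Scope ring_scope.

(* T^2 is the square [0,2pi]^2 with unnormalised Lebesgue measure. Functions are
   defined on the whole plane but only their values on the square matter, and
   equality in H is a.e. equality on the square ([eqH]). Periodicity enters
   through the test functions: weak derivatives are tested against all smooth
   2pi-periodic functions, so they are derivatives on the torus. *)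
Section Torus.
Context {R : realType}.
Implicit Types (x : R * R) (g h psi : R * R -> R) (i j : 'I_2) (k : int * int).

Definition leb2 : {measure set (measurableTypeR R * measurableTypeR R) -> \bar R} :=
  (@lebesgue_measure R \x @lebesgue_measure R)%E.

Definition torus : set (R * R) := `[0, 2 * pi] `*` `[0, 2 * pi].

Definition ev j : R * R := if j == ord0 then (1, 0) else (0, 1).

Definition L2 g : Prop :=
  measurable_fun torus g /\
  leb2.-integrable torus (fun x => (g x ^+ 2)%:E).

Definition L2dot g h : R := Rintegral leb2 torus (fun x => g x * h x).

Fixpoint Cn (n : nat) psi : Prop :=
  continuous psi /\
  if n is n'.+1 then
    forall j, (forall x, derivable psi x (ev j)) /\ Cn n' (fun x => 'D_(ev j) psi x)
  else True.

Definition test psi : Prop :=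
  (forall n, Cn n psi) /\ (forall j x, psi (x + (2 * pi) *: ev j) = psi x).

Definition weak_pd j g h : Prop :=
  forall psi, test psi -> L2dot g (fun x => 'D_(ev j) psi x) = - L2dot h psi.

Fixpoint Hs (s : nat) g : Prop :=
  L2 g /\
  if s is s'.+1 then forall j, exists2 h, weak_pd j g h & Hs s' h else True.

(* any representative of the weak derivative; 0 if there is none in L^2 *)
Definition pd j g : R * R -> R := xget 0 [set h | L2 h /\ weak_pd j g h].

Definition phase k x : R := k.1%:~R * x.1 + k.2%:~R * x.2.

End Torus.

Notation vfield R := ('I_2 -> R * R -> R).

Section Fields.
Context {R : realType}.
Implicit Types (u v w phi : vfield R) (N nu : R).

Definition eqH u v : Prop :=
  forall i, {ae leb2, forall x, torus x -> u i x = v i x}.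

Definition L2v u : Prop := forall i, L2 (u i).

Definition inner u v : R := \sum_i L2dot (u i) (v i).

Definition normH u : R := Num.sqrt (inner u u).

Definition divfree u : Prop :=
  forall psi, test psi -> \sum_i L2dot (u i) (fun x => 'D_(ev i) psi x) = 0.

Definition meanfree u : Prop := forall i, Rintegral leb2 torus (u i) = 0.

Definition inH : set (vfield R) := [set u | [/\ L2v u, divfree u & meanfree u]].

Definition inV : set (vfield R) := [set u | inH u /\ forall i, Hs 1 (u i)].

Definition inDA : set (vfield R) := [set u | inV u /\ forall i, Hs 2 (u i)].

Definition normV u : R :=
  Num.sqrt (\sum_i \sum_j L2dot (pd j (u i)) (pd j (u i))).

Definition mag u : R * R -> R := fun x => Num.sqrt (\sum_i u i x ^+ 2).

Definition normLp (p : \bar R) u : \bar R :=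
  ('N[leb2]_p[(EFin \o mag u) \_ torus])%E.

(* For S a closed subspace of L^2(T^2)^2 and u in L^2(T^2)^2 the projection
   exists and is unique up to a.e. equality; 0 is only a default value. *)
Definition orthproj (S : set (vfield R)) u : vfield R :=
  xget 0 [set w | S w /\ forall phi, S phi -> inner (u - w) phi = 0].

Definition leray : vfield R -> vfield R := orthproj inH.

(* fields with Fourier support in |k| <= N *)
Definition modes N : set (vfield R) :=
  [set u | L2v u /\ forall (k : int * int) i,
     N < Num.sqrt (k.1%:~R ^+ 2 + k.2%:~R ^+ 2) ->
     L2dot (u i) (fun x => cos (phase k x)) = 0 /\
     L2dot (u i) (fun x => sin (phase k x)) = 0].

Definition PN N : vfield R -> vfield R := orthproj (modes N).

(* P_sigma(-Delta) = -Delta on D(A) in the periodic setting *)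
Definition A u : vfield R := fun i => - \sum_j pd j (pd j (u i)).

Definition adv u v : vfield R := fun i => \sum_j u j * pd j (v i).

Definition B u v : vfield R := leray (adv u v).

Definition DB v phi : vfield R := B v phi + B phi v.

Definition ladyzhenskaya (cL : R) : Prop :=
  forall phi, inV phi ->
    (normLp 4%:E phi ^+ 2 <= (cL * normV phi * normH phi)%:E)%E.

Definition agmon (cA : R) : Prop :=
  forall phi, inDA phi ->
    (normLp +oo phi <=
      (cA * Num.sqrt (normH (A phi)) * Num.sqrt (normH phi))%:E)%E.

Definition brezis_gallouet (cBG : R) : Prop :=
  forall phi, inDA phi -> ~ eqH phi 0 ->
    (normLp +oo phi <=
      (cBG * normV phi
         * Num.sqrt (1 + ln (normH (A phi) / normV phi)))%:E)%E.

(* L^2_loc([0,oo); H): as H is separable, weak measurability is enough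
   (Pettis). *)
Definition L2loc_H (u : R -> vfield R) : Prop :=
  [/\ {ae lebesgue_measure, forall t, 0 <= t -> inH (u t)},
      forall phi, inH phi ->
        measurable_fun [set t : R | 0 <= t] (fun t => inner (u t) phi)
    & forall T, 0 <= T ->
        lebesgue_measure.-integrable `[0, T] (fun t => (normH (u t) ^+ 2)%:E)].

(* u is the indefinite Bochner integral of u' in H, which for u continuous into
   H says that u' is its distributional time derivative *)
Definition time_derivative (u u' : R -> vfield R) : Prop :=
  forall phi, inH phi -> forall T, 0 <= T ->
    inner (u T) phi - inner (u 0) phi
    = Rintegral lebesgue_measure `[0, T] (fun t => inner (u' t) phi).

(* du/dt + nu A u + B(u,u) = F on [0,oo), u(0) = u0, with the usual regularity
   u in C([0,oo);V), u in L^2_loc(D(A)), du/dt in L^2_loc(H) *)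
Definition strong_solution nu (F : R -> vfield R) (u0 : vfield R)
    (u : R -> vfield R) : Prop :=
  [/\ eqH (u 0) u0,
      forall t, 0 <= t -> inV (u t) /\
        normV (u s - u t) @[s --> within [set s | 0 <= s] (nbhs t)] --> 0,
      {ae lebesgue_measure, forall t, 0 <= t -> inDA (u t)} /\
        L2loc_H (fun t => A (u t))
    & exists u' : R -> vfield R,
      [/\ L2loc_H u', time_derivative u u'
        & {ae lebesgue_measure, forall t, 0 <= t ->
            eqH (u' t + nu *: A (u t) + B (u t) (u t)) (F t)}]].

End Fields.

(* Main.v *)
(* Testing the linearized equation with its solution w = vhs gives
   -(A vs, w) >= E(w)/2, where E(w) = nuh |grad w|^2 + mu |P_N w|^2: the trilinear term
   (B(w,vs), w) = -(B(w,w), vs) is absorbed through the bound on |vs|_oo from the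
   Brezis-Gallouet inequality. Testing with P_N A vs instead, and using that
   nuh N^2 <= K mu, gives |P_N A vs|^2 <= 8 K^2 mu E(w). It remains to see that
   |P_N A vs| >= |A us|/2. For d = vs - us, testing the difference of the two
   stationary equations with d gives |grad d| <= 2 rho |A us|, and testing it with
   A d, with Agmon's inequality, gives |A d| <= |A us|/4 for rho small; for N large
   |A us - P_N A us| <= |A us|/4. The constant is c(K) = 1/(64 K^2).

   The functional analysis is done on Fourier coefficients: completeness of L^2
   and uniqueness of coefficients give Parseval's identity, which turns statements
   on P_N, A and norms into termwise ones; truncations of Fourier series, being
   smooth, give the antisymmetry of (B(u,v),phi). *)

(* Why [P_N A vs] serves as test field: [E(w)] controls one derivative of [w], so the second
   derivative in [A w] must fall on the test field. On low modes each derivative costs a factor [N],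
   and [nuh N^2 <= K mu] converts these factors into the weight [mu] of the energy. Since [vs] is
   controlled by its supremum, antisymmetry moves derivatives off [vs] whenever it stands in the
   differentiated slot.

   In the gradient estimate for [d] the identity (B(d,us),d) + (B(d,d),d) = (B(d,vs),d) leaves a
   single trilinear term, absorbed as in the linearized equation.

   The constant comes from |A us|^2 / 4 <= |P_N A vs|^2 <= 8 K^2 mu E <= 16 K^2 mu (-(A vs, w)). The
   bound on [rho] is quadratic in nu0 / (cA |A us| + nu0), because Agmon's inequality sees |d| only
   through its square root.

   [pd] and [orthproj] choose representatives, so even their linearity holds only almost everywhere;
   identities between them are established through coefficients. *)
Require Import Defs.
From mathcomp Require Import measurable_realfun ess_sup_inf ring lra zify.

Set Implicit Arguments.
Unset Strict Implicit.
Unset Printing Implicit Defensive.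

Local Open Scope classical_set_scope.
Local Open Scope ring_scope.

(** * Square-integrable functions on the torus *)

Section SquareIntegrable.
Context {R : realType}.
Implicit Types (f g h psi : R * R -> R) (c : R) (i j : 'I_2) (k : int * int).
Notation leb2 := (@leb2 R).
Notation torus := (@torus R).
Notation integ f := (leb2.-integrable torus (EFin \o f)).
Notation mfun f := (measurable_fun (torus : set (measurableTypeR R * measurableTypeR R)) f).

#[global] Instance ae_leb2_filter : Filter (nbhs (almost_everywhere leb2)).
Proof. exact: ae_filter_ringOfSetsType. Qed.

Lemma scalefE c g x : (c *: g) x = c * g x. Proof. by []. Qed.

Lemma measurable_torus : measurable (torus : set (measurableTypeR R * measurableTypeR R)).
Proof. by apply: measurableX; exact: measurable_itv. Qed.
Hint Resolve measurable_torus : core.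

Lemma leb2_rect (a b : R) : 0 <= a -> 0 <= b ->
  leb2 (`[0, a] `*` `[0, b]) = (a * b)%:E.
Proof.
move=> a0 b0.
have -> : leb2 (`[0, a] `*` `[0, b]) =
   (lebesgue_measure (`[0%R, a] : set R) * lebesgue_measure (`[0%R, b] : set R))%E.
  exact: (@product_measure1E _ _ _ _ R lebesgue_measure lebesgue_measure).
rewrite !lebesgue_measure_itv/= !lte_fin.
case: ltgtP a0 => // [a0|<-] _; case: ltgtP b0 => // [b0|<-] _;
  by rewrite ?sube0 -?EFinM ?mul0e ?mule0 ?mul0r ?mulr0.
Qed.

Lemma leb2_torus : leb2 torus = (4 * pi ^+ 2)%:E.
Proof.
rewrite leb2_rect ?mulr_ge0 ?pi_ge0//.
by congr EFin; ring.
Qed.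

Lemma leb2_torus_lty : (leb2 torus < +oo)%E.
Proof. by rewrite leb2_torus ltry. Qed.

Lemma integ_bounded f M : mfun f -> (forall x, torus x -> `|f x| <= M) -> integ f.
Proof.
move=> mf fM; apply: measurable_bounded_integrable => //; first exact: leb2_torus_lty.
exists M; split; first exact: num_real.
by move=> y My x tx; apply: le_trans (ltW My); exact: fM.
Qed.

Lemma L2_mfun g : L2 g -> mfun g. Proof. by case. Qed.

Lemma integ_mfun g : integ g -> mfun g.
Proof. by move/measurable_int/measurable_EFinP. Qed.

Lemma le_integ f g : mfun f -> (forall x, torus x -> `|f x| <= `|g x|) -> integ g -> integ f.
Proof.
move=> mf fg; apply: le_integrable => //; first exact/measurable_EFinP.
Qed.

Lemma integD f g : integ f -> integ g -> integ (f \+ g).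
Proof.
by move=> fi gi; apply: eq_integrable (integrableD _ fi gi).
Qed.

Lemma L2M g h : L2 g -> L2 h -> integ (g \* h).
Proof.
move=> [mg ig] [mh ih].
apply: (@le_integ _ ((fun x => g x ^+ 2) \+ (fun x => h x ^+ 2))).
- exact: measurable_funM.
- move=> x _ /=; rewrite normrM [leRHS]ger0_norm ?addr_ge0 ?sqr_ge0//.
  rewrite -[g x ^+ 2]real_normK ?num_real// -[h x ^+ 2]real_normK ?num_real//.
  have := sqr_ge0 (`|g x| - `|h x|); have := normr_ge0 (g x); have := normr_ge0 (h x); nra.
- exact: integD.
Qed.

Lemma L2M_sqr g : mfun g -> integ (g \* g) -> L2 g.
Proof. by move=> mg ig; split. Qed.

Lemma L2D g h : L2 g -> L2 h -> L2 (g + h).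
Proof.
move=> L2g L2h; have [mg ig] := L2g; have [mh ih] := L2h.
apply: L2M_sqr; first exact: measurable_funD.
apply: (@le_integ _ (((fun x => g x ^+ 2) \+ (g \* h)) \+ ((g \* h) \+ (fun x => h x ^+ 2)))).
- by apply: measurable_funM; exact: measurable_funD.
- by move=> x _ /=; rewrite le_eqVlt; apply/orP; left; apply/eqP; congr Num.norm;
    rewrite !fctE; ring.
- by apply: integD; apply: integD => //; exact: L2M.
Qed.

Lemma L2Z c g : L2 g -> L2 (c *: g).
Proof.
move=> [mg ig]; apply: L2M_sqr; first exact: measurable_funM.
have := integrableZl measurable_torus (c ^+ 2) ig.
apply: eq_integrable => // x _ /=; rewrite -EFinM; congr EFin.
by rewrite !scalefE; ring.
Qed.

Lemma L2_bounded f M : mfun f -> (forall x, torus x -> `|f x| <= M) -> L2 f.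
Proof.
move=> mf fM; apply: L2M_sqr => //; apply: (@integ_bounded _ (M * M)).
  exact: measurable_funM.
by move=> x tx /=; rewrite normrM ler_pM// fM.
Qed.

Lemma L2_cst c : L2 (fun=> c).
Proof. by apply: (@L2_bounded _ `|c|) => //; exact: measurable_cst. Qed.

Lemma L2_0 : L2 (0 : R * R -> R). Proof. exact: (L2_cst 0). Qed.

Lemma L2N g : L2 g -> L2 (- g).
Proof. by move=> /(L2Z (-1)); rewrite scaleN1r. Qed.

Lemma L2B g h : L2 g -> L2 h -> L2 (g - h).
Proof. by move=> L2g L2h; apply: L2D => //; exact: L2N. Qed.

Lemma L2_sum (I : Type) (r : seq I) (P : pred I) (F : I -> R * R -> R) :
  (forall i : I, P i -> L2 (F i)) -> L2 (\sum_(i <- r | P i) F i).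
Proof. by move=> LF; apply: (big_ind (@L2 R)) => //; [exact: L2_0|exact: L2D]. Qed.

Lemma L2dotC g h : L2dot g h = L2dot h g.
Proof. by rewrite /L2dot; congr Rintegral; apply/funext => x; rewrite mulrC. Qed.

Lemma L2dotDl g1 g2 h : L2 g1 -> L2 g2 -> L2 h ->
  L2dot (g1 + g2) h = L2dot g1 h + L2dot g2 h.
Proof.
move=> L1 L2' Lh; rewrite /L2dot -RintegralD//; try exact: L2M.
by congr Rintegral; apply/funext => x; rewrite /= -mulrDl.
Qed.

Lemma L2dotDr g h1 h2 : L2 g -> L2 h1 -> L2 h2 ->
  L2dot g (h1 + h2) = L2dot g h1 + L2dot g h2.
Proof. by move=> ? ? ?; rewrite L2dotC L2dotDl// !(L2dotC g). Qed.

Lemma L2dotZl c g h : L2 g -> L2 h -> L2dot (c *: g) h = c * L2dot g h.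
Proof.
move=> Lg Lh; rewrite /L2dot -RintegralZl//; last exact: L2M.
by congr Rintegral; apply/funext => x; rewrite /= mulrA.
Qed.

Lemma L2dotZr c g h : L2 g -> L2 h -> L2dot g (c *: h) = c * L2dot g h.
Proof. by move=> ? ?; rewrite L2dotC L2dotZl// L2dotC. Qed.

Lemma L2dotNl g h : L2 g -> L2 h -> L2dot (- g) h = - L2dot g h.
Proof. by move=> ? ?; rewrite -scaleN1r L2dotZl// mulN1r. Qed.

Lemma L2dotNr g h : L2 g -> L2 h -> L2dot g (- h) = - L2dot g h.
Proof. by move=> ? ?; rewrite L2dotC L2dotNl// L2dotC. Qed.

Lemma L2dotBl g1 g2 h : L2 g1 -> L2 g2 -> L2 h ->
  L2dot (g1 - g2) h = L2dot g1 h - L2dot g2 h.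
Proof. by move=> ? ? ?; rewrite L2dotDl ?L2dotNl//; exact: L2N. Qed.

Lemma L2dotBr g h1 h2 : L2 g -> L2 h1 -> L2 h2 ->
  L2dot g (h1 - h2) = L2dot g h1 - L2dot g h2.
Proof. by move=> ? ? ?; rewrite L2dotC L2dotBl// !(L2dotC g). Qed.

Lemma L2dot0l h : L2dot 0 h = 0.
Proof.
rewrite /L2dot /Rintegral (eq_integral (cst 0%E)) ?integral0//.
by move=> x _; rewrite mul0r.
Qed.

Lemma L2dot0r g : L2dot g 0 = 0.
Proof. by rewrite L2dotC L2dot0l. Qed.

Lemma L2dot_suml (I : Type) (r : seq I) (P : pred I) (F : I -> R * R -> R) h :
  (forall i : I, P i -> L2 (F i)) -> L2 h ->
  L2dot (\sum_(i <- r | P i) F i) h = \sum_(i <- r | P i) L2dot (F i) h.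
Proof.
move=> LF Lh.
suff [] : L2 (\sum_(i <- r | P i) F i) /\
  L2dot (\sum_(i <- r | P i) F i) h = \sum_(i <- r | P i) L2dot (F i) h by [].
apply: (big_ind2 (fun a b => L2 a /\ L2dot a h = b)).
- by rewrite L2dot0l; split=> //; exact: L2_0.
- by move=> a x b y [? <-] [? <-]; rewrite L2dotDl//; split => //; exact: L2D.
- by move=> i Pi; split => //; exact: LF.
Qed.

Lemma L2dot_ge0 g : 0 <= L2dot g g.
Proof. by apply: Rintegral_ge0 => x _; rewrite -expr2 sqr_ge0. Qed.

Lemma L2dot_CS g h : L2 g -> L2 h -> L2dot g h ^+ 2 <= L2dot g g * L2dot h h.
Proof.
move=> Lg Lh.
have key t : 0 <= L2dot g g + 2 * t * L2dot g h + t ^+ 2 * L2dot h h.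
  have := L2dot_ge0 (g + t *: h).
  have Lt := L2Z t Lh; have Ls := L2D Lg Lt.
  rewrite L2dotDl// !L2dotDr// !L2dotZl// !L2dotZr// (L2dotC h g).
  by congr (0 <= _); ring.
have [h0|h0] := eqVneq (L2dot h h) 0.
  have [->|n0] := eqVneq (L2dot g h) 0; first by rewrite h0 mulr0 expr0n.
  (* With [L2dot h h = 0] the quadratic is affine in [t], and this [t] gives it the value -1. *)
  have := key (- (L2dot g g + 1) / (2 * L2dot g h)).
  rewrite h0 mulr0 addr0.
  have -> : 2 * (- (L2dot g g + 1) / (2 * L2dot g h)) * L2dot g h = - (L2dot g g + 1) by field.
  lra.
have hp : 0 < L2dot h h by rewrite lt_neqAle eq_sym h0 L2dot_ge0.
have := key (- L2dot g h / L2dot h h).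
have -> : L2dot g g + 2 * (- L2dot g h / L2dot h h) * L2dot g h
    + (- L2dot g h / L2dot h h) ^+ 2 * L2dot h h =
   (L2dot g g * L2dot h h - L2dot g h ^+ 2) / L2dot h h by field.
by rewrite pmulr_lge0 ?invr_gt0// subr_ge0.
Qed.

Lemma L2dot_aeeq g g' h : L2 g -> L2 g' -> L2 h ->
  {ae leb2, forall x, torus x -> g x = g' x} -> L2dot g h = L2dot g' h.
Proof.
move=> Lg Lg' Lh gg'; rewrite /L2dot /Rintegral; congr fine.
apply: ae_eq_integral => //.
- by apply/measurable_EFinP/measurable_funM; exact: L2_mfun.
- by apply/measurable_EFinP/measurable_funM; exact: L2_mfun.
- by apply: filterS gg' => x gx tx; rewrite gx.
Qed.

Lemma L2dot_eq0 g : L2 g -> L2dot g g = 0 -> {ae leb2, forall x, torus x -> g x = 0}.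
Proof.
move=> Lg g0; have ig := L2M Lg Lg.
have /integral_ge0 : forall x : R * R, torus x -> (0 <= (g x * g x)%:E)%E.
  by move=> x _; rewrite lee_fin -expr2 sqr_ge0.
have : (\int[leb2]_(x in torus) `|(g x * g x)%:E|)%E = 0%E.
  transitivity ((\int[leb2]_(x in torus) (g x * g x)%:E)%E).
    by apply: eq_integral => x _; rewrite gee0_abs// lee_fin -expr2 sqr_ge0.
  by rewrite -[LHS]fineK ?integrable_fin_num//; congr EFin; exact: g0.
move/ae_eq_integral_abs => h _.
apply: filterS (h measurable_torus (measurable_int _ ig)) => x + tx => /(_ tx) [] /eqP.
by rewrite mulf_eq0 => /orP[] /eqP.
Qed.

Lemma integ_ae_le f g : mfun f -> integ g ->
  {ae leb2, forall x, torus x -> `|f x| <= g x} -> integ f.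
Proof.
move=> mf ig fg; have mg := integ_mfun ig.
apply/integrableP; split; first exact/measurable_EFinP.
move/integrableP : ig => [_]; apply: le_lt_trans.
apply: ae_ge0_le_integral => //.
- by apply: measurableT_comp => //; exact/measurable_EFinP.
- by apply: measurableT_comp => //; exact/measurable_EFinP.
- by apply: filterS fg => x fg tx /=; rewrite lee_fin (le_trans (fg tx))// ler_norm.
Qed.

Lemma ae_le_Rintegral f g : integ f -> integ g ->
  {ae leb2, forall x, torus x -> f x <= g x} ->
  Rintegral leb2 torus f <= Rintegral leb2 torus g.
Proof.
move=> fi gi fg.
have ih : integ (g \- f).
  by apply: eq_integrable (integrableB _ gi fi).
rewrite -subr_ge0 -RintegralB//.
have -> : Rintegral leb2 torus (fun x => g x - f x)
  = Rintegral leb2 torus (fun x => `|g x - f x|).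
  rewrite /Rintegral; congr fine; apply: ae_eq_integral => //.
  - exact: measurable_int ih.
  - by apply/measurable_EFinP/measurableT_comp => //; exact: integ_mfun ih.
  - by apply: filterS fg => x fg tx; rewrite ger0_norm// subr_ge0 fg.
exact: Rintegral_ge0.
Qed.

End SquareIntegrable.

#[local] Hint Resolve measurable_torus : core.

(** * Test functions and integration by parts *)

Section TestFunctions.
Context {R : realType}.
Implicit Types (f g h psi phi : R * R -> R) (c : R) (i j : 'I_2) (k : int * int).
Notation leb2 := (@leb2 R).
Notation torus := (@torus R).
Notation integ f := (leb2.-integrable torus (EFin \o f)).
Notation mfun f := (measurable_fun (torus : set (measurableTypeR R * measurableTypeR R)) f).
Notation R2 := (measurableTypeR R * measurableTypeR R)%type.

(** Measurability in the plane refers to the product sigma-algebra; a countable union of rectangles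
    brings open sets, hence continuous functions, into it. *)
Lemma open_rational_rectangles (U : set (R * R)) : open U ->
  U = \bigcup_(p in [set p : rat * rat * (rat * rat) |
         `]ratr p.1.1, ratr p.1.2[ `*` `]ratr p.2.1, ratr p.2.2[ `<=` U])
       (`]ratr p.1.1, ratr p.1.2[ `*` `]ratr p.2.1, ratr p.2.2[).
Proof.
move=> oU; apply/seteqP; split => [x Ux|x [p /= pU]]; last exact: pU.
have /nbhs_ballP[e /= e0 xe] : nbhs x U by exact/open_nbhs_nbhs.
have nearby (y : R) : exists p : rat * rat, (y \in `]ratr p.1, ratr p.2[) /\
    (`]ratr p.1, ratr p.2[ `<=` ball y e).
  have /rat_in_itvoo[p] : y - e < y by rewrite ltrBlDr ltrDl.
  have /rat_in_itvoo[q] : y < y + e by rewrite ltrDl.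
  rewrite !in_itv/= => /andP[yq qe] /andP[ep py].
  exists (p, q); rewrite /= in_itv/= py yq; split => // z/=; rewrite in_itv/= => /andP[pz zq].
  by rewrite /ball/= ltr_norml; apply/andP; split; lra.
have [p [px pe]] := nearby x.1; have [q [qx qe]] := nearby x.2.
exists (p, q) => /=; last by split.
by move=> z [z1 z2]; apply: xe; split; [exact: pe|exact: qe].
Qed.

Lemma open_measurable2 (U : set (R * R)) : open U -> measurable (U : set R2).
Proof.
move=> /open_rational_rectangles ->; rewrite bigcup_mkcond.
apply: countable_bigcupT_measurable; first exact: countableP.
move=> p; case: ifPn => // _; apply: measurableX; exact: measurable_itv.
Qed.

Lemma continuous_mfun f : continuous f -> mfun f.
Proof.
move=> /continuousP cf; apply: (@measurable_funS _ _ _ _ setT) => //.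
apply: (measurability _ (RGenOpens.measurableE R)).
move=> _ [_ [a [b ->] <-]]; rewrite setTI.
by apply: open_measurable2; exact/cf/interval_open.
Qed.

Lemma compact_torus : compact torus.
Proof. by apply: compact_setX; exact: segment_compact. Qed.

Lemma continuous_bounded f : continuous f -> exists M, forall x, torus x -> `|f x| <= M.
Proof.
move=> cf; have : compact (f @` torus).
  by apply: continuous_compact; [exact: continuous_subspaceT|exact: compact_torus].
move=> /compact_bounded[M [_ Mf]]; exists (M + 1) => x tx.
by apply: Mf; [rewrite ltrDl|exists x].
Qed.

Lemma continuous_L2 f : continuous f -> L2 f.
Proof.
move=> cf; have [M fM] := continuous_bounded cf.
by apply: L2_bounded fM; exact: continuous_mfun.
Qed.

Lemma continuous_integ f : continuous f -> integ f.
Proof.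
move=> cf; have [M fM] := continuous_bounded cf.
by apply: integ_bounded fM; exact: continuous_mfun.
Qed.

Definition cosk k : R * R -> R := fun x => cos (phase k x).
Definition sink k : R * R -> R := fun x => sin (phase k x).
Definition wn j k : R := if j == ord0 then k.1%:~R else k.2%:~R.

Lemma shift_ev0 (s t y : R) : (s + t, y) = s *: ev ord0 + (t, y).
Proof.
rewrite /ev eqxx; transitivity (s * 1 + t, s * 0 + y); last by [].
by rewrite mulr1 mulr0 add0r.
Qed.

Lemma shift_ev1 j (s t y : R) : j != ord0 -> (y, s + t) = s *: ev j + (y, t).
Proof.
move=> j1; rewrite /ev (negbTE j1); transitivity (s * 0 + y, s * 1 + t); last by [].
by rewrite mulr1 mulr0 add0r.
Qed.

Lemma phase_ev k j (t : R) (x : R * R) : phase k (t *: ev j + x) = t * wn j k + phase k x.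
Proof.
rewrite /phase /ev /wn; case: ifP => _ /=; rewrite /GRing.scale/=; ring.
Qed.

(** Both difference quotients are the same function of [t], so directional derivatives follow the
    one-variable rules. *)
Lemma is_derive_line f (v x : R * R) (d : R) :
  is_derive (0 : R) (1 : R) (fun t : R => f (t *: v + x)) d -> is_derive x v f d.
Proof.
move=> [dl el]; have E : (fun t : R => t^-1 *: (((fun t : R => f (t *: v + x)) \o shift 0)
  (t *: 1) -
    (fun t : R => f (t *: v + x)) 0)) = (fun t : R => t^-1 *: ((f \o shift x) (t *: v) - f x)).
  by apply/funext => t /=; rewrite addr0 scale0r add0r /GRing.scale/= mulr1.
by split; [move: dl; rewrite /derivable E|move: el; rewrite /derive E].
Qed.

Lemma is_derive_affine (a b : R) : is_derive (0 : R) (1 : R) (fun t : R => t * a + b) a.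
Proof.
have -> : (fun t : R => t * a + b) = (fun t => a *: id t) \+ cst b.
  by apply/funext => t /=; rewrite mulrC.
by apply: is_derive_eq; rewrite addr0 /GRing.scale/= mulr1.
Qed.

Lemma is_derive_cosk k j x : is_derive x (ev j) (cosk k) (- wn j k * sink k x).
Proof.
apply: is_derive_line; rewrite /cosk.
rewrite [X in is_derive _ _ X](_ : _ = (@cos R) \o (fun t : R => t * wn j k + phase k x));
  last first.
  by apply/funext => t /=; rewrite phase_ev.
have := is_derive1_comp (is_derive_cos _) (is_derive_affine (wn j k) (phase k x)).
by move/is_derive_eq; apply; rewrite /sink mul0r add0r mulrC mulrN mulNr.
Qed.

Lemma is_derive_sink k j x : is_derive x (ev j) (sink k) (wn j k * cosk k x).
Proof.
apply: is_derive_line; rewrite /sink.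
rewrite [X in is_derive _ _ X](_ : _ = (@sin R) \o (fun t : R => t * wn j k + phase k x));
  last first.
  by apply/funext => t /=; rewrite phase_ev.
have := is_derive1_comp (is_derive_sin _) (is_derive_affine (wn j k) (phase k x)).
by move/is_derive_eq; apply; rewrite /cosk mul0r add0r mulrC.
Qed.

Lemma CnS n f : Cn n.+1 f -> Cn n f.
Proof.
elim: n f => [f [cf _]|n ih f [cf Cf]]; first by split.
by split => // j; have [df Cdf] := Cf j; split => //; exact: ih.
Qed.

Lemma CnD n f g : Cn n f -> Cn n g -> Cn n (f + g).
Proof.
elim: n f g => [|n ih] f g [cf Cf] [cg Cg].
  by split => // x; apply: continuousD; [exact: cf|exact: cg].
split => [x|j]; first by apply: continuousD; [exact: cf|exact: cg].
have [df Cdf] := Cf j; have [dg Cdg] := Cg j.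
split => [x|]; first exact: derivableD.
rewrite [X in Cn n X](_ : _ = (fun x => 'D_(ev j) f x) + (fun x => 'D_(ev j) g x)).
  exact: ih.
by apply/funext => x; rewrite deriveD.
Qed.

Lemma CnM n f g : Cn n f -> Cn n g -> Cn n (f * g).
Proof.
elim: n f g => [|n ih] f g Cfn Cgn; have [cf Cf] := Cfn; have [cg Cg] := Cgn.
  by split => // x; apply: continuousM; [exact: cf|exact: cg].
split => [x|j]; first by apply: continuousM; [exact: cf|exact: cg].
have [df Cdf] := Cf j; have [dg Cdg] := Cg j.
split => [x|]; first exact: derivableM.
rewrite [X in Cn n X](_ : _ = f * (fun x => 'D_(ev j) g x) + g * (fun x => 'D_(ev j) f x)).
  by apply: CnD; apply: ih => //; exact: CnS.
by apply/funext => x; rewrite deriveM.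
Qed.

Lemma Cn_cst n c : Cn n (fun=> c).
Proof.
elim: n c => [|n ih] c; first by split => //; exact: cst_continuous.
split => [|j]; first exact: cst_continuous.
split => [x|]; first exact: derivable_cst.
by rewrite [X in Cn n X](_ : _ = fun=> 0)//; apply/funext => x; rewrite derive_cst.
Qed.

Lemma testD f g : test f -> test g -> test (f + g).
Proof.
move=> [Cf pf] [Cg pg]; split => [n|j x]; first exact: CnD.
by rewrite !fctE pf pg.
Qed.

Lemma testM f g : test f -> test g -> test (f * g).
Proof.
move=> [Cf pf] [Cg pg]; split => [n|j x]; first exact: CnM.
by rewrite !fctE pf pg.
Qed.

Lemma test_cst c : test (fun=> c : R).
Proof. by split => // n; exact: Cn_cst. Qed.

Lemma testZ c f : test f -> test (c *: f).
Proof. exact: (testM (test_cst c)). Qed.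

Lemma test_sum (I : Type) (r : seq I) (P : pred I) (F : I -> R * R -> R) :
  (forall i : I, P i -> test (F i)) -> test (\sum_(i <- r | P i) F i).
Proof. by move=> tF; apply: (big_ind (@test R)) => //; [exact: test_cst|exact: testD]. Qed.

Lemma test_continuous f : test f -> continuous f.
Proof. by case=> /(_ 0%N) [cf _]. Qed.

Lemma test_L2 f : test f -> L2 f.
Proof. by move/test_continuous/continuous_L2. Qed.

Lemma test_derivable f : test f -> forall j x, derivable f x (ev j).
Proof. by case=> Cf _ j; have [_ /(_ j) []] := Cf 1%N. Qed.

Lemma test_derive f : test f -> forall j, test (fun x => 'D_(ev j) f x).
Proof.
move=> [Cf pf] j; split => [n|i x]; first by have [_ /(_ j) []] := Cf n.+1.
have E : (fun t : R => t^-1 *: ((f \o shift (x + (2 * pi) *: ev i)) (t *: ev j)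
  - f (x + (2 * pi) *: ev i)))
   = (fun t : R => t^-1 *: ((f \o shift x) (t *: ev j) - f x)).
  by apply/funext => t /=; rewrite addrA !pf.
by rewrite /derive E.
Qed.

Lemma test_cosk_sink k : test (cosk k) /\ test (sink k).
Proof.
have ccos : continuous (cosk k).
  by move=> x; apply: continuous_comp; [|exact: continuous_cos];
     apply: continuousD; apply: continuousM;
     by [exact: cst_continuous|exact: cvg_fst|exact: cvg_snd].
have csin : continuous (sink k).
  by move=> x; apply: continuous_comp; [|exact: continuous_sin];
     apply: continuousD; apply: continuousM;
     by [exact: cst_continuous|exact: cvg_fst|exact: cvg_snd].
(* Differentiation exchanges the two functions up to a factor, hence the joint induction. *)
have C n : Cn n (cosk k) /\ Cn n (sink k).
  elim: n => [|n [ihc ihs]]; first by [].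
  split; split=> // j; split=> [x|].
  - by case: (is_derive_cosk k j x).
  - rewrite [X in Cn n X](_ : _ = (fun=> - wn j k) * sink k); first exact/CnM/ihs/Cn_cst.
    by apply/funext => x; case: (is_derive_cosk k j x).
  - by case: (is_derive_sink k j x).
  - rewrite [X in Cn n X](_ : _ = (fun=> wn j k) * cosk k); first exact/CnM/ihc/Cn_cst.
    by apply/funext => x; case: (is_derive_sink k j x).
have per j (x : R * R) : exists m : int,
  phase k (x + (2 * pi) *: ev j) = phase k x + m%:~R * (2 * pi).
  exists (if j == ord0 then k.1 else k.2).
  by rewrite [x + _]addrC phase_ev [LHS]addrC [_ * wn j k]mulrC /wn; case: ifP.
have cosper (y : R) (m : int) : cos (y + m%:~R * (2 * pi))
  = cos y /\ sin (y + m%:~R * (2 * pi)) = sin y.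
  have nper (z : R) (n : nat) : cos (z + n%:R * (2 * pi))
    = cos z /\ sin (z + n%:R * (2 * pi)) = sin z.
    have -> : n%:R * (2 * pi) = pi *+ 2 *+ n :> R by rewrite !mulr_natl.
    by rewrite (periodicn (@cosD2pi R)) (periodicn (@sinD2pi R)).
  case: m => n; first exact: nper.
  by have [<- <-] := nper (y + (Negz n)%:~R * (2 * pi)) n.+1; rewrite NegzE mulrNz mulNr subrK.
split; split.
- by move=> n; case: (C n).
- by move=> j x; rewrite /cosk; have [m ->] := per j x; case: (cosper (phase k x) m).
- by move=> n; case: (C n).
- by move=> j x; rewrite /sink; have [m ->] := per j x; case: (cosper (phase k x) m).
Qed.

(** Fubini with the inner integral in direction [j]: on each line the fundamental theorem of
    calculus leaves a difference of endpoint values, zero by periodicity. All integration by parts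
    rests on this. *)
Lemma Rintegral_derive_test j f : test f ->
  Rintegral leb2 torus (fun x => 'D_(ev j) f x) = 0.
Proof.
move=> tf; have tdf := test_derive tf j.
have icd := continuous_integ (test_continuous tdf).
(* Fubini is applied on the whole plane, so the integrand is extended by 0 outside the square. *)
set F := ((EFin \o (fun x => 'D_(ev j) f x)) \_ torus).
have iF : (lebesgue_measure \x lebesgue_measure)%E.-integrable setT (F : R2 -> \bar R).
  by apply/integrable_restrict => //; rewrite setTI.
have p2 : 0 < 2 * pi :> R by rewrite mulr_gt0// pi_gt0.
have ftc (g : R -> R) (G : R -> R) : continuous g -> (forall t : R,
  is_derive t (1 : R) G (g t)) ->
    G (2 * pi) = G 0 -> (\int[lebesgue_measure]_(t in `[0%R, (2 * pi)%R]) (g t)%:E = 0)%E.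
  move=> cg dG per.
  have cG : continuous G.
    by move=> t; apply/differentiable_continuous/derivable1_diffP; case: (dG t).
  rewrite (@continuous_FTC2 _ g G)//; first by rewrite per -EFinB subrr.
  - exact: continuous_subspaceT.
  - split => [t _| |]; first by case: (dG t).
    + exact/cvg_at_right_filter/cG.
    + exact/cvg_at_left_filter/cG.
  - by move=> t _; rewrite derive1E; case: (dG t).
suff I0 : (\int[leb2]_x F x = 0)%E by rewrite /Rintegral integral_mkcond I0.
have Fin x y : F (x, y) = if (x \in `[0, 2 * pi]) && (y \in `[0, 2 * pi]) then
    ('D_(ev j) f (x, y))%:E else 0%E.
  rewrite /F /patch; congr (if _ then _ else _).
  by apply/idP/andP => [|[xt yt]]; rewrite inE.
have slice (G : R -> R * R) (t : R) : (forall s : R, G (s + t) = s *: ev j + G t) ->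
   is_derive t (1 : R) (fun s => f (G s)) ('D_(ev j) f (G t)).
  move=> Gs; have := @test_derivable _ tf j (G t).
  have E : (fun h : R => h^-1 *: (((fun s => f (G s)) \o shift t) (h *: 1) - f (G t))) =
    (fun h : R => h^-1 *: ((f \o shift (G t)) (h *: ev j) - f (G t))).
    by apply/funext => h /=; rewrite /GRing.scale/= mulr1 Gs.
  by move=> df; split; rewrite /derivable /derive E.
have [j0|j1] := eqVneq j ord0.
- rewrite -[LHS](integral21_prod_meas1 iF).
  rewrite (eq_integral (cst 0%E)) ?integral0// => y _ /=.
  rewrite /fubini_G; under eq_integral do rewrite Fin.
  have [yt|yt] := boolP (y \in `[0, 2 * pi]); last first.
    by rewrite integral0_eq// => x _; rewrite andbF.
  under eq_integral do rewrite andbT.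
  transitivity (\int[lebesgue_measure]_(x in `[0%R, (2 * pi)%R]) ('D_(ev j) f (x, y))%:E)%E;
    last apply: (ftc _ (fun x => f (x, y))).
  + rewrite [RHS]integral_mkcond; apply: eq_integral => x _.
    by rewrite /patch mem_setE.
  + move=> x; apply: (@continuous_comp _ _ _ (fun x : R => (x, y)) (fun z => 'D_(ev j) f z)).
      by apply: (@cvg_pair _ _ _ _ (nbhs _)) => //=; exact: cvg_cst.
    exact: test_continuous.
  + move=> t; apply: (slice (fun x => (x, y))) => h.
    by rewrite j0; exact: shift_ev0.
  + have [_ /(_ j (0, y))] := tf => <-.
    by rewrite j0 addrC -shift_ev0 addr0.
- rewrite -[LHS](integral12_prod_meas1 iF).
  rewrite (eq_integral (cst 0%E)) ?integral0// => x _ /=.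
  rewrite /fubini_F; under eq_integral do rewrite Fin.
  have [xt|xt] := boolP (x \in `[0, 2 * pi]); last first.
    by rewrite integral0_eq// => y _.
  transitivity (\int[lebesgue_measure]_(y in `[0%R, (2 * pi)%R]) ('D_(ev j) f (x, y))%:E)%E;
    last apply: (ftc _ (fun y => f (x, y))).
  + rewrite [RHS]integral_mkcond; apply: eq_integral => y _.
    by rewrite /patch mem_setE.
  + move=> y; apply: (@continuous_comp _ _ _ (fun y : R => (x, y)) (fun z => 'D_(ev j) f z)).
      by apply: (@cvg_pair _ _ _ _ (nbhs _)) => //=; exact: cvg_cst.
    exact: test_continuous.
  + move=> t; apply: (slice (fun y => (x, y))) => h.
    exact: shift_ev1.
  + have [_ /(_ j (x, 0))] := tf => <-.
    by rewrite addrC -shift_ev1// addr0.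
Qed.

Lemma test_by_parts j f g : test f -> test g ->
  L2dot (fun x => 'D_(ev j) f x) g = - L2dot f (fun x => 'D_(ev j) g x).
Proof.
move=> tf tg; have := Rintegral_derive_test j (testM tf tg).
have Lf := test_L2 tf; have Lg := test_L2 tg.
have Ldf := test_L2 (test_derive tf j); have Ldg := test_L2 (test_derive tg j).
have -> : (fun x => 'D_(ev j) (f * g) x) =
    (fun x => f x * 'D_(ev j) g x + 'D_(ev j) f x * g x).
  apply/funext => x; rewrite deriveM; try exact: test_derivable.
  by rewrite /GRing.scale/= [g x * _]mulrC.
rewrite RintegralD//; try exact: L2M.
by rewrite -/(L2dot f _) -/(L2dot _ g) => /eqP; rewrite addrC addr_eq0 => /eqP.
Qed.

Lemma test_weak_pd j f : test f -> weak_pd j f (fun x => 'D_(ev j) f x).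
Proof. by move=> tf psi tpsi; rewrite test_by_parts// opprK. Qed.

End TestFunctions.

(** * Completeness of L^2 *)

Section Completeness.
Context {R : realType}.
Implicit Types (f g h : R * R -> R).
Notation leb2 := (@leb2 R).
Notation torus := (@torus R).
Notation integ f := (leb2.-integrable torus (EFin \o f)).
Notation mfun f := (measurable_fun (torus : set (measurableTypeR R * measurableTypeR R)) f).

(* On the torus, of finite measure, the weighted bound
   [|u| <= (q + u^2 / q) / 2] with [q = 2^-n] replaces Cauchy-Schwarz. *)
Lemma L1_le_of_L2_le (n : nat) f : L2 f -> L2dot f f <= 4 ^- n ->
  (\int[leb2]_(x in torus) `|f x|%:E <= ((2 * pi ^+ 2 + 1) * 2 ^- n)%:E)%E.
Proof.
move=> Lf fn; set q : R := 2 ^- n.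
have q0 : 0 < q by rewrite invr_gt0 exprn_gt0.
pose F : R * R -> R := fun x => q / 2 + (2 * q)^-1 * (f x * f x).
have iff := L2M Lf Lf.
have iF : integ F.
  apply: (@integD _ (fun=> q / 2) (fun x => (2 * q)^-1 * (f x * f x))).
    by apply: (@integ_bounded _ _ `|q / 2|) => //; exact: measurable_cst.
  by apply: eq_integrable (integrableZl measurable_torus (2 * q)^-1 iff).
apply: (@le_trans _ _ (\int[leb2]_(x in torus) (F x)%:E)%E).
  apply: ge0_le_integral => //.
  - by apply/measurable_EFinP/measurableT_comp => //; exact: L2_mfun.
  - exact: measurable_int iF.
  - move=> x _; rewrite lee_fin /F.
    have -> : f x * f x = `|f x| ^+ 2 by rewrite real_normK ?num_real.
    rewrite -subr_ge0.
    have -> : q / 2 + (2 * q)^-1 * `|f x| ^+ 2 - `|f x| = (`|f x| - q) ^+ 2 / (2 * q).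
      by field; rewrite gt_eqF.
    by rewrite mulr_ge0 ?sqr_ge0// invr_ge0 mulr_ge0// ltW.
have -> : (\int[leb2]_(x in torus) (F x)%:E = (Rintegral leb2 torus F)%:E)%E.
  by rewrite fineK// integrable_fin_num.
rewrite lee_fin /F RintegralD//; last 2 first.
- by apply: (@integ_bounded _ _ `|q / 2|) => //; exact: measurable_cst.
- by apply: eq_integrable (integrableZl measurable_torus (2 * q)^-1 iff).
rewrite (Rintegral_cst _ measurable_torus) leb2_torus/= (RintegralZl _ measurable_torus iff)
  -/(L2dot f f).
have -> : (2 * pi ^+ 2 + 1) * q = q / 2 * (4 * pi ^+ 2) + q by field.
rewrite lerD2l -(@ler_pM2l _ (2 * q)) ?mulr_gt0// mulrA divff ?mul1r; last first.
  by rewrite mulf_neq0// gt_eqF.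
have -> : 2 * q * q = 2 * 4 ^- n.
  by rewrite -mulrA -expr2 /q -exprVn -exprM mulnC exprM exprVn -natrX -exprVn.
by apply: (le_trans fn); rewrite ler_peMl ?ler1n// invr_ge0 exprn_ge0.
Qed.

(** By monotone convergence the sum of the [|a n.+1 x - a n x|] is integrable, hence finite a.e.;
    there the telescoping series converges absolutely. *)
Lemma ae_cvg_of_summable_L1 (a : nat -> R * R -> R) (C : R) :
  (forall n, mfun (a n)) ->
  (forall n, (\int[leb2]_(x in torus) `|a n.+1 x - a n x|%:E <= (C * 2 ^- n)%:E)%E) ->
  {ae leb2, forall x, torus x -> cvgn (fun n => a n x)}.
Proof.
move=> ma aC.
pose d n x := (`|a n.+1 x - a n x|%:E)%E.
have md n : measurable_fun torus (d n).
  by apply/measurable_EFinP/measurableT_comp => //; apply: measurable_funB; exact: ma.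
have d0 n x : (0 <= d n x)%E by rewrite lee_fin.
have C0 : 0 <= C.
  have := aC 0%N; rewrite expr0 invr1 mulr1 => aC0.
  by rewrite -lee_fin (le_trans _ aC0)//; exact: integral_ge0.
have iS : leb2.-integrable torus (fun x => \sum_(n <oo) d n x)%E.
  apply/integrableP; split; first by apply: ge0_emeasurable_sum => [n x _ _|n _];
    [exact: d0|exact: md].
  under eq_integral => x _ do rewrite (gee0_abs (nneseries_ge0 (fun n _ _ => d0 n x))).
  rewrite integral_nneseries//.
  apply: (@le_lt_trans _ _ (2 * C)%:E); last exact: ltry.
  apply: lime_le.
    by apply: is_cvg_nneseries => n _ _; exact: integral_ge0.
  (* The value [2 C - 2 C 2^-n] is the closed form of the geometric partial sum, provable by
     induction. *)
  apply: nearW => n; apply: (@le_trans _ _ (2 * C - 2 * C * 2 ^- n)%:E).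
    elim: n => [|n ih]; first by rewrite big_geq// expr0 invr1 mulr1 subrr.
    rewrite big_nat_recr//=; apply: le_trans (leeD ih (aC n)) _.
    rewrite -EFinD lee_fin le_eqVlt; apply/orP; left; apply/eqP.
    by rewrite exprS invfM; field; rewrite expf_neq0.
  by rewrite lee_fin lerBlDr lerDl !mulr_ge0// invr_ge0 exprn_ge0.
apply: filterS (integrable_ae measurable_torus iS) => x Sx tx.
have {}Sx := Sx tx.
have cS : cvgn (series (fun n => a n.+1 x - a n x)).
  apply: normed_cvg; apply: nondecreasing_is_cvgn.
    by apply: nondecreasing_series => n _ _; exact: normr_ge0.
  exists (fine (\sum_(n <oo) d n x)%E) => _ [n _ <-].
  rewrite -lee_fin fineK// /series/= -sumEFin.
  exact: (nneseries_lim_ge n).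
rewrite (_ : (fun n => a n x) = cst (a 0%N x) \+ series (fun n => a n.+1 x - a n x)).
  by apply: is_cvgD => //; exact: is_cvg_cst.
by apply/funext => n; rewrite /series /= telescope_sumr// addrC subrK.
Qed.

(** Fatou's lemma for the squares, whose limit inferior is [h ^+ 2] almost everywhere. *)
Lemma L2_fatou (a : nat -> R * R -> R) h (e : R) :
  (forall n, mfun (a n)) -> mfun h ->
  {ae leb2, forall x, torus x -> a n x @[n --> \oo] --> h x} ->
  (forall n, integ (fun x => a n x ^+ 2) /\ Rintegral leb2 torus (fun x => a n x ^+ 2) <= e) ->
  L2 h /\ L2dot h h <= e.
Proof.
move=> ma mh ah ae.
pose f n x := ((a n x) ^+ 2)%:E.
have mf n : measurable_fun torus (f n).
  by apply/measurable_EFinP; apply: measurable_funX; exact: ma.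
have mh2 : mfun (fun x => h x ^+ 2) by exact: measurable_funX.
have f0 n x : torus x -> (0 <= f n x)%E by rewrite lee_fin sqr_ge0.
have he : (\int[leb2]_(x in torus) (h x ^+ 2)%:E <= e%:E)%E.
  rewrite (@ae_eq_integral _ _ _ leb2 torus (fun x => limn_einf (f^~ x)))//.
  - have fa := fatou leb2 measurable_torus mf f0; apply: (le_trans fa).
    rewrite limn_einf_lim; apply: lime_le; first exact: is_cvg_einfs.
    apply: nearW => n; apply: (@le_trans _ _ (\int[leb2]_(x in torus) f n x)%E).
      by apply: ereal_inf_lbound; exists n => //=.
    have [i2 ie] := ae n.
    by rewrite -(fineK (integrable_fin_num measurable_torus i2)) lee_fin.
  - exact/measurable_EFinP.
  - rewrite /limn_einf; apply: measurableT_comp => //.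
    apply: (measurable_fun_limn_esup (f := fun n x => - f n x)%E) => n.
    exact: measurableT_comp.
  - apply: filterS ah => x axh tx.
    have /cvg_limn_einf_sup[-> _]// : (f^~ x) n @[n --> \oo] --> (h x ^+ 2)%:E.
    apply: cvg_EFin; first exact: nearW.
    by apply: cvgM; exact: axh.
have Lh : L2 h.
  split => //; apply/integrableP; split; first exact/measurable_EFinP.
  by under eq_integral do rewrite gee0_abs ?lee_fin ?sqr_ge0//; rewrite (le_lt_trans he)// ltry.
split => //; rewrite /L2dot -lee_fin /Rintegral fineK//.
by apply: integrable_fin_num => //; exact: L2M.
Qed.

(** A subsequence with gaps at most [2^-k] converges a.e.; Fatou's lemma, applied to its differences
    with a fixed [g n], shows that the a.e. limit is also the L^2 limit of the whole sequence. *)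
Theorem L2_complete (g : nat -> R * R -> R) :
  (forall n, L2 (g n)) ->
  (forall e : R, 0 < e -> exists N, forall m n, (N <= m)%N -> (N <= n)%N ->
     L2dot (g m - g n) (g m - g n) <= e) ->
  exists h, L2 h /\ forall e : R, 0 < e -> exists N, forall n, (N <= n)%N ->
     L2dot (g n - h) (g n - h) <= e.
Proof.
move=> Lg Cg.
have /choice[p0 p0E] : forall k : nat, exists N, forall m n, (N <= m)%N -> (N <= n)%N ->
     L2dot (g m - g n) (g m - g n) <= 4 ^- k.
  by move=> k; apply: Cg; rewrite invr_gt0 exprn_gt0.
(* Summing the moduli makes the indices increasing, with [p k >= p0 k] and [p k >= k]. *)
pose p (k : nat) := (\sum_(i < k.+1) (p0 i).+1)%N.
have p_le k : (p k <= p k.+1)%N by rewrite /p [leqRHS]big_ord_recr/= leq_addr.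
have p0p k : (p0 k <= p k)%N.
  by rewrite /p big_ord_recr/= (leq_trans (leqnSn _))// leq_addl.
have kp k : (k <= p k)%N.
  elim: k => // k ih; rewrite /p big_ord_recr/= -/(p k) addnS ltnS.
  by rewrite (leq_trans ih)// leq_addr.
pose a k := g (p k).
have ma k : mfun (a k) by exact: L2_mfun (Lg _).
have [N [mN N0 NE]] : {ae leb2, forall x, torus x -> cvgn (fun n => a n x)}.
  apply: (ae_cvg_of_summable_L1 (C := 2 * pi ^+ 2 + 1)) => // n.
  apply: (L1_le_of_L2_le (f := a n.+1 - a n)); first exact: (L2B (Lg _) (Lg _)).
  by apply: p0E => //; exact: leq_trans (p_le n).
(* Set to 0 on the exceptional null set, the sequence converges everywhere on the square, so its
   limit is measurable. *)
pose a' k x := a k x * \1_(~` N) x.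
have fcos x : torus x -> cvgn (fun k => a' k x).
  move=> tx; have [xN|xN] := pselect (N x).
    rewrite (_ : (fun k => a' k x) = cst 0); first exact: is_cvg_cst.
    by apply/funext => k; rewrite /a' indicE memNset ?mulr0//= => /(_ xN).
  rewrite (_ : (fun k => a' k x) = (fun k => a k x)); last first.
    by apply/funext => k; rewrite /a' indicE mem_set ?mulr1.
  by apply: contrapT => nc; apply: xN; apply: NE => /= /(_ tx).
pose h x := limn (fun k => a' k x).
have mh : mfun h.
  apply: (measurable_fun_cvg (h := a')) => [k|x tx]; last exact: fcos.
  apply: measurable_funM; first exact: ma.
  by apply: measurable_indic; exact: measurableC.
have ah : {ae leb2, forall x, torus x -> a n x @[n --> \oo] --> h x}.
  exists N; split => // x xh; apply: contrapT => xN; apply: xh => tx.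
  have := fcos x tx; rewrite /h (_ : (fun k => a' k x) = (fun k => a k x))//.
  by apply/funext => k; rewrite /a' indicE mem_set ?mulr1.
have main (e : R) : 0 < e -> exists N, forall n, (N <= n)%N ->
     L2 (g n - h) /\ L2dot (g n - h) (g n - h) <= e.
  move=> e0; have [M ME] := Cg e e0; exists M => n Mn.
  apply: (L2_fatou (a := fun m => g n - a (m + M)%N)).
  - by move=> m; apply: L2_mfun; exact: (L2B (Lg _) (Lg _)).
  - by apply: measurable_funB => //; exact: L2_mfun (Lg _).
  - apply: filterS ah => x axh tx; apply: cvgB; first exact: cvg_cst.
    have := axh tx; rewrite -(cvg_shiftn M) => //.
  - move=> m; split; first by case: (L2B (Lg n) (Lg (p (m + M)%N))).
    have -> : Rintegral leb2 torus (fun x => (g n - a (m + M)%N) x ^+ 2) =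
      L2dot (g n - a (m + M)%N) (g n - a (m + M)%N) by [].
    by apply: ME => //; apply: leq_trans (kp _); rewrite leq_addl.
exists h; split.
  have [M /(_ M (leqnn M))[LM _]] := main 1 ltr01.
  by have := L2B (Lg M) LM; rewrite opprB addrC subrK.
by move=> e /main[M ME]; exists M => n /ME[].
Qed.

End Completeness.

(** * Uniqueness of Fourier coefficients *)

Section ThresholdPolynomials.
Context {R : realType}.
Implicit Types (s t : R) (n m : nat).

Lemma bernoulli_ge t m : 0 <= t <= 1 -> 1 - m%:R * t <= (1 - t) ^+ m.
Proof.
move=> /andP[t0 t1]; elim: m => [|m ih]; first by rewrite mul0r subr0 expr0.
rewrite exprS; have := ler_wpM2l (_ : 0 <= 1 - t) ih; rewrite subr_ge0 => /(_ t1).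
apply: le_trans; rewrite -subr_ge0 -natr1.
have -> : (1 - t) * (1 - m%:R * t) - (1 - (m%:R + 1) * t) = m%:R * t ^+ 2 by ring.
by rewrite mulr_ge0// sqr_ge0.
Qed.

Lemma bernoulli_le t m : 0 <= t <= 1 -> (1 - t) ^+ m * (1 + m%:R * t) <= 1.
Proof.
move=> /andP[t0 t1]; elim: m => [|m ih]; first by rewrite mul0r addr0 expr0 mulr1.
have q0 : 0 <= (1 - t) ^+ m by rewrite exprn_ge0// subr_ge0.
apply: le_trans ih; rewrite exprS -natr1 -subr_ge0.
have -> : (1 - t) ^+ m * (1 + m%:R * t) - (1 - t) * (1 - t) ^+ m * (1 + (m%:R + 1) * t) =
  (1 - t) ^+ m * ((m%:R + 1) * t ^+ 2) by ring.
by rewrite mulr_ge0// mulr_ge0 ?sqr_ge0// addr_ge0.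
Qed.

(** The polynomials of the Brosowski-Deutsch proof of the Stone-Weierstrass theorem. The exponents
    are chosen so that [2 ^ n * s ^+ n = (2 s) ^+ n] tends to 0 or to infinity according to the side
    of 1/2 on which [s] lies. *)
Definition threshold n s := (1 - s ^+ n) ^+ (2 ^ n).

Lemma threshold_ge0_le1 n s : 0 <= s <= 1 -> 0 <= threshold n s <= 1.
Proof.
move=> /andP[s0 s1]; have sn1 : s ^+ n <= 1 by rewrite exprn_ile1.
have sn0 : 0 <= s ^+ n by rewrite exprn_ge0.
by rewrite /threshold exprn_ge0 ?subr_ge0//= exprn_ile1 ?subr_ge0// gerBl.
Qed.

(** Bernoulli's inequality gives [threshold n s >= 1 - (2 s) ^+ n], useful below 1/2; its companion
    gives [threshold n s <= (2 s) ^- n], useful above. *)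
Lemma threshold_cvg s : 0 <= s <= 1 -> s != 2^-1 ->
  threshold n s @[n --> \oo] --> ((s < 2^-1)%R%:R : R).
Proof.
move=> s01 s2; have /andP[s0 s1] := s01.
have sn01 n : 0 <= s ^+ n <= 1 by rewrite exprn_ge0//= exprn_ile1.
have [s_lt|s_gt|/eqP] := ltgtP s 2^-1; last by rewrite (negbTE s2).
- apply: (@squeeze_cvgr _ _ _ _ (fun n => 1 - (2 * s) ^+ n) (cst 1)).
  + apply: nearW => n; rewrite (proj2 (andP (threshold_ge0_le1 n s01))) andbT.
    by have := bernoulli_ge (2 ^ n) (sn01 n); rewrite natrX -exprMn.
  + rewrite -[X in _ --> X]subr0; apply: cvgB; first exact: cvg_cst.
    by apply: cvg_expr; rewrite ger0_norm ?mulr_ge0// mulrC -ltr_pdivlMr// mul1r.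
  + exact: cvg_cst.
- have s2p : 1 < 2 * s by rewrite mulrC -ltr_pdivrMr// mul1r.
  apply: (@squeeze_cvgr _ _ _ _ (cst 0) (fun n => ((2 * s)^-1) ^+ n)).
  + apply: nearW => n; rewrite (proj1 (andP (threshold_ge0_le1 n s01)))/=.
    have := bernoulli_le (2 ^ n) (sn01 n); rewrite natrX -exprMn -/(threshold n s) => le1.
    have p0 : 0 < (2 * s) ^+ n by rewrite exprn_gt0// (lt_trans _ s2p).
    rewrite exprVn -(ler_pM2r p0) mulVf ?gt_eqF//.
    apply: le_trans le1; rewrite ler_wpM2l ?lerDr//.
    by case/andP: (threshold_ge0_le1 n s01).
  + exact: cvg_cst.
  + apply: cvg_expr; rewrite ger0_norm ?invr_ge0 ?(ltW (lt_trans _ s2p))//.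
    by rewrite invf_lt1// (lt_trans _ s2p).
Qed.

(** On the circle the arc from 0 to [b] consists of the points at angular distance less than [b / 2]
    from its midpoint, and the cosine decreases with that distance. The witness [z] is the distance,
    taken in [0, pi]. *)
Lemma cos_lt_far (b y : R) : 0 < b < 2 * pi -> 0 < y < 2 * pi -> y != b ->
  (cos (b / 2) < cos (y - b / 2)) = (y < b) /\ cos (b / 2) != cos (y - b / 2).
Proof.
move=> /andP[b0 b2] /andP[y0 y2] yb; have pi0 := pi_gt0 R.
have hb : b / 2 \in `[0, pi] by rewrite in_itv/=; apply/andP; split; lra.
suff [z [zpi <- zb zb2]] : exists z, [/\ z \in `[0, pi], cos z = cos (y - b / 2),
    (z < b / 2) = (y < b) & z != b / 2].
  split; first by rewrite ltr_cos.
  by rewrite neq_lt !ltr_cos// -neq_lt.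
have [yb2|yb2] := leP y (b / 2).
  exists (b / 2 - y); split.
  - by rewrite in_itv/=; apply/andP; split; lra.
  - by rewrite -[LHS]cosN opprB.
  - by apply/idP/idP => _; lra.
  - by apply/eqP; lra.
have [yp|yp] := leP (y - b / 2) pi.
  exists (y - b / 2); split => //.
  - by rewrite in_itv/=; apply/andP; split; lra.
  - by apply/idP/idP => h; lra.
  - by apply: contra_neq yb; lra.
exists (2 * pi - (y - b / 2)); split.
- by rewrite in_itv/=; apply/andP; split; lra.
- by rewrite -[LHS]cosN opprB -[LHS]cosD2pi; congr cos; rewrite mulr2n; ring.
- by apply/idP/idP => h; lra.
- by apply/eqP; lra.
Qed.

End ThresholdPolynomials.

(** * Trigonometric polynomials, approximation of quadrants, and uniqueness *)

Section FourierUniqueness.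
Context {R : realType}.
Implicit Types (f g h psi phi p : R * R -> R) (j : 'I_2) (k l : int * int).
Notation leb2 := (@leb2 R).
Notation torus := (@torus R).
Notation integ f := (leb2.-integrable torus (EFin \o f)).
Notation R2 := (measurableTypeR R * measurableTypeR R)%type.
Notation mfun f := (measurable_fun (torus : set R2) f).

Lemma phaseD k l (x : R * R) : phase (k + l) x = phase k x + phase l x.
Proof. by rewrite /phase /= !rmorphD/=; ring. Qed.

Lemma phaseN k (x : R * R) : phase (- k) x = - phase k x.
Proof. by rewrite /phase /= !rmorphN/=; ring. Qed.

Lemma coskN k : cosk (- k) = cosk k :> (R * R -> R).
Proof. by apply/funext => x; rewrite /cosk phaseN cosN. Qed.

Lemma sinkN k : sink (- k) = - sink k :> (R * R -> R).
Proof. by apply/funext => x; rewrite /sink phaseN sinN. Qed.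

Lemma cosk0 : cosk 0 = (fun=> 1) :> (R * R -> R).
Proof. by apply/funext => x; rewrite /cosk /phase /= !mul0r addr0 cos0. Qed.

Lemma sink0 : sink 0 = (fun=> 0) :> (R * R -> R).
Proof. by apply/funext => x; rewrite /sink /phase /= !mul0r addr0 sin0. Qed.

Lemma cosk_mul_cosk k l :
  cosk k * cosk l = 2^-1 *: (cosk (k - l) + cosk (k + l)) :> (R * R -> R).
Proof.
apply/funext => x; rewrite !fctE /cosk phaseD phaseD phaseN cosB cosD.
by rewrite /GRing.scale/=; field.
Qed.

Lemma sink_mul_sink k l :
  sink k * sink l = 2^-1 *: (cosk (k - l) - cosk (k + l)) :> (R * R -> R).
Proof.
apply/funext => x; rewrite !fctE /cosk /sink phaseD phaseD phaseN cosB cosD.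
by rewrite /GRing.scale/=; field.
Qed.

Lemma sink_mul_cosk k l :
  sink k * cosk l = 2^-1 *: (sink (k - l) + sink (k + l)) :> (R * R -> R).
Proof.
apply/funext => x; rewrite !fctE /cosk /sink phaseD phaseD phaseN sinB sinD.
by rewrite /GRing.scale/=; field.
Qed.

(** Only linear closure is built in, so orthogonality to every mode passes to all trigonometric
    polynomials by induction; closure under products comes from the product-to-sum formulas. *)
Inductive trigpoly : (R * R -> R) -> Prop :=
| trigpoly_cosk k : trigpoly (cosk k)
| trigpoly_sink k : trigpoly (sink k)
| trigpolyD f g : trigpoly f -> trigpoly g -> trigpoly (f + g)
| trigpolyZ c f : trigpoly f -> trigpoly (c *: f).

Lemma trigpoly_cst c : trigpoly (fun=> c).
Proof.
rewrite (_ : (fun=> c) = c *: cosk 0 :> (R * R -> R)).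
  by apply: trigpolyZ; exact: trigpoly_cosk.
by apply/funext => x; rewrite cosk0 fctE /GRing.scale/= mulr1.
Qed.

Lemma scalefAl (c : R) f g : (c *: f) * g = c *: (f * g).
Proof. by apply/funext => x; rewrite /= !fctE /GRing.scale/= mulrA. Qed.

Lemma trigpolyM f g : trigpoly f -> trigpoly g -> trigpoly (f * g).
Proof.
have trigN h : trigpoly h -> trigpoly (- h) by rewrite -scaleN1r; exact: trigpolyZ.
move=> tf; elim: tf g => [k|k|f1 f2 _ ih1 _ ih2|c f1 _ ih1] g tg.
- elim: tg => [l|l|g1 g2 _ ih1 _ ih2|c g1 _ ih1].
  + rewrite cosk_mul_cosk; do !constructor.
  + rewrite mulrC sink_mul_cosk; do !constructor.
  + by rewrite mulrDr; exact: trigpolyD.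
  + by rewrite mulrC scalefAl mulrC; exact: trigpolyZ.
- elim: tg => [l|l|g1 g2 _ ih1 _ ih2|c g1 _ ih1].
  + rewrite sink_mul_cosk; do !constructor.
  + rewrite sink_mul_sink; constructor; apply: trigpolyD; first by constructor.
    by apply: trigN; constructor.
  + by rewrite mulrDr; exact: trigpolyD.
  + by rewrite mulrC scalefAl mulrC; exact: trigpolyZ.
- by rewrite mulrDl; apply: trigpolyD; [exact: ih1|exact: ih2].
- by rewrite scalefAl; apply: trigpolyZ; exact: ih1.
Qed.

Lemma trigpolyX f n : trigpoly f -> trigpoly (f ^+ n).
Proof.
move=> tf; elim: n => [|n ih]; first by rewrite expr0; exact: trigpoly_cst.
by rewrite exprS; exact: trigpolyM.
Qed.

Lemma trigpoly_test f : trigpoly f -> test f.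
Proof.
elim=> [k|k|f1 f2 _ ? _ ?|c f1 _ ?].
- exact: (test_cosk_sink k).1.
- exact: (test_cosk_sink k).2.
- exact: testD.
- exact: testZ.
Qed.

Definition coord j (x : R * R) : R := if j == ord0 then x.1 else x.2.
Definition unit_wave j : int * int := if j == ord0 then (1, 0) else (0, 1).

Lemma phase_unit_wave j (x : R * R) : phase (unit_wave j) x = coord j x.
Proof. by rewrite /unit_wave /phase /coord; case: ifP => _ /=; ring. Qed.

Lemma coord_torus j (x : R * R) : torus x -> 0 <= coord j x <= 2 * pi.
Proof. by rewrite /coord; case: x => x1 x2 [/= + +]; rewrite !in_itv/=; case: ifP. Qed.

(** For [b] strictly between 0 and [2 pi], the excluded lines are those where [s = 1/2] below; there
    [threshold] tends to 1/e instead of 0 or 1. *)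
Lemma trigpoly_halfspace (b : R) j : exists p : nat -> R * R -> R,
  [/\ forall n, trigpoly (p n), forall n x, `|p n x| <= 1 &
   forall x, torus x -> coord j x != 0 -> coord j x != b -> coord j x != 2 * pi ->
     p n x @[n --> \oo] --> ((coord j x < b)%R%:R : R)].
Proof.
have [b0|b0] := leP b 0.
  exists (fun _ _ => 0); split => [n|n x|x /(coord_torus j) /andP[x0 _] _ _ _].
  - exact: trigpoly_cst.
  - by rewrite normr0.
  - by rewrite ltNge (le_trans b0)//=; exact: cvg_cst.
have [b2|b2] := leP (2 * pi) b.
  exists (fun _ _ => 1); split => [n|n x|x /(coord_torus j) /andP[_ x2] _ xb _].
  - exact: trigpoly_cst.
  - by rewrite normr1.
  - by rewrite lt_neqAle xb (le_trans x2)//=; exact: cvg_cst.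
(* An affine image of [cos (coord j x - b / 2)], scaled to take values in [0, 1] and to be below 1/2
   exactly on the arc. *)
pose s : R * R -> R := fun x => 2^-1 + (cos (b / 2) - cos (coord j x - b / 2)) / 4.
have s01 x : 0 <= s x <= 1.
  have := cos_geN1 (b / 2); have := cos_le1 (b / 2).
  have := cos_geN1 (coord j x - b / 2); have := cos_le1 (coord j x - b / 2).
  by rewrite /s => ? ? ? ?; apply/andP; split; lra.
have ts : trigpoly s.
  have -> : s = (fun=> 2^-1 + cos (b / 2) / 4) +
    ((- cos (b / 2) / 4) *: cosk (unit_wave j) + (- sin (b / 2) / 4) *: sink (unit_wave j)).
    apply/funext => x; rewrite !fctE /s cosB /cosk /sink phase_unit_wave /GRing.scale/=.
    by field.
  apply: trigpolyD; first exact: trigpoly_cst.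
  by apply: trigpolyD; constructor; constructor.
exists (fun n x => threshold n (s x)); split => [n|n x|x tx x0 xb x2].
- have -> : (fun x => threshold n (s x)) = ((fun=> 1) + (-1) *: s ^+ n) ^+ (2 ^ n).
    apply/funext => x; rewrite !fctE /threshold; congr (_ ^+ _).
    by rewrite /GRing.scale/= mulN1r.
  apply: trigpolyX; apply: trigpolyD; first exact: trigpoly_cst.
  by constructor; exact: trigpolyX.
- have /andP[? ?] := threshold_ge0_le1 n (s01 x).
  by rewrite ger0_norm.
- have /andP[y0 y2] := coord_torus j tx.
  have y0' : 0 < coord j x < 2 * pi by rewrite !lt_neqAle y0 y2 x2 eq_sym x0.
  have b02 : 0 < b < 2 * pi by rewrite b0 b2.
  have [far ne] := cos_lt_far b02 y0' xb.
  have -> : (coord j x < b) = (s x < 2^-1).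
    by rewrite -far /s; apply/idP/idP => h; lra.
  apply: threshold_cvg => //; apply: contra_neq ne; rewrite /s; lra.
Qed.

Lemma coord_null j (c : R) : {ae leb2, forall x : R * R, coord j x != c}.
Proof.
exists (if j == ord0 then [set c] `*` setT else setT `*` [set c]); split.
- by case: ifP => _; apply: measurableX.
- have prod0 (X Y : set R) : measurable X -> measurable Y ->
    leb2 (X `*` Y) = (lebesgue_measure (X : set (measurableTypeR R))
      * lebesgue_measure (Y : set (measurableTypeR R)))%E.
    exact: (@product_measure1E _ _ _ _ R lebesgue_measure lebesgue_measure).
  by case: ifP => _; rewrite prod0// lebesgue_measure_set1 ?mul0e ?mule0.
- move=> x /= /negP; rewrite negbK => /eqP xc; move: xc; rewrite /coord.
  by case: ifP => _ xc; split.
Qed.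

Lemma trigpoly_orth g p : L2 g ->
  (forall k, L2dot g (cosk k) = 0 /\ L2dot g (sink k) = 0) ->
  trigpoly p -> L2dot g p = 0.
Proof.
move=> Lg g0; elim=> [k|k|f1 f2 t1 e1 t2 e2|c f1 t1 e1].
- exact: (g0 k).1.
- exact: (g0 k).2.
- by rewrite L2dotDr ?e1 ?e2 ?addr0//; exact/test_L2/trigpoly_test.
- by rewrite L2dotZr ?e1 ?mulr0//; exact/test_L2/trigpoly_test.
Qed.

Definition quadrant (b c : R) : set R2 := `]-oo, b[ `*` `]-oo, c[.

(** Half-planes are increasing unions of quadrants, so quadrants make both coordinates
    measurable. *)
Lemma measurable_quadrants :
  @measurable _ R2 = <<s [set quadrant b.1 b.2 | b in [set: R * R]] >>.
Proof.
apply/seteqP; split; last first.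
  apply: smallest_sub; first exact: sigma_algebra_measurable.
  by move=> _ [b _ <-]; apply: measurableX; exact: measurable_itv.
have covfst : measurable_fun setT (fst : g_sigma_algebraType [set quadrant b.1 b.2 | b in
  [set: R * R]] -> measurableTypeR R).
  apply: (measurability _ (RGenInftyO.measurableE R)) => _ [_ [b ->] <-].
  rewrite setTI (_ : _ @^-1` _ = \bigcup_n quadrant b n%:R).
    apply: bigcupT_measurable => n; apply: sub_sigma_algebra.
    by exists (b, n%:R).
  apply/seteqP; split => [x /= xb|x [n _ []]//].
  exists (Num.bound `|x.2|) => //; split => //=.
  by rewrite in_itv/= (le_lt_trans (ler_norm _))// archi_boundP.
have covsnd : measurable_fun setT (snd : g_sigma_algebraType [set quadrant b.1 b.2 | b in
  [set: R * R]] -> measurableTypeR R).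
  apply: (measurability _ (RGenInftyO.measurableE R)) => _ [_ [b ->] <-].
  rewrite setTI (_ : _ @^-1` _ = \bigcup_n quadrant n%:R b).
    apply: bigcupT_measurable => n; apply: sub_sigma_algebra.
    by exists (n%:R, b).
  apply/seteqP; split => [x /= xb|x [n _ []]//].
  exists (Num.bound `|x.1|) => //; split => //=.
  by rewrite in_itv/= (le_lt_trans (ler_norm _))// archi_boundP.
apply: smallest_sub; first exact: smallest_sigma_algebra.
move=> X [[A mA <-]|[A mA <-]].
- exact: covfst.
- exact: covsnd.
Qed.

(** The product of the approximants in the two coordinates is a trigonometric polynomial bounded by
    1. Its integral against [g] is 0, and dominated convergence with majorant [|g|] passes to the
    indicator. *)
Lemma integral_quadrant0 g b c : L2 g ->
  (forall k, L2dot g (cosk k) = 0 /\ L2dot g (sink k) = 0) ->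
  (\int[leb2]_(x in torus `&` quadrant b c) (g x)%:E = 0)%E.
Proof.
move=> Lg g0.
have [p [tp p1 pb]] := trigpoly_halfspace b ord0.
have [q [tq q1 qc]] := trigpoly_halfspace c ord_max.
have tpq n := trigpolyM (tp n) (tq n).
have Lpq n := test_L2 (trigpoly_test (tpq n)).
have ig : integ g.
  by have := L2M Lg (L2_cst 1); apply: eq_integrable => // x _ /=; rewrite mulr1.
pose F n x := (g x * (p n * q n) x)%:E.
rewrite integral_mkcondr.
have mF n : measurable_fun torus (F n).
  apply/measurable_EFinP; apply: measurable_funM; first exact: L2_mfun.
  exact: L2_mfun (Lpq n).
have [||||_ _] := @dominated_convergence _ _ _ leb2 torus measurable_torus F
   ((EFin \o g) \_ (quadrant b c)) (fun x => `|g x|%:E) mF.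
- have mQ : measurable (quadrant b c) by apply: measurableX; exact: measurable_itv.
  apply/(measurable_restrict _ mQ measurable_torus).
  by apply/measurable_EFinP; apply: measurable_funS (L2_mfun Lg) => //; exact: subIsetl.
- have nb j (d : R) : {ae leb2, forall x : R * R, [/\ coord j x != 0,
    coord j x != d & coord j x != 2 * pi]}.
    by apply: filterS3 (coord_null j 0) (coord_null j d) (coord_null j (2 * pi)).
  apply: filterS2 (nb ord0 b) (nb ord_max c) => x [x0 xb xp] [y0 yc yp] tx.
  have -> : ((EFin \o g) \_ (quadrant b c)) x =
      (g x * ((coord ord0 x < b)%R%:R * (coord ord_max x < c)%R%:R))%:E.
    rewrite patchE /quadrant /coord/=; case: ifPn => [|/negP].
      by rewrite inE => -[/=]; rewrite !in_itv/= => -> ->; rewrite !mulr1.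
    rewrite inE => /= /not_andP; rewrite !in_itv/= => -[] /negP/negbTE ->;
      by rewrite ?mul0r ?mulr0 ?mulr0.
  apply: cvg_EFin; first exact: nearW.
  apply: cvgM; first exact: cvg_cst.
  by apply: cvgM; [exact: pb|exact: qc].
- exact: integrable_norm.
- apply: aeW => x n tx; rewrite /F lee_fin normrM ler_piMr// normrM -[leRHS]mulr1.
  by rewrite ler_pM.
- move=> /cvg_lim <- //; rewrite (_ : [sequence _]_n = cst 0%E) ?lim_cst//.
  apply/funext => n /=; have := trigpoly_orth Lg g0 (tpq n).
  rewrite /L2dot /Rintegral => e0; rewrite -[LHS]fineK ?e0//.
  exact: (integrable_fin_num measurable_torus (L2M Lg (Lpq n))).
Qed.

(* Indicators of quadrants are bounded a.e. limits of trigonometric polynomials,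
   and quadrants form a pi-system generating the Borel sets. *)
Theorem fourier_coefs_eq0 g : L2 g ->
  (forall k, L2dot g (cosk k) = 0 /\ L2dot g (sink k) = 0) ->
  {ae leb2, forall x, torus x -> g x = 0}.
Proof.
move=> Lg g0.
have ig : integ g.
  by have := L2M Lg (L2_cst 1); apply: eq_integrable => // x _ /=; rewrite mulr1.
have igI (E : set R2) : measurable E -> leb2.-integrable (torus `&` E) (EFin \o g).
  by move=> mE; apply: integrableS ig => //; exact: measurableI.
pose P (E : set R2) := (\int[leb2]_(x in torus `&` E) (g x)%:E = 0)%E.
have PT : P setT.
  rewrite /P setIT -[LHS]fineK; last exact: integrable_fin_num.
  have [+ _] := g0 0; rewrite cosk0 /L2dot /Rintegral => e0; congr EFin; rewrite -[RHS]e0.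
  by congr fine; apply: eq_integral => x _; rewrite mulr1.
have PE E : measurable E -> P E.
  move=> mE; have := mE; rewrite measurable_quadrants.
  apply: (dynkin_induction measurable_quadrants) => //.
  - move=> _ _ [[a b] _ <-] [[c d] _ <-]; exists (Num.min a c, Num.min b d) => //=.
    apply/seteqP; split => [x [/= ]|x [[/= + +] [/= + +]]]; rewrite !in_itv/= ?lt_min.
      by move=> /andP[? ?] /andP[? ?]; split; split => /=; rewrite in_itv.
    by move=> ? ? ? ?; split => /=; rewrite in_itv/= lt_min; apply/andP.
  - by move=> _ [b _ <-]; exact: integral_quadrant0.
  - move=> S mS PS; have := PT; rewrite /P setIT.
    have eT : torus = (torus `&` S) `|` (torus `&` ~` S) by rewrite -setDE setUIDK.
    rewrite {1}eT integral_setU_EFin ?PS ?add0e//.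
    + exact: measurableI.
    + by apply: measurableI => //; exact: measurableC.
    + by rewrite -eT; exact: L2_mfun.
    + by apply/disj_setPS => x [[_ ?] [_ ?]].
  - move=> F mF tF PF; rewrite /P setI_bigcupr integral_bigcup.
    + by apply: eseries0 => n _ _; exact: PF.
    + exact: trivIset_setIl.
    + by move=> n; exact: measurableI.
    + by rewrite -setI_bigcupr; apply: igI; exact: bigcupT_measurable.
have := @integral_ae_eq _ _ _ leb2 torus measurable_torus (cst 0%E) (EFin \o g) ig.
move=> h; apply: filterS (h _ _) => [x /[apply]/= [[]]//||E Et mE].
- exact: measurable_cst.
- by rewrite integral0; have := PE E mE; rewrite /P setIidr.
Qed.

End FourierUniqueness.

(** * Parseval's identity *)

Section Parseval.
Context {R : realType}.
Implicit Types (f g h psi phi : R * R -> R) (j : 'I_2) (k l : int * int) (c s : int * int -> R).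
Notation leb2 := (@leb2 R).
Notation torus := (@torus R).

Lemma L2_cosk k : L2 (cosk k : R * R -> R).
Proof. exact: test_L2 (test_cosk_sink k).1. Qed.

Lemma L2_sink k : L2 (sink k : R * R -> R).
Proof. exact: test_L2 (test_cosk_sink k).2. Qed.
Hint Resolve L2_cosk L2_sink : core.

Lemma L2dot1 g : L2dot g (fun=> 1) = Rintegral leb2 torus g.
Proof. by rewrite /L2dot; congr Rintegral; apply/funext => x; rewrite mulr1. Qed.

Lemma Rintegral_mul f g : Rintegral leb2 torus (f * g) = L2dot f g.
Proof. by []. Qed.

Lemma wn_neq0 k : k != 0 -> exists j, (wn j k : R) != 0.
Proof.
case: k => a b; rewrite xpair_eqE negb_and => /orP[a0|b0].
  by exists ord0; rewrite /wn eqxx/= intr_eq0.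
by exists ord_max; rewrite /wn/= intr_eq0.
Qed.

(** For [k <> 0] some component of [k] is non-zero, so [cosk k] is a multiple of a derivative of
    [sink k], whose integral vanishes by periodicity. *)
Lemma Rintegral_cosk k :
  Rintegral leb2 torus (cosk k) = (k == 0)%:R * (4 * pi ^+ 2).
Proof.
have [->|k0] := eqVneq k 0.
  by rewrite cosk0 (Rintegral_cst _ measurable_torus) leb2_torus.
have [j kj] := wn_neq0 k0; rewrite mul0r.
have : Rintegral leb2 torus (wn j k *: cosk k) = 0.
  rewrite -(Rintegral_derive_test j (test_cosk_sink k).2); congr Rintegral.
  by apply/funext => x; have [_ ->] := is_derive_sink k j x.
rewrite -L2dot1 L2dotZl//; last exact: L2_cst.
by move/eqP; rewrite mulf_eq0 (negbTE kj)/= L2dot1 => /eqP.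
Qed.

Lemma Rintegral_sink k : Rintegral leb2 torus (sink k) = 0.
Proof.
have [->|k0] := eqVneq k 0.
  by rewrite sink0 (Rintegral_cst _ measurable_torus) mul0r.
have [j kj] := wn_neq0 k0.
have : Rintegral leb2 torus (- wn j k *: sink k) = 0.
  rewrite -(Rintegral_derive_test j (test_cosk_sink k).1); congr Rintegral.
  by apply/funext => x; have [_ ->] := is_derive_cosk k j x.
rewrite -L2dot1 L2dotZl//; last exact: L2_cst.
by move/eqP; rewrite mulf_eq0 oppr_eq0 (negbTE kj)/= L2dot1 => /eqP.
Qed.

Lemma L2dot_half f g h : L2 f -> L2 g -> f * g = 2^-1 *: h -> L2 h ->
  L2dot f g = 2^-1 * Rintegral leb2 torus h.
Proof.
by move=> Lf Lg e Lh; rewrite -Rintegral_mul e -L2dot1 L2dotZl ?L2dot1//; exact: L2_cst.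
Qed.

(** At [k = l = 0] both indicators count, which gives the doubled value [4 * pi ^+ 2], the area of
    the square. *)
Lemma L2dot_cosk k l :
  L2dot (cosk k) (cosk l) = 2 * pi ^+ 2 * ((k == l)%:R + (k == - l)%:R) :> R.
Proof.
rewrite (L2dot_half _ _ (cosk_mul_cosk k l))//; last exact: L2D.
rewrite -L2dot1 L2dotDl//; last exact: L2_cst.
rewrite !L2dot1 !Rintegral_cosk subr_eq0 addr_eq0; by field.
Qed.

Lemma L2dot_sink k l :
  L2dot (sink k) (sink l) = 2 * pi ^+ 2 * ((k == l)%:R - (k == - l)%:R) :> R.
Proof.
rewrite (L2dot_half _ _ (sink_mul_sink k l))//; last exact: L2B.
rewrite -L2dot1 L2dotBl//; last exact: L2_cst.
rewrite !L2dot1 !Rintegral_cosk subr_eq0 addr_eq0; by field.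
Qed.

Lemma L2dot_sink_cosk k l : L2dot (sink k) (cosk l) = 0 :> R.
Proof.
rewrite (L2dot_half _ _ (sink_mul_cosk k l))//; last exact: L2D.
rewrite -L2dot1 L2dotDl//; last exact: L2_cst.
by rewrite !L2dot1 !Rintegral_sink addr0 mulr0.
Qed.

Definition ints n : seq int := [seq i%:Z - n%:Z | i <- iota 0 (n.*2.+1)].
Definition box n : seq (int * int) := [seq (a, b) | a <- ints n, b <- ints n].

Lemma mem_ints n (a : int) : (a \in ints n) = (`|a| <= n)%N.
Proof.
apply/mapP/idP => [[i + ->]|an]; first by rewrite mem_iota; lia.
by exists (absz (a + n%:Z)%R); rewrite ?mem_iota; lia.
Qed.

Lemma mem_box n k : (k \in box n) = (`|k.1| <= n)%N && (`|k.2| <= n)%N.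
Proof.
case: k => a b; rewrite -!mem_ints/=;
  apply/allpairsP/andP => [[[a' b'] [? ? [-> ->]]]//|[an bn]].
by exists (a, b).
Qed.

Lemma box_uniq n : uniq (box n).
Proof.
have u : uniq (ints n) by rewrite map_inj_uniq ?iota_uniq// => x y; lia.
by apply: allpairs_uniq => // -[a b] [a' b'].
Qed.

Lemma boxN n k : (- k \in box n) = (k \in box n).
Proof. by rewrite !mem_box/= !abszN. Qed.

Lemma box_mono m n k : (m <= n)%N -> k \in box m -> k \in box n.
Proof. by rewrite !mem_box => mn /andP[? ?]; rewrite !(leq_trans _ mn). Qed.

Lemma big_box_delta n (F : int * int -> R) l :
  \sum_(k <- box n) F k * (k == l)%:R = (l \in box n)%:R * F l.
Proof.
have [ln|ln] := boolP (l \in box n).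
  rewrite (bigD1_seq l ln (box_uniq n)) eqxx mulr1 mul1r big1 => [|k /negbTE ->];
    first exact: addr0.
  exact: mulr0.
rewrite mul0r big_seq big1// => k kn; case: eqP => [kl|_]; last by rewrite mulr0.
by move: ln; rewrite -kl kn.
Qed.

(** The parity of the coefficients of a real function; for the complex numbers [c k - i s k] it says
    that opposite modes are conjugate. *)
Definition hermitian c s := forall k, c (- k) = c k /\ s (- k) = - s k.

(* The sum runs over all of Z^2, so every mode occurs twice, as [k] and as [-k];
   for [hermitian] coefficients the weight 1/(4 pi^2) compensates for this. *)
Definition trunc c s n : R * R -> R :=
  (4 * pi ^+ 2)^-1 *: \sum_(k <- box n) (c k *: cosk k + s k *: sink k).

Definition boxsum n (x : int * int -> R) : R := (4 * pi ^+ 2)^-1 * \sum_(k <- box n) x k.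

Lemma trunc_test c s n : test (trunc c s n).
Proof.
apply: testZ; apply: test_sum => k _.
by apply: testD; apply: testZ; [exact: (test_cosk_sink k).1|exact: (test_cosk_sink k).2].
Qed.

Lemma L2_trunc c s n : L2 (trunc c s n).
Proof. exact/test_L2/trunc_test. Qed.
Hint Resolve L2_trunc : core.

Lemma L2dot_trunc c s n h : L2 h ->
  L2dot (trunc c s n) h = boxsum n (fun k => c k * L2dot h (cosk k) + s k * L2dot h (sink k)).
Proof.
move=> Lh; have Lk k : L2 (c k *: cosk k + s k *: sink k) by apply: L2D; exact: L2Z.
rewrite L2dotZl//; last exact: L2_sum.
rewrite L2dot_suml//; congr (_ * _); apply: eq_bigr => k _.
by rewrite L2dotDl ?L2dotZl ?(L2dotC h)//; exact: L2Z.
Qed.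

Lemma trunc_cosk c s n l : hermitian c s ->
  L2dot (trunc c s n) (cosk l) = (l \in box n)%:R * c l.
Proof.
move=> hcs; rewrite L2dot_trunc// /boxsum.
under eq_bigr => k _ do rewrite (L2dotC _ (sink k)) L2dot_sink_cosk mulr0 addr0
  L2dotC L2dot_cosk mulrCA mulrDr.
rewrite -mulr_sumr big_split/= !big_box_delta boxN (hcs l).1.
by move: (@pi_gt0 R); generalize (@pi R) => p p0; field; rewrite gt_eqF.
Qed.

Lemma trunc_sink c s n l : hermitian c s ->
  L2dot (trunc c s n) (sink l) = (l \in box n)%:R * s l.
Proof.
move=> hcs; rewrite L2dot_trunc// /boxsum.
under eq_bigr => k _ do rewrite L2dot_sink_cosk mulr0 add0r
  (L2dotC _ (sink k)) L2dot_sink mulrCA mulrBr.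
rewrite -mulr_sumr sumrB/= !big_box_delta boxN (hcs l).2.
by move: (@pi_gt0 R); generalize (@pi R) => p p0; field; rewrite gt_eqF.
Qed.

Lemma L2dot_trunc_trunc c s m n : hermitian c s -> (n <= m)%N ->
  L2dot (trunc c s n) (trunc c s m) = boxsum n (fun k => c k ^+ 2 + s k ^+ 2).
Proof.
move=> hcs nm; rewrite L2dot_trunc//; congr (_ * _).
rewrite big_seq [RHS]big_seq; apply: eq_bigr => k kn.
by rewrite trunc_cosk// trunc_sink// (box_mono nm kn) !mul1r.
Qed.

Lemma trunc_diff c s m n : hermitian c s -> (n <= m)%N ->
  L2dot (trunc c s m - trunc c s n) (trunc c s m - trunc c s n) =
  boxsum m (fun k => c k ^+ 2 + s k ^+ 2) - boxsum n (fun k => c k ^+ 2 + s k ^+ 2).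
Proof.
move=> hcs nm; have LB := L2B (L2_trunc c s m) (L2_trunc c s n).
rewrite L2dotBl// !L2dotBr// (L2dotC (trunc c s m) (trunc c s n)).
by rewrite !L2dot_trunc_trunc//; ring.
Qed.

Lemma L2_cvg_dot (u : nat -> R * R -> R) g h : (forall n, L2 (u n)) -> L2 g -> L2 h ->
  (forall e : R, 0 < e -> exists N, forall n, (N <= n)%N -> L2dot (u n - g) (u n - g) <= e) ->
  L2dot (u n) h @[n --> \oo] --> L2dot g h.
Proof.
move=> Lu Lg Lh ug; apply/cvgrPdist_le => /= e e0.
(* The added 1 avoids a division by zero when [h] vanishes. *)
set H := L2dot h h + 1; have H0 : 0 < H by rewrite ltr_wpDl// L2dot_ge0.
have [N uN] := ug (e ^+ 2 / H) (divr_gt0 (exprn_gt0 _ e0) H0).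
exists N => // n /= Nn; rewrite distrC -L2dotBl// -(@ler_pXn2r _ 2) ?nnegrE ?(ltW e0)//.
rewrite real_normK ?num_real//.
apply: le_trans (L2dot_CS (L2B (Lu n) Lg) Lh) _.
apply: (@le_trans _ _ (e ^+ 2 / H * H)); last by rewrite divfK// gt_eqF.
by apply: ler_pM => //; rewrite ?L2dot_ge0 ?uN// lerDl.
Qed.

(** The energies of the truncations increase and are bounded, so the truncations are Cauchy in L^2.
    The coefficient at [k] is constant along the truncations once the box contains [k], hence
    survives in the limit. *)
Theorem riesz_fischer c s (M : R) : hermitian c s ->
  (forall n, boxsum n (fun k => c k ^+ 2 + s k ^+ 2) <= M) ->
  exists g, [/\ L2 g, forall k, L2dot g (cosk k) = c k /\ L2dot g (sink k) = s k &
    forall e : R, 0 < e -> exists N, forall n, (N <= n)%N ->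
      L2dot (trunc c s n - g) (trunc c s n - g) <= e].
Proof.
move=> hcs eM; set en := fun n => boxsum n (fun k => c k ^+ 2 + s k ^+ 2).
have en_mono m n : (m <= n)%N -> en m <= en n.
  by move=> mn; rewrite -subr_ge0 -trunc_diff// L2dot_ge0.
have cen : cvgn en.
  apply: nondecreasing_is_cvgn; first by move=> m n /en_mono.
  by exists M => _ [n _ <-]; exact: eM.
have cauchy (e : R) : 0 < e -> exists N, forall m n, (N <= m)%N -> (N <= n)%N ->
     L2dot (trunc c s m - trunc c s n) (trunc c s m - trunc c s n) <= e.
  move=> e0; have /cvgrPdist_lt /(_ _ e0)[N _ Ne] := cen.
  have up n : en n <= limn en by apply: nondecreasing_cvgn_le => //; move=> a b /en_mono.
  have sym m n : L2dot (trunc c s m - trunc c s n) (trunc c s m - trunc c s n) =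
      L2dot (trunc c s n - trunc c s m) (trunc c s n - trunc c s m).
    have LB := L2B (L2_trunc c s n) (L2_trunc c s m).
    by rewrite -[trunc c s m - _]opprB (L2dotNl LB (L2N LB)) (L2dotNr LB LB) opprK.
  have half m n : (N <= m)%N -> (m <= n)%N ->
    L2dot (trunc c s n - trunc c s m) (trunc c s n - trunc c s m) <= e.
    move=> Nm mn; rewrite trunc_diff// -/(en n) -/(en m).
    have := Ne m Nm; rewrite ger0_norm ?subr_ge0 ?up// => /ltW; apply: le_trans.
    by rewrite lerD2r up.
  exists N => m n Nm Nn; have [mn|/ltnW nm] := leqP m n; last exact: half.
  by rewrite sym; exact: half.
have [g [Lg gT]] := L2_complete (L2_trunc c s) cauchy.
exists g; split => // k; split.
- have /cvg_lim <- // := L2_cvg_dot (L2_trunc c s) Lg (L2_cosk k) gT.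
  apply/cvg_lim => //; apply: cvg_near_cst.
  exists (maxn `|k.1| `|k.2|) => // n /= kn; rewrite trunc_cosk// mem_box.
  by rewrite -geq_max kn mul1r.
- have /cvg_lim <- // := L2_cvg_dot (L2_trunc c s) Lg (L2_sink k) gT.
  apply/cvg_lim => //; apply: cvg_near_cst.
  exists (maxn `|k.1| `|k.2|) => // n /= kn; rewrite trunc_sink// mem_box.
  by rewrite -geq_max kn mul1r.
Qed.

End Parseval.

#[local] Hint Resolve L2_cosk L2_sink L2_trunc : core.

(** * Parseval's identity, sums over modes, and coefficients of weak derivatives *)

Section ParsevalIdentity.
Context {R : realType}.
Implicit Types (f g h psi phi : R * R ->
  R) (j : 'I_2) (k l : int * int) (c s x y : int * int -> R).
Implicit Types (X Y a : R).
Notation leb2 := (@leb2 R).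
Notation torus := (@torus R).

Definition fcos g k : R := L2dot g (cosk k).
Definition fsin g k : R := L2dot g (sink k).
Definition partial g n := trunc (fcos g) (fsin g) n.

Lemma L2_partial g n : L2 (partial g n). Proof. exact: L2_trunc. Qed.
Hint Resolve L2_partial : core.

Lemma coefs_hermitian g : L2 g -> hermitian (fcos g) (fsin g).
Proof. by move=> Lg k; rewrite /fcos /fsin coskN sinkN L2dotNr. Qed.

Lemma bessel g n : L2 g -> boxsum n (fun k => fcos g k ^+ 2 + fsin g k ^+ 2) <= L2dot g g.
Proof.
move=> Lg; have := L2dot_ge0 (g - partial g n).
rewrite L2dotBl// ?L2dotBr//; last exact: L2B.
rewrite (L2dotC g) L2dot_trunc_trunc//; last exact: coefs_hermitian.
rewrite L2dot_trunc// -/(fcos g _)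
  (_ : boxsum n _ = boxsum n (fun k => fcos g k ^+ 2 + fsin g k ^+ 2)); last first.
  by congr (_ * _); apply: eq_bigr => k _; rewrite -!expr2.
by rewrite subrr subr0 subr_ge0.
Qed.

(** Bessel's inequality provides a Riesz-Fischer limit with the coefficients of [g]; by uniqueness
    of coefficients it is [g] almost everywhere. *)
Lemma partial_cvg g : L2 g -> forall e : R, 0 < e -> exists N, forall n, (N <= n)%N ->
  L2dot (partial g n - g) (partial g n - g) <= e.
Proof.
move=> Lg; have hg := coefs_hermitian Lg.
have [g' [Lg' cg' Tg']] := riesz_fischer hg (fun n => bessel n Lg).
have gg' : {ae leb2, forall z, torus z -> (g' - g) z = 0}.
  apply: fourier_coefs_eq0; first exact: L2B.
  by move=> k; rewrite !L2dotBl// (cg' k).1 (cg' k).2 !subrr.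
move=> e /Tg'[N NE]; exists N => n /NE; apply: le_trans.
have Lp := L2_partial g n.
have L1 := L2B Lp Lg; have L2' := L2B Lp Lg'.
have ae : {ae leb2, forall z, torus z -> (partial g n - g) z = (partial g n - g') z}.
  apply: filterS gg' => x g'g tx; have /eqP := g'g tx.
  by rewrite !fctE subr_eq0 => /eqP ->.
by rewrite (L2dot_aeeq L1 L2' L1 ae) L2dotC (L2dot_aeeq L1 L2' L2' ae).
Qed.

(* [X] is the normalised sum of [x] over Z^2, as a limit over boxes. *)
Definition has_boxsum X x := boxsum n x @[n --> \oo] --> X.

Lemma parseval g h : L2 g -> L2 h ->
  has_boxsum (L2dot g h) (fun k => fcos g k * fcos h k + fsin g k * fsin h k).
Proof.
move=> Lg Lh; rewrite /has_boxsum.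
rewrite (_ : (fun n => _) = (fun n => L2dot (partial g n) h)).
  by apply: L2_cvg_dot => //; exact: partial_cvg.
by apply/funext => n; rewrite L2dot_trunc.
Qed.

Lemma eq_has_boxsum x y X : (forall k, x k = y k) -> has_boxsum X x -> has_boxsum X y.
Proof. by move=> xy; rewrite (_ : x = y)//; apply/funext. Qed.

Lemma has_boxsumD X Y x y : has_boxsum X x -> has_boxsum Y y ->
  has_boxsum (X + Y) (fun k => x k + y k).
Proof.
move=> Xx Yy; rewrite /has_boxsum (_ : (fun n => _) = (fun n => boxsum n x + boxsum n y)).
  exact: cvgD.
by apply/funext => n; rewrite /boxsum -mulrDr -big_split.
Qed.

Lemma has_boxsumZ a X x : has_boxsum X x -> has_boxsum (a * X) (fun k => a * x k).
Proof.
move=> Xx; rewrite /has_boxsum (_ : (fun n => _) = (fun n => a * boxsum n x)).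
  by apply: cvgMl_tmp; exact: Xx.
by apply/funext => n; rewrite /boxsum -mulr_sumr mulrCA.
Qed.

Lemma has_boxsum0 : has_boxsum 0 (fun=> 0).
Proof.
rewrite /has_boxsum (_ : (fun n => _) = cst 0); first exact: cvg_cst.
by apply/funext => n; rewrite /boxsum big1 ?mulr0.
Qed.

Lemma has_boxsum_sum (I : Type) (r : seq I) (P : pred I) (X : I -> R) (x : I -> int * int ->
  R) :
  (forall i, P i -> has_boxsum (X i) (x i)) ->
  has_boxsum (\sum_(i <- r | P i) X i) (fun k => \sum_(i <- r | P i) x i k).
Proof.
move=> H; elim: r => [|i r ih].
  by rewrite big_nil; apply: eq_has_boxsum has_boxsum0 => k; rewrite big_nil.
rewrite big_cons; case: ifPn => Pi.
  by apply: eq_has_boxsum (has_boxsumD (H i Pi) ih) => k; rewrite big_cons Pi.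
by apply: eq_has_boxsum ih => k; rewrite big_cons (negbTE Pi).
Qed.

Lemma has_boxsum_ge0 X x : has_boxsum X x -> (forall k, 0 <= x k) -> 0 <= X.
Proof.
move=> Xx x0; have /cvg_lim <- // := Xx; apply: limr_ge; first by apply/cvg_ex; exists X.
apply: nearW => n; apply: mulr_ge0; last exact: sumr_ge0.
by rewrite invr_ge0 mulr_ge0// sqr_ge0.
Qed.

Lemma has_boxsum_le X Y x y : has_boxsum X x -> has_boxsum Y y -> (forall k,
  x k <= y k) -> X <= Y.
Proof.
move=> Xx Yy xy; have := has_boxsum_ge0 (has_boxsumD Yy (has_boxsumZ (a := -1) Xx)).
by rewrite mulN1r subr_ge0; apply => k; rewrite mulN1r subr_ge0.
Qed.

Lemma has_boxsum_eq X Y x y : has_boxsum X x -> has_boxsum Y y -> (forall k,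
  x k = y k) -> X = Y.
Proof.
by move=> Xx Yy xy; apply/eqP;
  rewrite eq_le (has_boxsum_le Xx Yy) ?(has_boxsum_le Yy Xx)// => k; rewrite xy.
Qed.

Lemma coefs_ae g h : L2 g -> L2 h -> (forall k, fcos g k = fcos h k /\ fsin g k = fsin h k) ->
  {ae leb2, forall z, torus z -> g z = h z}.
Proof.
move=> Lg Lh gh.
have : {ae leb2, forall z, torus z -> (g - h) z = 0}.
  apply: fourier_coefs_eq0; first exact: L2B.
  by move=> k; rewrite !L2dotBl// -!/(fcos _ _) -!/(fsin _ _) (gh k).1 (gh k).2 !subrr.
by apply: filterS => x gx tx; have /eqP := gx tx; rewrite !fctE subr_eq0 => /eqP.
Qed.

Lemma ae_coefs g h : L2 g -> L2 h -> {ae leb2, forall z, torus z -> g z = h z} ->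
  forall k, fcos g k = fcos h k /\ fsin g k = fsin h k.
Proof. by move=> Lg Lh gh k; split; exact: L2dot_aeeq. Qed.

Lemma fcosD g h k : L2 g -> L2 h -> fcos (g + h) k = fcos g k + fcos h k.
Proof. by move=> ? ?; rewrite /fcos L2dotDl. Qed.
Lemma fsinD g h k : L2 g -> L2 h -> fsin (g + h) k = fsin g k + fsin h k.
Proof. by move=> ? ?; rewrite /fsin L2dotDl. Qed.
Lemma fcosB g h k : L2 g -> L2 h -> fcos (g - h) k = fcos g k - fcos h k.
Proof. by move=> ? ?; rewrite /fcos L2dotBl. Qed.
Lemma fsinB g h k : L2 g -> L2 h -> fsin (g - h) k = fsin g k - fsin h k.
Proof. by move=> ? ?; rewrite /fsin L2dotBl. Qed.
Lemma fcosZ a g k : L2 g -> fcos (a *: g) k = a * fcos g k.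
Proof. by move=> ?; rewrite /fcos L2dotZl. Qed.
Lemma fsinZ a g k : L2 g -> fsin (a *: g) k = a * fsin g k.
Proof. by move=> ?; rewrite /fsin L2dotZl. Qed.

Lemma fcos_partial g n k : L2 g -> fcos (partial g n) k = (k \in box n)%:R * fcos g k.
Proof. by move=> Lg; rewrite /fcos trunc_cosk//; exact: coefs_hermitian. Qed.
Lemma fsin_partial g n k : L2 g -> fsin (partial g n) k = (k \in box n)%:R * fsin g k.
Proof. by move=> Lg; rewrite /fsin trunc_sink//; exact: coefs_hermitian. Qed.

Lemma derive_cosk j k : (fun z => 'D_(ev j) (cosk k) z) = (- wn j k) *: sink k :> (R * R -> R).
Proof. by apply/funext => z; have [_ ->] := is_derive_cosk k j z. Qed.
Lemma derive_sink j k : (fun z => 'D_(ev j) (sink k) z) = (wn j k) *: cosk k :> (R * R -> R).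
Proof. by apply/funext => z; have [_ ->] := is_derive_sink k j z. Qed.

Lemma weak_pd_coefs j g h : L2 g -> L2 h -> weak_pd j g h ->
  forall k, fcos h k = wn j k * fsin g k /\ fsin h k = - wn j k * fcos g k.
Proof.
move=> Lg Lh gh k; split.
  have := gh _ (test_cosk_sink k).1; rewrite derive_cosk L2dotZr// -/(fsin g k) -/(fcos h k).
  by move/eqP; rewrite mulNr eqr_opp => /eqP.
have := gh _ (test_cosk_sink k).2; rewrite derive_sink L2dotZr// -/(fsin h k) -/(fcos g k).
by move=> /eqP; rewrite mulNr -eqr_oppLR => /eqP.
Qed.

(** Parseval's identity against a test function and its derivative: a weak derivative can be
    recognised from coefficients alone. *)
Lemma coefs_weak_pd j g h : L2 g -> L2 h ->
  (forall k, fcos h k = wn j k * fsin g k /\ fsin h k = - wn j k * fcos g k) -> weak_pd j g h.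
Proof.
move=> Lg Lh gh psi tpsi.
have Lpsi := test_L2 tpsi; have Ldpsi := test_L2 (test_derive tpsi j).
have dc := weak_pd_coefs Lpsi Ldpsi (test_weak_pd j tpsi).
have h1 := has_boxsumZ (a := -1) (parseval Lh Lpsi); rewrite -[RHS]mulN1r.
apply: (has_boxsum_eq (parseval Lg Ldpsi) h1) => k.
by rewrite (dc k).1 (dc k).2 (gh k).1 (gh k).2; ring.
Qed.

End ParsevalIdentity.

(** * Sobolev fields and projections in Fourier variables *)

Section FieldsFourier.
Context {R : realType}.
Implicit Types (g h psi : R * R -> R) (i j : 'I_2) (k l : int * int).
Implicit Types (u v w phi : vfield R) (N : R).
Notation leb2 := (@leb2 R).
Notation torus := (@torus R).

Definition ksq k : R := \sum_j wn j k ^+ 2.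

Lemma ksqE k : ksq k = k.1%:~R ^+ 2 + k.2%:~R ^+ 2.
Proof. by rewrite /ksq big_ord_recl big_ord1 /wn. Qed.

Lemma ksq_ge0 k : 0 <= ksq k.
Proof. by apply: sumr_ge0 => j _; exact: sqr_ge0. Qed.

Lemma wnN j k : wn j (- k) = - wn j k :> R.
Proof. by rewrite /wn; case: ifP => _ /=; rewrite rmorphN. Qed.

Lemma ksqN k : ksq (- k) = ksq k.
Proof. by apply: eq_bigr => j _; rewrite wnN sqrrN. Qed.

Lemma ksq_ge1 k : k != 0 -> 1 <= ksq k.
Proof.
case: k => a b; rewrite ksqE/= -!rmorphXn -rmorphD/= -[1]/(1%:~R) ler_int.
rewrite xpair_eqE negb_and => ab; apply: contraLR ab; rewrite -ltNge => ab.
by apply/negP => /orP[] /eqP; nia.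
Qed.

Lemma L2_pd j g : L2 (pd j g).
Proof.
by rewrite /pd; case: xgetP => [h _ [Lh _]|_]//; exact: L2_0.
Qed.
Hint Resolve L2_pd : core.

Lemma weak_pd_pd j g : (exists h, L2 h /\ weak_pd j g h) -> weak_pd j g (pd j g).
Proof.
by move=> [h0 h0P]; rewrite /pd; case: xgetP => [h _ [_]//|/(_ h0)].
Qed.

Lemma Hs_L2 s g : Hs s g -> L2 g. Proof. by case: s => [[]|s []]. Qed.

Lemma Hs1_weak_pd j g : Hs 1 g -> weak_pd j g (pd j g).
Proof.
by move=> [_ /(_ j)[h gh Hh]]; apply: weak_pd_pd; exists h; split => //; exact: (@Hs_L2 0).
Qed.

Lemma Hs1_coefs j g : Hs 1 g -> forall k,
  fcos (pd j g) k = wn j k * fsin g k /\ fsin (pd j g) k = - wn j k * fcos g k.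
Proof. by move=> Hg; apply: weak_pd_coefs => //; [exact: (Hs_L2 Hg)|exact: Hs1_weak_pd]. Qed.

Lemma Hs_eq_coefs s g h : Hs s g -> L2 h ->
  (forall k, fcos h k = fcos g k /\ fsin h k = fsin g k) -> Hs s h.
Proof.
case: s => [|s] [Lg Hg] Lh gh; split => // j.
have [g' gg' Hg'] := Hg j; exists g' => //; have Lg' := Hs_L2 Hg'.
apply: coefs_weak_pd => // k; rewrite (gh k).1 (gh k).2.
exact: weak_pd_coefs gg' k.
Qed.

(** [pd] may select another representative than the derivative supplied by [Hs]; the two have the
    same coefficients, and [Hs_eq_coefs] transfers the regularity. *)
Lemma Hs_pd s j g : Hs s.+1 g -> Hs s (pd j g).
Proof.
move=> Hg; have [Lg /(_ j)[h gh Hh]] := Hg; have Lh := Hs_L2 Hh.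
apply: Hs_eq_coefs Hh _ _ => // k; have := weak_pd_coefs Lg Lh gh k.
have wg : weak_pd j g (pd j g) by apply: weak_pd_pd; exists h.
by have [-> ->] := weak_pd_coefs Lg (L2_pd j g) wg k => -[-> ->].
Qed.

Lemma HsB s g h : Hs s g -> Hs s h -> Hs s (g - h).
Proof.
elim: s g h => [|s ih] g h [Lg Hg] [Lh Hh]; split; rewrite ?L2B//; try exact: L2B.
move=> j; have [g' gg' Hg'] := Hg j; have [h' hh' Hh'] := Hh j.
have Lg' := Hs_L2 Hg'; have Lh' := Hs_L2 Hh'.
exists (g' - h'); last exact: ih.
apply: coefs_weak_pd; do ?exact: L2B.
move=> k; rewrite !(fcosB k, fsinB k)//.
have [-> ->] := weak_pd_coefs Lg Lg' gg' k; have [-> ->] := weak_pd_coefs Lh Lh' hh' k.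
by split; ring.
Qed.

Lemma test_Hs s g : test g -> Hs s g.
Proof.
elim: s g => [|s ih] g tg; split => //; do ?exact: test_L2.
move=> j; exists (fun z => 'D_(ev j) g z); first exact: test_weak_pd.
by apply: ih; exact: test_derive.
Qed.

(** With complex coefficients [c - i s], the real part of the Hermitian product of the two fields at
    the mode [k]: the density of [inner u v] in Fourier variables. *)
Definition cross u v k : R := \sum_i (fcos (u i) k * fcos (v i) k + fsin (u i) k * fsin (v i)
  k).

Lemma has_boxsum_inner u v : L2v u -> L2v v -> has_boxsum (inner u v) (cross u v).
Proof. by move=> Lu Lv; apply: has_boxsum_sum => i _; exact: parseval. Qed.

Lemma cross_ge0 u k : 0 <= cross u u k.
Proof. by apply: sumr_ge0 => i _; rewrite -!expr2 addr_ge0 ?sqr_ge0. Qed.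

(** Vanishing divergence means that the coefficient vectors are orthogonal to [k]. For the mean only
    the cosine coefficient at 0 is listed, as [sink 0] is zero. *)
Lemma inH_coefs u : inH u <-> L2v u /\ forall k,
  [/\ \sum_i wn i k * fcos (u i) k = 0, \sum_i wn i k * fsin (u i) k = 0 &
      forall i, k = 0 -> fcos (u i) k = 0].
Proof.
split=> [[Lu du mu]|[Lu cu]].
  split => // k; split.
  - rewrite -[RHS](du _ (test_cosk_sink k).2); apply: eq_bigr => i _.
    by rewrite derive_sink L2dotZr.
  - apply/eqP; rewrite -oppr_eq0; apply/eqP; rewrite -sumrN.
    rewrite -[RHS](du _ (test_cosk_sink k).1); apply: eq_bigr => i _.
    by rewrite derive_cosk L2dotZr// mulNr.
  - by move=> i ->; rewrite /fcos cosk0 L2dot1.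
split => //.
- move=> psi tpsi; have Lpsi := test_L2 tpsi.
  have Ld j := test_L2 (test_derive tpsi j).
  apply: has_boxsum_eq (has_boxsum_sum (fun i _ => parseval (Lu i) (Ld i))) has_boxsum0 _ => k.
  have [cu0 su0 _] := cu k.
  transitivity (fsin psi k * (\sum_i wn i k * fcos (u i) k)
    - fcos psi k * (\sum_i wn i k * fsin (u i) k)).
    rewrite !mulr_sumr -sumrB; apply: eq_bigr => i _.
    have [-> ->] := weak_pd_coefs Lpsi (Ld i) (test_weak_pd i tpsi) k; ring.
  by rewrite cu0 su0 !mulr0 subrr.
- by move=> i; have [_ _ /(_ i erefl)] := cu 0; rewrite /fcos cosk0 L2dot1.
Qed.

Lemma L2vB u v : L2v u -> L2v v -> L2v (u - v).
Proof. by move=> Lu Lv i; exact: L2B. Qed.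

Lemma inner_eq0 u : L2v u -> inner u u = 0 ->
  forall i, {ae leb2, forall z, torus z -> u i z = 0}.
Proof.
move=> Lu /eqP; rewrite psumr_eq0 => [/allP d0 i|i _]; last exact: L2dot_ge0.
by apply: L2dot_eq0 => //; apply/eqP; exact: (d0 i (mem_index_enum i)).
Qed.

Lemma innerBl u v w : L2v u -> L2v v -> L2v w -> inner (u - v) w = inner u w - inner v w.
Proof. by move=> Lu Lv Lw; rewrite -sumrB; apply: eq_bigr => i _; exact: L2dotBl. Qed.

(** Two candidates for the projection differ by an element of [S] orthogonal to itself. Exhibiting
    one candidate [w] therefore excludes the default value and determines the coefficients of the
    chosen one. *)
Lemma orthproj_coefs (S : set (vfield R)) u w : (forall v, S v -> L2v v) ->
  (forall v v', S v -> S v' -> S (v - v')) -> L2v u ->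
  S w -> (forall phi, S phi -> inner (u - w) phi = 0) ->
  [/\ S (orthproj S u), forall phi, S phi -> inner (u - orthproj S u) phi = 0 &
   forall i k, fcos (orthproj S u i) k = fcos (w i) k /\ fsin (orthproj S u i) k = fsin (w i)
     k].
Proof.
move=> SL SB Lu Sw wP; rewrite /orthproj; case: xgetP => [w' _ [Sw' w'P]|/(_ w) /=];
  last by case.
split => // i k; have Lw := SL _ Sw; have Lw' := SL _ Sw'.
have Sd := SB _ _ Sw' Sw; have Ld := SL _ Sd.
have : inner (w' - w) (w' - w) = 0.
  have := wP _ Sd; have := w'P _ Sd; rewrite !innerBl// => e e'.
  by rewrite -[RHS]subr0 -{1}e' -e; ring.
move=> /(inner_eq0 Ld) /(_ i) d0; apply: ae_coefs => //.
by apply: filterS d0 => z dz tz; have /eqP := dz tz; rewrite !fctE subr_eq0 => /eqP.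
Qed.

(** Riesz-Fischer in each component: coefficients dominated mode by mode by those of an L^2 field
    belong to an L^2 field. This constructs [PN], the Leray projection and the derivatives of
    [PN N u]. *)
Lemma exists_field_coefs (c s : 'I_2 -> int * int -> R) u (C : R) : 0 <= C -> L2v u ->
  (forall i, hermitian (c i) (s i)) ->
  (forall i k, c i k ^+ 2 + s i k ^+ 2 <= C * cross u u k) ->
  exists w, L2v w /\ forall i k, fcos (w i) k = c i k /\ fsin (w i) k = s i k.
Proof.
move=> C0 Lu hcs bnd.
have /choice[w wP] : forall i, exists g, L2 g /\ forall k, fcos g k = c i k /\ fsin g k = s i k.
  move=> i; have [|g [Lg gc _]] := @riesz_fischer R (c i) (s i) (C * inner u u) (hcs i).
    move=> n; apply: (@le_trans _ _ (C * boxsum n (cross u u))).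
      rewrite /boxsum [leRHS]mulrCA; apply: ler_wpM2l.
        by rewrite invr_ge0 mulr_ge0 ?sqr_ge0.
      by rewrite mulr_sumr; apply: ler_sum.
    apply: ler_wpM2l => //.
    apply: (@le_trans _ _ (\sum_i boxsum n (fun k => fcos (u i) k ^+ 2 + fsin (u i) k ^+ 2))).
      rewrite /boxsum -mulr_sumr exchange_big/= le_eqVlt; apply/orP; left; apply/eqP.
      by congr (_ * _); apply: eq_bigr => k _; apply: eq_bigr => j _; rewrite -!expr2.
    by apply: ler_sum => j _; exact: bessel.
  by exists g.
by exists w; split=> [i|i]; have [] := wP i.
Qed.

Lemma fsin0 g : fsin g 0 = 0.
Proof. by rewrite /fsin sink0; exact: L2dot0r. Qed.

Definition knorm k : R := Num.sqrt (k.1%:~R ^+ 2 + k.2%:~R ^+ 2).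

Lemma modesP N u : modes N u <-> L2v u /\ forall k i,
  N < knorm k -> fcos (u i) k = 0 /\ fsin (u i) k = 0.
Proof. by []. Qed.

Lemma modesB N u v : modes N u -> modes N v -> modes N (u - v).
Proof.
move=> /modesP[Lu cu] /modesP[Lv cv]; apply/modesP; split; first exact: L2vB.
move=> k i Nk; rewrite fcosB// fsinB//; have [-> ->] := cu k i Nk; have [-> ->] := cv k i Nk.
by rewrite !subrr.
Qed.

Lemma knormN k : knorm (- k) = knorm k.
Proof. by rewrite /knorm -!ksqE ksqN. Qed.

Lemma cross_coef_le u i k : fcos (u i) k ^+ 2 + fsin (u i) k ^+ 2 <= cross u u k.
Proof.
rewrite /cross (bigD1 i)//= -!expr2 lerDl; apply: sumr_ge0 => j _.
by rewrite -!expr2 addr_ge0 ?sqr_ge0.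
Qed.

(** The sharp cutoff of the coefficients is a candidate for the projection: what it removes lives on
    modes where fields of [modes N] vanish. *)
Lemma PN_coefs N u : L2v u -> L2v (PN N u) /\ forall i k,
  fcos (PN N u i) k = (knorm k <= N)%R%:R * fcos (u i) k /\
  fsin (PN N u i) k = (knorm k <= N)%R%:R * fsin (u i) k.
Proof.
move=> Lu; have [||w [Lw wc]] := @exists_field_coefs
    (fun i k => (knorm k <= N)%R%:R * fcos (u i) k)
    (fun i k => (knorm k <= N)%R%:R * fsin (u i) k) u 1 ler01 Lu.
- by move=> i k; rewrite knormN (coefs_hermitian (Lu i) k).1 (coefs_hermitian (Lu i) k).2 mulrN.
- move=> i k; rewrite mul1r; apply: le_trans (cross_coef_le u i k).
  by case: (knorm k <= N); rewrite ?mul1r// !mul0r expr0n addr0 addr_ge0 ?sqr_ge0.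
have mw : modes N w.
  apply/modesP; split => // k i Nk; have [-> ->] := wc i k.
  by rewrite leNgt Nk !mul0r.
have wP phi : modes N phi -> inner (u - w) phi = 0.
  move=> /modesP[Lphi cphi].
  apply: (has_boxsum_eq (has_boxsum_inner (L2vB Lu Lw) Lphi) has_boxsum0) => k.
  apply: big1 => i _; rewrite fcosB// fsinB//; have [-> ->] := wc i k.
  have [kN|Nk] := leP (knorm k) N; first by rewrite !mul1r !subrr !mul0r addr0.
  by have [-> ->] := cphi k i Nk; rewrite !mulr0 addr0.
have [mp _ pc] := @orthproj_coefs (modes N) u w (fun v (mv : modes N v) => mv.1) (@modesB N)
  Lu mw wP.
split; first exact: mp.1.
by move=> i k; have [-> ->] := pc i k; exact: wc.
Qed.

Lemma inHB u v : inH u -> inH v -> inH (u - v).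
Proof.
move=> /inH_coefs[Lu cu] /inH_coefs[Lv cv]; apply/inH_coefs; split; first exact: L2vB.
move=> k; have [u1 u2 u3] := cu k; have [v1 v2 v3] := cv k; split.
- by under eq_bigr => i _ do rewrite fcosB// mulrBr; rewrite sumrB u1 v1 subrr.
- by under eq_bigr => i _ do rewrite fsinB// mulrBr; rewrite sumrB u2 v2 subrr.
- by move=> i k0; rewrite fcosB// u3// v3// subrr.
Qed.

Lemma inH_L2v u : inH u -> L2v u. Proof. by case. Qed.

Lemma leray_spec u : L2v u -> inH (leray u) /\
  forall phi, inH phi -> inner (leray u) phi = inner u phi.
Proof.
move=> Lu.
(* On the mode k <> 0 the Leray projection removes the component along k. *)
pose q (x : 'I_2 -> R) k := \sum_j wn j k * x j.
pose c (x : 'I_2 -> int * int ->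
  R) i k := if k == 0 then 0 else x i k - wn i k * q (x^~ k) k / ksq k.
(* The mode 0 is dropped to remove the mean. Elsewhere the component and the part subtracted from it
   have squares at most the square sum, hence the factor 4. *)
have cbound x i k : c x i k ^+ 2 <= 4 * \sum_j x j k ^+ 2.
  have S0 : 0 <= \sum_j x j k ^+ 2 by apply: sumr_ge0 => j _; exact: sqr_ge0.
  rewrite /c; case: eqP => [_|/eqP k0]; first by rewrite expr0n mulr_ge0.
  have kp : 0 < ksq k by rewrite (lt_le_trans ltr01)// ksq_ge1.
  have wk : wn i k ^+ 2 <= ksq k.
    by rewrite /ksq (bigD1 i)//= lerDl sumr_ge0// => j _; exact: sqr_ge0.
  have xk : x i k ^+ 2 <= \sum_j x j k ^+ 2.
    by rewrite [leRHS](bigD1 i)//= lerDl sumr_ge0// => j _; exact: sqr_ge0.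
  have qk : q (x^~ k) k ^+ 2 <= ksq k * \sum_j x j k ^+ 2.
    rewrite /q /ksq !big_ord_recl !big_ord0 !addr0.
    set a := wn _ _; set b := wn _ _; set y := x _ _; set z := x _ _.
    by have := sqr_ge0 (a * z - b * y); nra.
  have : (wn i k * q (x^~ k) k / ksq k) ^+ 2 <= \sum_j x j k ^+ 2.
    rewrite !exprMn exprVn ler_pdivrMr ?exprn_gt0//.
    apply: (@le_trans _ _ (ksq k * (ksq k * \sum_j x j k ^+ 2))).
      by apply: ler_pM; rewrite ?sqr_ge0.
    by rewrite mulrA -expr2 mulrC.
  move: xk; set A := x i k; set B := wn i k * _ / _; set S := \sum_j _ => AS BS.
  by have := sqr_ge0 (A + B); nra.
have cN x (e : R) i k : (forall j, x j (- k) = e * x j k) -> c x i (- k) = e * c x i k.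
  move=> xe; rewrite /c oppr_eq0; case: eqP => _; first by rewrite mulr0.
  rewrite xe ksqN wnN (_ : q _ (- k) = - e * q (x^~ k) k); first by ring.
  by rewrite /q mulr_sumr; apply: eq_bigr => j _; rewrite wnN xe; ring.
have [|||w [Lw wc]] := @exists_field_coefs (c (fun i => fcos (u i)))
  (c (fun i => fsin (u i))) u 4 _ Lu.
- by [].
- move=> i k; split.
    by rewrite (cN _ 1) ?mul1r// => j; rewrite mul1r (coefs_hermitian (Lu j) k).1.
  by rewrite (cN _ (-1)) ?mulN1r// => j; rewrite mulN1r (coefs_hermitian (Lu j) k).2.
- move=> i k; have := cbound (fun i => fcos (u i)) i k;
    have := cbound (fun i => fsin (u i)) i k.
  have -> : cross u u k = \sum_j fcos (u j) k ^+ 2 + \sum_j fsin (u j) k ^+ 2.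
    by rewrite -big_split; apply: eq_bigr => j _; rewrite !expr2.
  by move=> s1 c1; rewrite mulrDr lerD.
have cdiv x k : \sum_i wn i k * c x i k = 0.
  rewrite /c; case: eqP => [_|/eqP k0]; first by rewrite big1// => i _; rewrite mulr0.
  have kp : ksq k != 0 by rewrite gt_eqF// (lt_le_trans ltr01)// ksq_ge1.
  under eq_bigr do rewrite mulrBr; rewrite sumrB -/(q _ _).
  rewrite (_ : \sum_i wn i k * (wn i k * q (x^~ k) k / ksq k) = ksq k * (q (x^~ k) k / ksq k)).
    by rewrite mulrCA divff ?mulr1 ?subrr.
  by rewrite /ksq mulr_suml; apply: eq_bigr => i _; rewrite expr2; ring.
have Hw : inH w.
  apply/inH_coefs; split => // k; split.
  - by under eq_bigr => i _ do rewrite (wc i k).1; exact: cdiv.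
  - by under eq_bigr => i _ do rewrite (wc i k).2; exact: cdiv.
  - by move=> i k0; rewrite (wc i k).1 /c k0 eqxx.
have orth (x : 'I_2 -> int * int -> R) (y : 'I_2 -> R) k : k != 0 -> \sum_i wn i k * y i = 0 ->
    \sum_i (x i k - c x i k) * y i = 0.
  move=> k0 y0; rewrite /c (negbTE k0).
  rewrite (eq_bigr (fun i => (q (x^~ k) k / ksq k) * (wn i k * y i))); last by move=> i _; ring.
  by rewrite -mulr_sumr y0 mulr0.
have wP v : inH v -> inner (u - w) v = 0.
  move=> /inH_coefs[Lv cv].
  apply: (has_boxsum_eq (has_boxsum_inner (L2vB Lu Lw) Lv) has_boxsum0) => k.
  have [p1 p2 p3] := cv k.
  rewrite /cross; under eq_bigr => i _ do rewrite fcosB// fsinB// (wc i k).1 (wc i k).2.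
  have [k0|k0] := eqVneq k 0.
    by rewrite big1// => i _; rewrite p3// k0 !fsin0 !mulr0 addr0.
  by rewrite big_split/= (orth (fun i => fcos (u i)) _ _ k0 p1) (orth (fun i => fsin (u i))
    _ _ k0 p2) addr0.
have [Hl lP _] := orthproj_coefs inH_L2v inHB Lu Hw wP.
split => // phi Hphi; have Lphi := inH_L2v Hphi; have := lP _ Hphi; rewrite innerBl//;
  last exact: inH_L2v.
by move/eqP; rewrite subr_eq0 => /eqP.
Qed.

End FieldsFourier.

#[local] Hint Resolve L2_pd : core.

(** * The trilinear form *)

Section Trilinear.
Context {R : realType}.
Implicit Types (f g h psi : R * R -> R) (i j : 'I_2) (k l : int * int).
Implicit Types (u v w phi : vfield R) (M : R).
Notation leb2 := (@leb2 R).
Notation torus := (@torus R).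
Notation integ f := (leb2.-integrable torus (EFin \o f)).
Notation mfun f := (measurable_fun (torus : set (measurableTypeR R * measurableTypeR R)) f).

Lemma ord2_sum (F : 'I_2 -> R) : \sum_i F i = F ord0 + F ord_max.
Proof.
by rewrite big_ord_recl big_ord1; congr (_ + F _); apply: val_inj.
Qed.

Lemma normH_ge0 u : 0 <= normH u. Proof. exact: sqrtr_ge0. Qed.
Lemma normV_ge0 u : 0 <= normV u. Proof. exact: sqrtr_ge0. Qed.

Lemma normH_sqr u : normH u ^+ 2 = inner u u.
Proof. by rewrite sqr_sqrtr// sumr_ge0// => i _; exact: L2dot_ge0. Qed.

Lemma normV_sqr u : normV u ^+ 2 = \sum_i \sum_j L2dot (pd j (u i)) (pd j (u i)).
Proof.
by rewrite sqr_sqrtr// sumr_ge0// => i _; apply: sumr_ge0 => j _; exact: L2dot_ge0.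
Qed.

Lemma inner_CS u v : L2v u -> L2v v -> `|inner u v| <= normH u * normH v.
Proof.
move=> Lu Lv; rewrite -(@ler_pXn2r _ 2) ?nnegrE ?mulr_ge0 ?normH_ge0//.
rewrite exprMn !normH_sqr real_normK ?num_real// /inner !ord2_sum.
have := L2dot_CS (Lu ord0) (Lv ord0); have := L2dot_CS (Lu ord_max) (Lv ord_max).
have := L2dot_ge0 (u ord0); have := L2dot_ge0 (v ord0).
have := L2dot_ge0 (u ord_max); have := L2dot_ge0 (v ord_max).
set p0 := L2dot (u ord0) (v ord0); set p1 := L2dot (u ord_max) (v ord_max).
set X0 := L2dot (u ord0) (u ord0); set X1 := L2dot (u ord_max) (u ord_max).
set Y0 := L2dot (v ord0) (v ord0); set Y1 := L2dot (v ord_max) (v ord_max) => y1 x1 y0 x0 h1 h0.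
suff : 2 * (p0 * p1) <= X0 * Y1 + X1 * Y0 by nra.
apply: le_trans (ler_norm _) _; rewrite -(@ler_pXn2r _ 2) ?nnegrE ?addr_ge0 ?mulr_ge0//.
rewrite real_normK ?num_real//.
have : p0 ^+ 2 * p1 ^+ 2 <= (X0 * Y0) * (X1 * Y1) by apply: ler_pM; rewrite ?sqr_ge0.
have := sqr_ge0 (X0 * Y1 - X1 * Y0); nra.
Qed.

Lemma integ_sum (I : Type) (r : seq I) (F : I -> R * R -> R) : (forall a, integ (F a)) ->
  integ (fun z => \sum_(a <- r) F a z) /\
  Rintegral leb2 torus (fun z => \sum_(a <- r) F a z) =
  \sum_(a <- r) Rintegral leb2 torus (F a).
Proof.
move=> iF; elim: r => [|a r [ih1 ih2]].
  rewrite big_nil (_ : (fun z => _) = fun=> 0); last by apply/funext => z; rewrite big_nil.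
  split; last by rewrite (Rintegral_cst _ measurable_torus) mul0r.
  by apply: (@integ_bounded _ _ 0) => [|z _]; [exact: measurable_cst|rewrite normr0].
rewrite big_cons (_ : (fun z => _) = (fun z => F a z + \sum_(a <- r) F a z)); last first.
  by apply/funext => z; rewrite big_cons.
split; first exact: integD.
by rewrite RintegralD// ih2.
Qed.

Definition ae_bounded M u := {ae leb2, forall z, torus z -> mag u z <= M}.

Lemma bdd_sqr M u : ae_bounded M u -> {ae leb2, forall z,
  torus z -> \sum_i u i z ^+ 2 <= M ^+ 2}.
Proof.
apply: filterS => z uz tz; have S0 : 0 <= \sum_i u i z ^+ 2.
  by apply: sumr_ge0 => i _; exact: sqr_ge0.
have := uz tz; rewrite /mag => mz; rewrite -[leLHS]sqr_sqrtr// ler_pXn2r ?nnegrE ?sqrtr_ge0//.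
exact: le_trans (sqrtr_ge0 _) mz.
Qed.

Lemma L2_mul_ae_le f g h M : mfun f -> mfun g -> L2 h ->
  {ae leb2, forall z, torus z -> (f z * g z) ^+ 2 <= M ^+ 2 * h z ^+ 2} -> L2 (f * g).
Proof.
move=> mf mg Lh fg; apply: L2M_sqr; first exact: measurable_funM.
apply: (@integ_ae_le _ _ (fun z => M ^+ 2 * (h z * h z))).
- by do 2 apply: measurable_funM => //.
- by apply: eq_integrable (integrableZl measurable_torus (M ^+ 2) (L2M Lh Lh)).
- apply: filterS fg => z fz tz /=; rewrite ger0_norm -?expr2 ?sqr_ge0//.
  exact: fz.
Qed.

Lemma L2_bdd_mul M u j h : ae_bounded M u -> mfun (u j) -> L2 h -> L2 (u j * h).
Proof.
move=> /bdd_sqr bu mu Lh; apply: (@L2_mul_ae_le _ _ h M) => //; first exact: L2_mfun.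
apply: filterS bu => z uz tz; rewrite exprMn ler_wpM2r ?sqr_ge0//.
apply: le_trans (uz tz); rewrite (bigD1 j)//= lerDl; apply: sumr_ge0 => i _; exact: sqr_ge0.
Qed.

(** Pointwise Cauchy-Schwarz in the contracted index, with [mag u] as one factor. *)
Lemma bdd_contract M u (a : 'I_2 -> R * R -> R) :
  ae_bounded M u -> L2v u -> L2v a ->
  L2 (\sum_j u j * a j) /\
  L2dot (\sum_j u j * a j) (\sum_j u j * a j) <= M ^+ 2 * \sum_j L2dot (a j) (a j).
Proof.
move=> bu Lu La.
have Lc : L2 (\sum_j u j * a j).
  by apply: L2_sum => j _; apply: L2_bdd_mul bu _ _; first exact: L2_mfun (Lu j).
split=> //; have [iS eS] := integ_sum (index_enum 'I_2) (fun j => L2M (La j) (La j)).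
rewrite -eS -(RintegralZl _ measurable_torus iS).
apply: ae_le_Rintegral; first exact: L2M.
  by apply: eq_integrable (integrableZl measurable_torus (M ^+ 2) iS).
apply: filterS (bdd_sqr bu) => z uz tz; have := uz tz.
rewrite fct_sumE !ord2_sum /= !fctE.
set u0 := u _ _; set u1 := u _ _; set a0 := a _ _; set a1 := a _ _ => uM.
apply: (@le_trans _ _ ((u0 ^+ 2 + u1 ^+ 2) * (a0 * a0 + a1 * a1))).
  by have := sqr_ge0 (u0 * a1 - u1 * a0); nra.
by rewrite ler_wpM2r// -!expr2 addr_ge0 ?sqr_ge0.
Qed.

Lemma normH_adv M u v : 0 <= M -> ae_bounded M u -> L2v u ->
  L2v (adv u v) /\ normH (adv u v) <= M * normV v.
Proof.
move=> M0 bu Lu; have c i := bdd_contract bu Lu (fun j => L2_pd j (v i)).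
split; first by move=> i; exact: (c i).1.
rewrite -(@ler_pXn2r _ 2) ?nnegrE ?mulr_ge0 ?normH_ge0 ?normV_ge0//.
rewrite exprMn normH_sqr normV_sqr mulr_sumr; apply: ler_sum => i _; exact: (c i).2.
Qed.

Definition trilinear u v phi : R := inner (adv u v) phi.

Lemma trilinear_bound1 M u v phi : 0 <= M -> ae_bounded M u -> L2v u -> L2v phi ->
  `|trilinear u v phi| <= M * normV v * normH phi.
Proof.
move=> M0 bu Lu Lphi; have [La na] := normH_adv v M0 bu Lu.
by apply: le_trans (inner_CS La Lphi) _; rewrite ler_wpM2r// normH_ge0.
Qed.

(** Regrouping the form as the sum over [j] of [u j] times [H j] contracts the bounded field [phi]
    with the gradient of [v] before Cauchy-Schwarz is applied. *)
Lemma trilinear_bound3 M u v phi : 0 <= M -> ae_bounded M phi -> L2v u -> L2v phi ->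
  `|trilinear u v phi| <= M * normV v * normH u.
Proof.
move=> M0 bphi Lu Lphi.
pose H : vfield R := fun j => \sum_i phi i * pd j (v i).
have c j := bdd_contract bphi Lphi (fun i => L2_pd j (v i)).
have LH : L2v H by move=> j; exact: (c j).1.
have Lp i j : L2 (phi i * pd j (v i)) by apply: L2_bdd_mul bphi _ _;
  first exact: L2_mfun (Lphi i).
have -> : trilinear u v phi = inner H u.
  transitivity (\sum_i \sum_j L2dot (u j) (phi i * pd j (v i))).
    apply: eq_bigr => i _.
    have [_ <-] := integ_sum (index_enum 'I_2) (fun j => L2M (Lu j) (Lp i j)).
    rewrite /L2dot; congr Rintegral; apply/funext => z.
    rewrite /adv fct_sumE mulr_suml; apply: eq_bigr => j _.
    by rewrite /= !fctE -mulrA [phi i z * _]mulrC.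
  rewrite exchange_big/=; apply: eq_bigr => j _.
  by rewrite L2dot_suml//; apply: eq_bigr => i _; rewrite L2dotC.
apply: le_trans (inner_CS LH Lu) _; rewrite ler_wpM2r ?normH_ge0//.
rewrite -(@ler_pXn2r _ 2) ?nnegrE ?mulr_ge0 ?normH_ge0 ?normV_ge0//.
rewrite exprMn normH_sqr normV_sqr exchange_big/= mulr_sumr; apply: ler_sum => j _.
exact: (c j).2.
Qed.

End Trilinear.

(** * Antisymmetry of the trilinear form by truncation *)

Section Antisymmetry.
Context {R : realType}.
Implicit Types (f g h psi : R * R -> R) (i j : 'I_2) (k l : int * int).
Implicit Types (u v w phi : vfield R) (M : R).
Notation leb2 := (@leb2 R).
Notation torus := (@torus R).

Lemma pd_test_ae j g : test g ->
  {ae leb2, forall z, torus z -> pd j g z = 'D_(ev j) g z}.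
Proof.
move=> tg; have Ld := test_L2 (test_derive tg j); have Lg := test_L2 tg.
apply: coefs_ae => // k; have [-> ->] := Hs1_coefs j (test_Hs 1 tg) k.
by have [-> ->] := weak_pd_coefs Lg Ld (test_weak_pd j tg) k.
Qed.

Lemma L2_mul_test g h : L2 g -> test h -> L2 (g * h).
Proof.
move=> Lg th; have [M hM] := continuous_bounded (test_continuous th).
apply: (@L2_mul_ae_le _ _ _ g M) => //; try exact: L2_mfun (test_L2 th).
  exact: L2_mfun.
apply: aeW => z tz; rewrite exprMn mulrC ler_wpM2r ?sqr_ge0//.
by rewrite -[h z ^+ 2]real_normK ?num_real// ler_pXn2r ?nnegrE// ?hM// (le_trans _ (hM z tz)).
Qed.

Lemma L2dot_mulA f g h : L2dot (f * g) h = L2dot f (g * h).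
Proof. by rewrite /L2dot; congr Rintegral; apply/funext => z; rewrite !fctE mulrA. Qed.

Lemma L2dot_swap f g h : L2dot (f * g) h = L2dot g (f * h).
Proof. by rewrite mulrC L2dot_mulA. Qed.

Definition advect u g h : R := \sum_j L2dot (u j * pd j g) h.

(** The weak divergence condition on [u] is tested with the product [g * h], itself a test function;
    no derivative of [u] appears. *)
Lemma advect_test u g h : L2v u -> divfree u -> test g -> test h ->
  advect u g h = - advect u h g.
Proof.
move=> Lu du tg th; apply/eqP; rewrite -addr_eq0; apply/eqP.
rewrite /advect -big_split/= -[RHS](du _ (testM tg th)); apply: eq_bigr => j _;
  rewrite !L2dot_mulA.
have Lgh : L2 (pd j g * h) by exact: L2_mul_test.
have Lhg : L2 (pd j h * g) by exact: L2_mul_test.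
rewrite -L2dotDr// L2dotC [RHS]L2dotC; apply: L2dot_aeeq => //.
- exact: L2D.
- exact/test_L2/test_derive/testM.
- apply: filterS2 (pd_test_ae j tg) (pd_test_ae j th) => z gz hz tz.
  rewrite (deriveM (@test_derivable _ _ tg j z) (@test_derivable _ _ th j z)) !fctE gz// hz//.
  by rewrite /GRing.scale/=; ring.
Qed.

Lemma partial_test g n : test (partial g n).
Proof. exact: trunc_test. Qed.

Lemma L2dot_eq_coefs g g' : L2 g -> L2 g' -> (forall k,
  fcos g k = fcos g' k /\ fsin g k = fsin g' k) ->
  L2dot g g = L2dot g' g'.
Proof.
move=> Lg Lg' gg'; apply: (has_boxsum_eq (parseval Lg Lg) (parseval Lg' Lg')) => k.
by have [-> ->] := gg' k.
Qed.

Lemma pd_partial_cvg j g : Hs 1 g -> forall e : R, 0 < e -> exists N, forall n, (N <= n)%N ->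
  L2dot (pd j (partial g n) - pd j g) (pd j (partial g n) - pd j g) <= e.
Proof.
move=> Hg e /(partial_cvg (L2_pd j g))[N NE]; exists N => n /NE; apply: le_trans.
have Lg := Hs_L2 Hg; have Lp := L2_partial (pd j g) n.
rewrite le_eqVlt; apply/orP; left; apply/eqP; apply: L2dot_eq_coefs; do ?exact: L2B.
move=> k; rewrite !(fcosB, fsinB)//.
have [-> ->] := Hs1_coefs j (test_Hs 1 (partial_test g n)) k.
rewrite !(fcos_partial, fsin_partial)//; have [-> ->] := Hs1_coefs j Hg k.
by split; ring.
Qed.

Lemma cvg_sum2 (F : 'I_2 -> nat -> R) (l : 'I_2 -> R) :
  (forall j, F j n @[n --> \oo] --> l j) ->
  \sum_j F j n @[n --> \oo] --> \sum_j l j.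
Proof. by move=> Fl; under eq_fun do rewrite ord2_sum; rewrite ord2_sum; apply: cvgD;
  exact: Fl. Qed.

Lemma advect_cvg_pd M u g h : ae_bounded M u -> L2v u -> Hs 1 g -> L2 h ->
  advect u (partial g n) h @[n --> \oo] --> advect u g h.
Proof.
move=> bu Lu Hg Lh; apply: cvg_sum2 => j.
have Luh : L2 (u j * h) by apply: L2_bdd_mul bu _ Lh; exact: L2_mfun (Lu j).
rewrite L2dot_swap; under eq_fun do rewrite L2dot_swap.
exact: L2_cvg_dot (fun n => L2_pd j (partial g n)) (L2_pd j g) Luh (pd_partial_cvg j Hg).
Qed.

Lemma advect_cvg M u g h : ae_bounded M u -> L2v u -> L2 h ->
  advect u g (partial h n) @[n --> \oo] --> advect u g h.
Proof.
move=> bu Lu Lh; apply: cvg_sum2 => j.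
have Lug : L2 (u j * pd j g) by apply: L2_bdd_mul bu _ _ => //; exact: L2_mfun (Lu j).
rewrite L2dotC; under eq_fun do rewrite L2dotC.
exact: L2_cvg_dot (L2_partial h) Lh Lug (partial_cvg Lh).
Qed.

(** The functions are replaced by truncations one at a time: [g] against a fixed test function, then
    [h]. Boundedness of [u] makes both sides continuous, in H^1 for the differentiated function and
    in L^2 for the other. *)
Lemma advect_antisym M u g h : ae_bounded M u -> L2v u -> divfree u -> Hs 1 g -> Hs 1 h ->
  advect u g h = - advect u h g.
Proof.
move=> bu Lu du Hg Hh; have Lg := Hs_L2 Hg; have Lh := Hs_L2 Hh.
have step f : test f -> advect u g f = - advect u f g.
  move=> tf; have Lf := test_L2 tf.
  have /cvg_lim <- // := advect_cvg_pd bu Lu Hg Lf.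
  apply/cvg_lim => //; under eq_fun do rewrite (advect_test Lu du (partial_test _ _) tf).
  exact: (cvgN (advect_cvg (g := f) bu Lu Lg)).
have /cvg_lim <- // := advect_cvg (g := g) bu Lu Lh.
apply/cvg_lim => //; under eq_fun do rewrite (step _ (partial_test _ _)).
exact: (cvgN (advect_cvg_pd bu Lu Hh Lg)).
Qed.

Lemma trilinearE M u v phi : ae_bounded M u -> L2v u -> L2v phi ->
  trilinear u v phi = \sum_i advect u (v i) (phi i).
Proof.
move=> bu Lu Lphi; apply: eq_bigr => i _; rewrite L2dot_suml// => j _.
by apply: L2_bdd_mul bu _ _ => //; exact: L2_mfun (Lu j).
Qed.

Lemma trilinear_antisym M u v phi : ae_bounded M u -> inH u ->
  (forall i, Hs 1 (v i)) -> (forall i, Hs 1 (phi i)) -> trilinear u v phi = - trilinear u phi v.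
Proof.
move=> bu [Lu du _] Hv Hphi.
have Lv : L2v v by move=> i; exact: Hs_L2 (Hv i).
have Lphi : L2v phi by move=> i; exact: Hs_L2 (Hphi i).
rewrite !(trilinearE _ bu)// -sumrN; apply: eq_bigr => i _; exact: (advect_antisym bu).
Qed.

End Antisymmetry.

(** * Norms of fields and truncations *)

Section Norms.
Context {R : realType}.
Implicit Types (f g h : R * R -> R) (i j : 'I_2) (k l : int * int).
Implicit Types (u v w phi : vfield R) (M N a : R).
Notation leb2 := (@leb2 R).
Notation torus := (@torus R).

(** The norm of exponent [+oo] is an essential supremum only when the total mass is positive. *)
Lemma leb2_setT_gt0 : (0 < leb2 setT)%E.
Proof.
apply: (@lt_le_trans _ _ (leb2 torus)).
  by rewrite leb2_torus lte_fin mulr_gt0// exprn_gt0// pi_gt0.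
by apply: le_measure => //; rewrite inE.
Qed.

Lemma normLp_ae_bounded M u : (normLp +oo u <= M%:E)%E -> ae_bounded M u.
Proof.
rewrite /normLp unlock /= leb2_setT_gt0 => /ess_supP; apply: filterS => z /= + tz.
by rewrite patchE mem_set//= lee_fin ger0_norm ?sqrtr_ge0.
Qed.

Lemma inner_eqH u u' v : L2v u -> L2v u' -> L2v v -> eqH u u' -> inner u v = inner u' v.
Proof. by move=> Lu Lu' Lv uu'; apply: eq_bigr => i _; exact: L2dot_aeeq. Qed.

Lemma innerDl u v w : L2v u -> L2v v -> L2v w -> inner (u + v) w = inner u w + inner v w.
Proof. by move=> Lu Lv Lw; rewrite -big_split; apply: eq_bigr => i _; exact: L2dotDl. Qed.

Lemma innerZl a u w : L2v u -> L2v w -> inner (a *: u) w = a * inner u w.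
Proof. by move=> Lu Lw; rewrite mulr_sumr; apply: eq_bigr => i _; exact: L2dotZl. Qed.

Lemma innerC u w : inner u w = inner w u.
Proof. by apply: eq_bigr => i _; rewrite L2dotC. Qed.

Lemma L2vD u v : L2v u -> L2v v -> L2v (u + v).
Proof. by move=> Lu Lv i; exact: L2D. Qed.

Lemma L2vZ a u : L2v u -> L2v (a *: u).
Proof. by move=> Lu i; exact: L2Z. Qed.

Lemma L2vN u : L2v u -> L2v (- u).
Proof. by move=> Lu i; exact: L2N. Qed.

Lemma inDA_Hs2 u : inDA u -> forall i, Hs 2 (u i). Proof. by case. Qed.
Lemma inDA_Hs1 u : inDA u -> forall i, Hs 1 (u i). Proof. by case=> [[]]. Qed.
Lemma inDA_inH u : inDA u -> inH u. Proof. by case=> [[]]. Qed.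
Lemma inDA_L2v u : inDA u -> L2v u. Proof. by move/inDA_inH/inH_L2v. Qed.

Lemma inDAB u v : inDA u -> inDA v -> inDA (u - v).
Proof.
move=> uD vD; split; last by move=> i; apply: HsB; exact: inDA_Hs2.
split; first by apply: inHB; exact: inDA_inH.
by move=> i; apply: HsB; exact: inDA_Hs1.
Qed.

Lemma L2v_A u : L2v (A u).
Proof. by move=> i; apply: L2N; apply: L2_sum. Qed.

Lemma A_coefs u : inDA u -> forall i k,
  fcos (A u i) k = ksq k * fcos (u i) k /\ fsin (A u i) k = ksq k * fsin (u i) k.
Proof.
move=> uD i k; have H1 := inDA_Hs1 uD i; have H2 j := Hs_pd j (inDA_Hs2 uD i).
have Ls : L2 (\sum_j pd j (pd j (u i))) by exact: L2_sum.
rewrite /A /fcos /fsin !L2dotNl//; rewrite !L2dot_suml// /ksq !mulr_suml -!sumrN.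
split; apply: eq_bigr => j _.
  by rewrite -/(fcos _ k) (Hs1_coefs j (H2 j) k).1 (Hs1_coefs j H1 k).2 /fcos; ring.
by rewrite -/(fsin _ k) (Hs1_coefs j (H2 j) k).2 (Hs1_coefs j H1 k).1 /fsin; ring.
Qed.

Lemma inH_A u : inDA u -> inH (A u).
Proof.
move=> uD; have [_ cu] := (inH_coefs u).1 (inDA_inH uD).
apply/inH_coefs; split; first exact: L2v_A.
move=> k; have [u1 u2 u3] := cu k; split.
- transitivity (ksq k * \sum_i wn i k * fcos (u i) k); last by rewrite u1 mulr0.
  by rewrite mulr_sumr; apply: eq_bigr => i _; rewrite (A_coefs uD i k).1; ring.
- transitivity (ksq k * \sum_i wn i k * fsin (u i) k); last by rewrite u2 mulr0.
  by rewrite mulr_sumr; apply: eq_bigr => i _; rewrite (A_coefs uD i k).2; ring.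
- by move=> i k0; rewrite (A_coefs uD i k).1 u3// mulr0.
Qed.

Lemma cross_scale (c d : R) u u' v v' k :
  (forall i, fcos (u i) k = c * fcos (u' i) k /\ fsin (u i) k = c * fsin (u' i) k) ->
  (forall i, fcos (v i) k = d * fcos (v' i) k /\ fsin (v i) k = d * fsin (v' i) k) ->
  cross u v k = c * d * cross u' v' k.
Proof.
move=> cu cv; rewrite /cross mulr_sumr; apply: eq_bigr => i _.
by have [-> ->] := cu i; have [-> ->] := cv i; ring.
Qed.

Lemma has_boxsum_normH u : L2v u -> has_boxsum (normH u ^+ 2) (cross u u).
Proof. by move=> Lu; rewrite normH_sqr; exact: has_boxsum_inner. Qed.

Lemma has_boxsum_normV u : (forall i, Hs 1 (u i)) ->
  has_boxsum (normV u ^+ 2) (fun k => ksq k * cross u u k).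
Proof.
move=> Hu; rewrite normV_sqr.
apply: eq_has_boxsum (has_boxsum_sum (fun i _ => has_boxsum_sum (fun j _ => parseval (L2_pd j
  (u i)) (L2_pd j (u i))))) => k.
rewrite /cross mulr_sumr; apply: eq_bigr => i _; rewrite /ksq mulr_suml; apply: eq_bigr => j _.
by have [-> ->] := Hs1_coefs j (Hu i) k; ring.
Qed.

Lemma cross_A u v k : inDA u -> cross (A u) v k = ksq k * cross u v k.
Proof.
move=> uD; rewrite (@cross_scale (ksq k) 1 _ u _ v) ?mulr1// => i; first exact: A_coefs.
by rewrite !mul1r.
Qed.

Lemma crossC u v k : cross u v k = cross v u k.
Proof. by apply: eq_bigr => i _; ring. Qed.

Lemma has_boxsum_normH_A u : inDA u ->
  has_boxsum (normH (A u) ^+ 2) (fun k => ksq k ^+ 2 * cross u u k).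
Proof.
move=> uD; apply: eq_has_boxsum (has_boxsum_normH (L2v_A u)) => k.
by rewrite cross_A// crossC cross_A// expr2 mulrA.
Qed.

Lemma inner_A u : inDA u -> inner (A u) u = normV u ^+ 2.
Proof.
move=> uD; apply: has_boxsum_eq (has_boxsum_inner (L2v_A u) (inDA_L2v uD))
  (has_boxsum_normV (inDA_Hs1 uD)) _ => k.
exact: cross_A.
Qed.

Lemma cross_mean0 u : inH u -> cross u u 0 = 0.
Proof.
move=> /inH_coefs[_ cu]; have [_ _ u3] := cu 0.
by apply: big1 => i _; rewrite fsin0 u3// !mulr0 addr0.
Qed.

Lemma ler_sqr_ge0 (x y : R) : 0 <= x -> 0 <= y -> x ^+ 2 <= y ^+ 2 -> x <= y.
Proof. by move=> x0 y0; rewrite ler_pXn2r ?nnegrE. Qed.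

(** The constant is 1 because non-zero wave vectors are integral, so [1 <= ksq k], while
    mean-freeness removes [k = 0]. *)
Lemma poincare u : inH u -> (forall i, Hs 1 (u i)) -> normH u <= normV u.
Proof.
move=> Hu H1; apply: ler_sqr_ge0; rewrite ?normH_ge0 ?normV_ge0//.
apply: has_boxsum_le (has_boxsum_normH (inH_L2v Hu)) (has_boxsum_normV H1) _ => k.
have [->|k0] := eqVneq k 0; first by rewrite cross_mean0// mulr0.
by rewrite ler_peMl ?cross_ge0// ksq_ge1.
Qed.

Lemma normV_le_A u : inDA u -> normV u <= normH (A u).
Proof.
move=> uD; apply: ler_sqr_ge0; rewrite ?normH_ge0 ?normV_ge0//.
apply: has_boxsum_le (has_boxsum_normV (inDA_Hs1 uD)) (has_boxsum_normH_A uD) _ => k.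
have [->|k0] := eqVneq k 0; first by rewrite (cross_mean0 (inDA_inH uD)) !mulr0.
by rewrite expr2 -mulrA ler_peMl ?mulr_ge0 ?cross_ge0 ?ksq_ge0// ksq_ge1.
Qed.

Lemma normH_eq0 u : L2v u -> normH u = 0 -> eqH u 0.
Proof.
by move=> Lu u0; apply: inner_eq0 => //; rewrite -normH_sqr u0 expr0n.
Qed.

Lemma normHD u v : L2v u -> L2v v -> normH (u + v) <= normH u + normH v.
Proof.
move=> Lu Lv; apply: ler_sqr_ge0; rewrite ?addr_ge0 ?normH_ge0//.
have Ls := L2vD Lu Lv.
rewrite normH_sqr innerDl// (innerC u) (innerC v) !innerDl// -!normH_sqr (innerC v u).
have := le_trans (ler_norm _) (inner_CS Lu Lv); nra.
Qed.

(** * The projection on low modes: tail and Bernstein inequalities *)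

Section Projection.
Variable N : R.
Hypothesis N0 : 0 < N.
Notation P := (PN N).

Lemma ksq_low k : knorm k <= N -> ksq k <= N ^+ 2.
Proof.
by rewrite /knorm -ksqE => kN;
  rewrite -[leLHS]sqr_sqrtr ?ksq_ge0// ler_pXn2r ?nnegrE ?sqrtr_ge0// ltW.
Qed.

Lemma ksq_high k : N < knorm k -> N ^+ 2 <= ksq k.
Proof.
rewrite /knorm -ksqE => kN;
  rewrite -[leRHS]sqr_sqrtr ?ksq_ge0// ler_pXn2r ?nnegrE ?sqrtr_ge0// ltW//.
Qed.

Lemma L2v_PN u : L2v u -> L2v (P u). Proof. by case/(PN_coefs N). Qed.

Lemma cross_PNl u v k : L2v u -> cross (P u) v k = (knorm k <= N)%R%:R * cross u v k.
Proof.
move=> Lu; rewrite (@cross_scale (knorm k <= N)%R%:R 1 _ u _ v) ?mulr1// => i;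
  last by rewrite !mul1r.
exact: (PN_coefs N Lu).2.
Qed.

Lemma cross_PN u v k : L2v u -> L2v v ->
  cross (P u) (P v) k = (knorm k <= N)%R%:R * cross u v k.
Proof.
move=> Lu Lv; rewrite cross_PNl// crossC cross_PNl// crossC mulrA.
by case: (knorm k <= N); rewrite ?mul1r ?mul0r.
Qed.

Lemma has_boxsum_normH_PN u : L2v u ->
  has_boxsum (normH (P u) ^+ 2) (fun k => (knorm k <= N)%R%:R * cross u u k).
Proof.
by move=> Lu; apply: eq_has_boxsum (has_boxsum_normH (L2v_PN Lu)) => k; rewrite cross_PN.
Qed.

Lemma inner_PN u v : L2v u -> L2v v -> inner (P u) v = inner (P u) (P v).
Proof.
move=> Lu Lv; apply: (has_boxsum_eq (has_boxsum_inner (L2v_PN Lu) Lv)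
  (has_boxsum_inner (L2v_PN Lu) (L2v_PN Lv))) => k.
by rewrite cross_PNl// cross_PN.
Qed.

Lemma inner_PN_A_ge0 u : inDA u -> 0 <= inner (P u) (A u).
Proof.
move=> uD; have Lu := inDA_L2v uD;
  apply: (has_boxsum_ge0 (has_boxsum_inner (L2v_PN Lu) (L2v_A u))) => k.
by rewrite cross_PNl// crossC cross_A// mulr_ge0// mulr_ge0 ?ksq_ge0// cross_ge0.
Qed.

Lemma inner_PNB u v w : L2v u -> L2v v -> L2v w ->
  inner (P (u - v)) w = inner (P u) w - inner (P v) w.
Proof.
move=> Lu Lv Lw; have Ld := L2vB Lu Lv; rewrite -innerBl; do ?exact: L2v_PN; last by [].
have LPd := L2vB (L2v_PN Lu) (L2v_PN Lv).
apply: (has_boxsum_eq (has_boxsum_inner (L2v_PN Ld) Lw) (has_boxsum_inner LPd Lw)) => k.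
rewrite -[RHS]mul1r -[1]mulr1; apply: (@cross_scale 1 1) => i; rewrite !mul1r; last by [].
have [_ cd] := PN_coefs N Ld; have [Lpu cu] := PN_coefs N Lu; have [Lpv cv] := PN_coefs N Lv.
rewrite (cd i k).1 (cd i k).2 !(fcosB, fsinB)// (cu i k).1 (cu i k).2 (cv i k).1 (cv i k).2.
by rewrite !mulrBr.
Qed.

Lemma normH_PN_le u : L2v u -> normH (P u) <= normH u.
Proof.
move=> Lu; apply: ler_sqr_ge0; rewrite ?normH_ge0//.
apply: has_boxsum_le (has_boxsum_normH_PN Lu) (has_boxsum_normH Lu) _ => k.
by case: (knorm k <= N); rewrite ?mul1r// mul0r cross_ge0.
Qed.

(** On high modes [1 <= ksq k / N^2], so the part of [u] not seen by [P] is paid for by the gradient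
    with a factor [1 / N]. *)
Lemma normH_split u : inH u -> (forall i, Hs 1 (u i)) -> normH u <= normH (P u) + normV u / N.
Proof.
move=> Hu H1; have Lu := inH_L2v Hu.
have r0 : 0 <= normV u / N by rewrite divr_ge0 ?normV_ge0// ltW.
apply: ler_sqr_ge0; rewrite ?addr_ge0 ?normH_ge0//.
apply: (@le_trans _ _ (normH (P u) ^+ 2 + N ^- 2 * normV u ^+ 2)).
  apply: has_boxsum_le (has_boxsum_normH Lu) (has_boxsumD (has_boxsum_normH_PN Lu)
    (has_boxsumZ (a := N ^- 2) (has_boxsum_normV H1))) _ => k.
  have [kN|Nk] := leP (knorm k) N.
    by rewrite mul1r lerDl !mulr_ge0 ?invr_ge0 ?exprn_ge0 ?ksq_ge0 ?cross_ge0// ltW.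
  rewrite mul0r add0r mulrA ler_peMl ?cross_ge0//.
  by rewrite mulrC ler_pdivlMr ?exprn_gt0// mul1r ksq_high.
have -> : N ^- 2 * normV u ^+ 2 = (normV u / N) ^+ 2 by rewrite exprMn exprVn mulrC.
by have := normH_ge0 (P u); move: r0; set x := normH _; set y := _ / _; nra.
Qed.

(** A Bernstein inequality: on low modes one of the two derivatives in [A] is traded for [N]. *)
Lemma normH_PN_A u : inDA u -> normH (P (A u)) <= N * normV u.
Proof.
move=> uD; apply: ler_sqr_ge0; rewrite ?mulr_ge0 ?normH_ge0 ?normV_ge0 ?(ltW N0)// exprMn.
apply: has_boxsum_le (has_boxsum_normH_PN (L2v_A u)) (has_boxsumZ (a := N ^+ 2)
  (has_boxsum_normV (inDA_Hs1 uD))) _ => k.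
rewrite cross_A// crossC cross_A//.
have [kN|Nk] := leP (knorm k) N; last first.
  by rewrite mul0r !mulr_ge0 ?sqr_ge0 ?ksq_ge0 ?cross_ge0// ltW.
by rewrite mul1r ler_wpM2r ?mulr_ge0 ?ksq_ge0 ?cross_ge0// ksq_low.
Qed.

Lemma PN_inH u : inH u -> inH (P u).
Proof.
move=> Hu; have [Lu cu] := (inH_coefs u).1 Hu; have [Lp cp] := PN_coefs N Lu.
apply/inH_coefs; split => // k; have [u1 u2 u3] := cu k; split.
- transitivity ((knorm k <= N)%R%:R * \sum_i wn i k * fcos (u i) k); last by rewrite u1 mulr0.
  by rewrite mulr_sumr; apply: eq_bigr => i _; rewrite (cp i k).1; ring.
- transitivity ((knorm k <= N)%R%:R * \sum_i wn i k * fsin (u i) k); last by rewrite u2 mulr0.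
  by rewrite mulr_sumr; apply: eq_bigr => i _; rewrite (cp i k).2; ring.
- by move=> i k0; rewrite (cp i k).1 u3// mulr0.
Qed.

Lemma wn_le_ksq j k : wn j k ^+ 2 <= ksq k :> R.
Proof. by rewrite /ksq (bigD1 j)//= lerDl; apply: sumr_ge0 => i _; exact: sqr_ge0. Qed.

(** The derivative is built from its coefficients, at most [N] times those of [u]. This regularity
    allows [P_N A vs] as an argument of the antisymmetry. *)
Lemma PN_Hs1 u : L2v u -> forall i, Hs 1 (P u i).
Proof.
move=> Lu i; have [Lp cp] := PN_coefs N Lu; split; first exact: Lp.
move=> j; have [|||h [Lh hc]] := @exists_field_coefs R
    (fun i k => wn j k * fsin (P u i) k) (fun i k => - wn j k * fcos (P u i) k) u (N ^+ 2) _ Lu.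
- exact: sqr_ge0.
- move=> a k; have [-> ->] := coefs_hermitian (Lp a) k.
  by rewrite wnN; split; ring.
- move=> a k; have [-> ->] := cp a k.
  have -> : (wn j k * ((knorm k <= N)%R%:R * fsin (u a) k)) ^+ 2 +
      (- wn j k * ((knorm k <= N)%R%:R * fcos (u a) k)) ^+ 2 =
      (wn j k ^+ 2 * (knorm k <= N)%R%:R ^+ 2) * (fcos (u a) k ^+ 2 + fsin (u a) k ^+ 2)
        by ring.
  apply: ler_pM (cross_coef_le u a k).
  - by apply: mulr_ge0; exact: sqr_ge0.
  - by apply: addr_ge0; exact: sqr_ge0.
  have [kN|Nk] := leP (knorm k) N; last by rewrite expr0n mulr0 sqr_ge0.
  by rewrite expr1n mulr1 (le_trans (wn_le_ksq j k))// ksq_low.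
by exists (h i); [apply: coefs_weak_pd => //; exact: hc|by split; [exact: Lh|]].
Qed.

Lemma normV_PN u : L2v u -> normV (P u) <= N * normH (P u).
Proof.
move=> Lu; apply: ler_sqr_ge0; rewrite ?mulr_ge0 ?normH_ge0 ?normV_ge0 ?(ltW N0)// exprMn.
have Lp := L2v_PN Lu.
apply: has_boxsum_le (has_boxsum_normV (PN_Hs1 Lu)) (has_boxsumZ (a := N ^+ 2)
  (has_boxsum_normH Lp)) _ => k.
rewrite cross_PN//; have [kN|Nk] := leP (knorm k) N; last by rewrite !mul0r !mulr0.
by rewrite mul1r ler_wpM2r ?cross_ge0// ksq_low.
Qed.

End Projection.

(** Once the disc of radius [N] contains the box of size [n], its tail is dominated mode by mode by
    the error of the box truncations. *)
Lemma PN_tail u (e : R) : L2v u -> 0 < e -> exists N0, 0 < N0 /\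
  forall N, N0 <= N -> normH (u - PN N u) <= e.
Proof.
move=> Lu e0.
have e2 : 0 < e ^+ 2 / 2 by rewrite divr_gt0// exprn_gt0.
have [n0 n0P] := partial_cvg (Lu ord0) e2; have [n1 n1P] := partial_cvg (Lu ord_max) e2.
pose n := maxn n0 n1; pose T : vfield R := fun i => partial (u i) n - u i.
have LT : L2v T by move=> i; exact: (L2B (L2_partial _ _) (Lu i)).
have Te : normH T ^+ 2 <= e ^+ 2.
  rewrite normH_sqr /inner ord2_sum [leRHS](splitr (e ^+ 2)).
  by apply: lerD; [exact: (n0P n (leq_maxl n0 n1))|exact: (n1P n (leq_maxr n0 n1))].
(* Wave vectors of the box have norm at most [sqrt 2 * n]; the successor keeps the radius
   positive. *)
exists (2 * n.+1%:R); split; first by rewrite mulr_gt0.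
move=> N nN; apply: ler_sqr_ge0; rewrite ?normH_ge0 ?(ltW e0)//; apply: le_trans Te.
have [Lp cp] := PN_coefs N Lu.
apply: has_boxsum_le (has_boxsum_normH (L2vB Lu Lp)) (has_boxsum_normH LT) _ => k.
have cT i : fcos (T i) k = ((k \in box n)%:R - 1) * fcos (u i) k /\
            fsin (T i) k = ((k \in box n)%:R - 1) * fsin (u i) k.
  have [Lp' Lu'] := (L2_partial (u i) n, Lu i).
  by rewrite /T fcosB// fsinB// fcos_partial// fsin_partial// !mulrBl !mul1r.
have cd i : fcos ((u - PN N u) i) k = (1 - (knorm k <= N)%R%:R) * fcos (u i) k /\
            fsin ((u - PN N u) i) k = (1 - (knorm k <= N)%R%:R) * fsin (u i) k.
  by rewrite (fcosB _ (Lu i) (Lp i)) (fsinB _ (Lu i) (Lp i))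
    (cp i k).1 (cp i k).2 !mulrBl !mul1r.
rewrite (cross_scale cd cd) (cross_scale cT cT) ler_wpM2r ?cross_ge0//.
have [kN|Nk] := leP (knorm k) N; first by rewrite subrr mul0r -expr2 sqr_ge0.
have [kn|kn] := boolP (k \in box n); last by rewrite subr0 sub0r mulrNN.
suff : knorm k <= N by rewrite leNgt Nk.
apply: le_trans nN; apply: ler_sqr_ge0; rewrite ?sqrtr_ge0 ?mulr_ge0//.
rewrite /knorm -ksqE sqr_sqrtr ?ksq_ge0// ksqE.
move: kn; rewrite mem_box => /andP[k1 k2].
have sq (x : int) : (`|x| <= n)%N -> x%:~R ^+ 2 <= n%:R ^+ 2 :> R.
  move=> xn; rewrite -[leLHS]real_normK ?num_real// ler_pXn2r ?nnegrE//.
  by rewrite -intr_norm -[n%:R]/(n%:Z%:~R) ler_int -abszE lez_nat.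
have := sq _ k1; have := sq _ k2; rewrite -natr1.
by have : 0 <= n%:R :> R by []; nra.
Qed.

End Norms.

(** * Estimates *)

Section Estimates.
Context {R : realType}.
Implicit Types (i j : 'I_2).
Implicit Types (u v w phi f us vs : vfield R) (M N al mu : R).
Notation leb2 := (@leb2 R).
Notation torus := (@torus R).

(** A bounded advecting field puts [adv u v] in L^2, where the Leray projection exists and
    disappears against fields of H. *)
Lemma B_spec M u v : 0 <= M -> ae_bounded M u -> L2v u ->
  inH (B u v) /\ forall phi, inH phi -> inner (B u v) phi = trilinear u v phi.
Proof. by move=> M0 bu Lu; apply: leray_spec; exact: (normH_adv v M0 bu Lu).1. Qed.

Lemma trilinearBl M M' u u' v phi : ae_bounded M u -> ae_bounded M' u' -> L2v u -> L2v u' ->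
  L2v phi ->
  trilinear (u - u') v phi = trilinear u v phi - trilinear u' v phi.
Proof.
move=> bu bu' Lu Lu' Lphi; rewrite /trilinear.
have -> : adv (u - u') v = adv u v - adv u' v.
  apply/funext => i; transitivity (adv u v i - adv u' v i); last by [].
  by rewrite /adv -sumrB; apply: eq_bigr => j _; rewrite -mulrBl.
rewrite innerBl//.
- by move=> i; apply: L2_sum => j _; apply: L2_bdd_mul bu _ _ => //; exact: L2_mfun (Lu j).
- by move=> i; apply: L2_sum => j _; apply: L2_bdd_mul bu' _ _ => //; exact: L2_mfun (Lu' j).
Qed.

(** Each [pd] is a separately chosen representative, so linearity can only be read off the
    coefficients. *)
Lemma pdB_ae j (g h : R * R -> R) : Hs 1 g -> Hs 1 h ->
  {ae leb2, forall z, torus z -> pd j (g - h) z = (pd j g - pd j h) z}.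
Proof.
move=> Hg Hh; have Lg := Hs_L2 Hg; have Lh := Hs_L2 Hh.
apply: coefs_ae => //; first exact: L2B.
move=> k; have [-> ->] := Hs1_coefs j (HsB Hg Hh) k.
rewrite !(fcosB, fsinB)//; have [-> ->] := Hs1_coefs j Hg k; have [-> ->] := Hs1_coefs j Hh k.
by split; ring.
Qed.

Lemma trilinearBr M u v v' phi : ae_bounded M u -> L2v u -> L2v phi ->
  (forall i, Hs 1 (v i)) -> (forall i, Hs 1 (v' i)) ->
  trilinear u (v - v') phi = trilinear u v phi - trilinear u v' phi.
Proof.
move=> bu Lu Lphi Hv Hv'; rewrite !(trilinearE _ bu)// -sumrB; apply: eq_bigr => i _.
have Lp j h : L2 h -> L2 (u j * h).
  by move=> Lh; apply: L2_bdd_mul bu _ Lh; exact: L2_mfun (Lu j).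
rewrite /advect -sumrB; apply: eq_bigr => j _.
have Lup := Lp j _ (Lphi i).
rewrite !L2dot_swap -L2dotBl//; apply: L2dot_aeeq => //; first exact: L2B.
exact: pdB_ae.
Qed.

Lemma agmon_ae_bounded cA u : agmon cA -> inDA u ->
  ae_bounded (cA * Num.sqrt (normH (A u)) * Num.sqrt (normH u)) u.
Proof. by move=> ag uD; apply: normLp_ae_bounded; exact: ag. Qed.

Lemma ae_bounded_le M M' u : M <= M' -> ae_bounded M u -> ae_bounded M' u.
Proof. by move=> MM; apply: filterS => z uz tz; rewrite (le_trans (uz tz)). Qed.

(** Poincare's inequality merges the two square roots. The gain is qualitative: every field of D(A)
    is bounded, so [B_spec] and the antisymmetry apply to it. *)
Lemma agmon_ae_bounded_A cA u : 0 < cA -> agmon cA -> inDA u -> ae_bounded (cA * normH (A u)) u.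
Proof.
move=> cA0 ag uD; apply: ae_bounded_le (agmon_ae_bounded ag uD).
rewrite -mulrA ler_wpM2l ?(ltW cA0)// -{2}[normH (A u)]sqr_sqrtr ?normH_ge0// expr2.
rewrite ler_wpM2l ?sqrtr_ge0// ler_wsqrtr//.
exact: le_trans (poincare (inDA_inH uD) (inDA_Hs1 uD)) (normV_le_A uD).
Qed.

(** Since |u| <= ||u|| <= |A u|, replacing ||u|| by |u| under the logarithm only enlarges the bound
    and gives the bracket of the conditions on [mu] and [N]; the logarithm is non-negative. *)
Lemma brezis_gallouet_ae_bounded cBG u : 0 < cBG -> brezis_gallouet cBG -> inDA u -> ~ eqH u 0 ->
  0 <= 1 + ln (normH (A u) / normH u) /\
  ae_bounded (cBG * normV u * Num.sqrt (1 + ln (normH (A u) / normH u))) u.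
Proof.
move=> c0 bg uD u0.
have h0 : 0 < normH u.
  rewrite lt_neqAle normH_ge0 andbT eq_sym; apply/eqP => /(normH_eq0 (inDA_L2v uD)).
  exact: u0.
have hv : normH u <= normV u := poincare (inDA_inH uD) (inDA_Hs1 uD).
have va := normV_le_A uD.
have v0 : 0 < normV u := lt_le_trans h0 hv.
have a0 : 0 < normH (A u) := lt_le_trans v0 va.
have lnle : ln (normH (A u) / normV u) <= ln (normH (A u) / normH u).
  rewrite ler_ln ?posrE ?divr_gt0//.
  by rewrite ler_wpM2l ?(ltW a0)// lef_pV2 ?posrE.
have ln0 : 0 <= ln (normH (A u) / normV u).
  by rewrite ln_ge0// ler_pdivlMr// mul1r.
split; first by rewrite addr_ge0// (le_trans ln0).
apply: ae_bounded_le (normLp_ae_bounded (bg _ uD u0)).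
rewrite ler_wpM2l ?mulr_ge0 ?(ltW c0) ?normV_ge0// ler_wsqrtr// lerD2l//.
Qed.

Definition energy al mu N w : R := al * normV w ^+ 2 + mu * normH (PN N w) ^+ 2.

(** The form is at most M ||w|| |w|, and |w| <= |P_N w| + ||w|| / N. The condition on [N] absorbs
    the gradient part into a quarter of [al ||w||^2]; the condition on [mu] and the
    arithmetic-geometric mean inequality put the other part below an eighth of the energy. *)
Lemma trilinear_le_energy M al mu N w vs : 0 <= M -> 0 < al -> 0 < mu -> 0 < N ->
  4 * M <= al * N -> 16 * M ^+ 2 <= mu * al ->
  ae_bounded M vs -> L2v vs -> inDA w -> `|trilinear w w vs| <= energy al mu N w / 2.
Proof.
move=> M0 al0 mu0 N0 MN MM bvs Lvs wD.
have Lw := inDA_L2v wD.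
apply: le_trans (trilinear_bound3 w M0 bvs Lw Lvs) _.
have := normH_split N0 (inDA_inH wD) (inDA_Hs1 wD).
rewrite /energy; have := normH_ge0 (PN N w); have := normV_ge0 w.
set x := normV w; set p := normH (PN N w); set d := normH w => x0 p0 dle.
apply: (@le_trans _ _ (M * x * (p + x / N))); first by rewrite ler_wpM2l ?mulr_ge0.
have h1 : M * x * (x / N) <= al * x ^+ 2 / 4.
  rewrite (_ : M * x * (x / N) = (M / N) * x ^+ 2); last by ring.
  rewrite (_ : al * x ^+ 2 / 4 = (al / 4) * x ^+ 2); last by ring.
  by rewrite ler_wpM2r ?sqr_ge0// ler_pdivrMr// mulrAC ler_pdivlMr// mulrC.
have h2 : 8 * (M * x * p) <= al * x ^+ 2 + mu * p ^+ 2.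
  have a0 : 0 <= al * x ^+ 2 by rewrite mulr_ge0 ?sqr_ge0// ltW.
  have b0 : 0 <= mu * p ^+ 2 by rewrite mulr_ge0 ?sqr_ge0// ltW.
  apply: ler_sqr_ge0; rewrite ?mulr_ge0 ?addr_ge0//.
  apply: (@le_trans _ _ (4 * ((al * x ^+ 2) * (mu * p ^+ 2)))).
    rewrite (_ : (8 * (M * x * p)) ^+ 2 = (4 * (x ^+ 2 * p ^+ 2)) * (16 * M ^+ 2));
      last by ring.
    rewrite (_ : 4 * (al * x ^+ 2 * (mu * p ^+ 2)) = (4 * (x ^+ 2 * p ^+ 2)) * (mu * al));
      last by ring.
    by rewrite ler_wpM2l// mulr_ge0// mulr_ge0 ?sqr_ge0.
  by have := sqr_ge0 (al * x ^+ 2 - mu * p ^+ 2); nra.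
rewrite mulrDr; move: h1 h2; set a := al * _; set b := mu * _; set c := M * x * _;
  set e := M * x * p.
have b0 : 0 <= b by rewrite mulr_ge0 ?sqr_ge0// ltW.
have a0 : 0 <= a by rewrite mulr_ge0 ?sqr_ge0// ltW.
lra.
Qed.

Lemma trilinear_self M u v : ae_bounded M u -> inH u -> (forall i, Hs 1 (v i)) ->
  trilinear u v v = 0.
Proof.
by move=> bu Hu Hv; have := trilinear_antisym bu Hu Hv Hv => /eqP;
  rewrite -addr_eq0 -mulr2n mulrn_eq0 => /eqP.
Qed.

End Estimates.

(** * Weak forms of the equations and real inequalities behind the estimates *)

Lemma inner_weak_form {R : realType} (al mu : R) (a p b1 b2 r phi : vfield R) :
  L2v a -> L2v p -> L2v b1 -> L2v b2 -> L2v r -> L2v phi ->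
  eqH (al *: a + mu *: p + (b1 + b2)) (- r) ->
  al * inner a phi + mu * inner p phi + (inner b1 phi + inner b2 phi) = - inner r phi.
Proof.
move=> La Lp L1 L2' Lr Lphi e.
have Laa := L2vZ al La; have Lpp := L2vZ mu Lp.
have := inner_eqH (L2vD (L2vD Laa Lpp) (L2vD L1 L2')) (L2vN Lr) Lphi e.
rewrite (innerDl (L2vD Laa Lpp) (L2vD L1 L2') Lphi) (innerDl Laa Lpp Lphi) (innerZl al La Lphi).
rewrite (innerZl mu Lp Lphi) (innerDl L1 L2' Lphi) => ->.
by rewrite -scaleN1r (innerZl (-1) Lr Lphi) mulN1r.
Qed.

(** Here [x], [p], [d], [y] stand for ||w||, |P_N w|, |w| and |P_N A vs|. After division by [y], the
    condition [4 M <= al N] hides the trilinear terms in the linear ones: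
    [y <= 3/2 al N x + (mu + al N^2 / 4) p]. Then [al N^2 <= K mu] compares both terms with the
    energy. *)
Lemma low_modes_arith {R : realType} (al mu N M K x p d y T1 T2 T3 T4 : R) :
  0 < al -> 0 < mu -> 0 < N -> 0 <= M -> 4 * M <= al * N -> 1 <= K -> al * N ^+ 2 <= K * mu ->
  0 <= x -> 0 <= p -> 0 <= y -> d <= p + x / N ->
  `|T1| <= N * x * y -> `|T2| <= p * y -> `|T3| <= M * x * y -> `|T4| <= M * (N * y) * d ->
  al * T1 + mu * T2 + (T3 + - T4) = - y ^+ 2 ->
  y ^+ 2 <= 8 * K ^+ 2 * mu * (al * x ^+ 2 + mu * p ^+ 2).
Proof.
move=> alp mu0 N0 M0 MN K1 KN x0 p0 y0 dle t1 t2 t3 t4 eqn.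
have Nd : N * d <= N * p + x.
  have := ler_wpM2l (ltW N0) dle; rewrite mulrDr (mulrC N (x / N)) divfK// gt_eqF//.
have al0' := ltW alp; have mu0' := ltW mu0; have N0' := ltW N0.
have main : y ^+ 2 <= (al * N * x + mu * p + M * x + M * (N * p + x)) * y.
  have h1 : al * `|T1| <= al * (N * x * y) by rewrite ler_wpM2l.
  have h2 : mu * `|T2| <= mu * (p * y) by rewrite ler_wpM2l.
  have h4 : M * (N * y) * d <= M * (N * p + x) * y.
    rewrite (_ : M * (N * y) * d = M * (N * d) * y); last by ring.
    by rewrite ler_wpM2r// ler_wpM2l.
  have h5 : y ^+ 2 <= al * `|T1| + mu * `|T2| + `|T3| + `|T4|.
    have -> : y ^+ 2 = - (al * T1 + mu * T2 + (T3 + - T4)) by lra.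
    have n1 : - (al * T1) <= al * `|T1| by rewrite -mulrN ler_wpM2l// -normrN ler_norm.
    have n2 : - (mu * T2) <= mu * `|T2| by rewrite -mulrN ler_wpM2l// -normrN ler_norm.
    have n3 : - T3 <= `|T3| by rewrite -normrN ler_norm.
    have := ler_norm T4; lra.
  apply: (le_trans h5); rewrite !mulrDl; lra.
have lin : y <= 3 / 2 * (al * N * x) + (mu + al * N ^+ 2 / 4) * p.
  have yle : y <= al * N * x + mu * p + M * x + M * (N * p + x).
    have [->|yn] := eqVneq y 0.
      by rewrite !addr_ge0 ?mulr_ge0 ?addr_ge0 ?mulr_ge0.
    by rewrite -(@ler_pM2r _ y) ?lt_neqAle ?y0 1?eq_sym ?yn// -expr2.
  apply: (le_trans yle).
  have m1 : 4 * M * x <= al * N * x by rewrite ler_wpM2r.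
  have m2 : 4 * M * (N * p) <= al * N * (N * p) by rewrite ler_wpM2r// mulr_ge0.
  rewrite (_ : al * N ^+ 2 / 4 = al * N * N / 4); last by ring.
  rewrite mulrDr [(mu + _) * p]mulrDl; lra.
have lin2 : y <= 3 / 2 * (al * N * x) + (5 / 4 * K * mu) * p.
  apply: (le_trans lin); rewrite lerD2l ler_wpM2r//.
  have : mu <= K * mu by rewrite ler_peMl.
  lra.
apply: (@le_trans _ _ ((3 / 2 * (al * N * x) + 5 / 4 * K * mu * p) ^+ 2)).
  by rewrite ler_pXn2r ?nnegrE// (le_trans _ lin2).
apply: (@le_trans _ _ (2 * ((3 / 2 * (al * N * x)) ^+ 2 + (5 / 4 * K * mu * p) ^+ 2))).
  by have := sqr_ge0 (3 / 2 * (al * N * x) - 5 / 4 * K * mu * p); nra.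
(* In this bound and the next, 9/4 and 25/16 are rounded up to 4 and a single [K] to [K^2]; with the
   2 from squaring a sum this gives the factor 8. *)
have q1 : (3 / 2 * (al * N * x)) ^+ 2 <= 4 * K ^+ 2 * mu * (al * x ^+ 2).
  rewrite (_ : (3 / 2 * (al * N * x)) ^+ 2 = 9 / 4 * (al * N ^+ 2) * (al * x ^+ 2));
    last by field.
  rewrite ler_wpM2r ?mulr_ge0 ?sqr_ge0//.
  apply: (@le_trans _ _ (9 / 4 * (K * mu))); first by rewrite ler_wpM2l.
  rewrite expr2 (_ : 4 * (K * K) * mu = 4 * K * (K * mu)); last by ring.
  apply: ler_wpM2r; last lra.
  by rewrite mulr_ge0 ?(ltW mu0)// (le_trans ler01).
have q2 : (5 / 4 * K * mu * p) ^+ 2 <= 4 * K ^+ 2 * mu * (mu * p ^+ 2).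
  rewrite (_ : (5 / 4 * K * mu * p) ^+ 2 = 25 / 16 * (K ^+ 2 * mu * (mu * p ^+ 2)));
    last by field.
  rewrite (_ : 4 * K ^+ 2 * mu * (mu * p ^+ 2) = 4 * (K ^+ 2 * mu * (mu * p ^+ 2)));
    last by ring.
  apply: ler_wpM2r; last lra.
  by apply: mulr_ge0; apply: mulr_ge0; rewrite ?sqr_ge0 ?(ltW mu0).
lra.
Qed.

(** Writing [al a - nu a'] as [al (a - a') + (al - nu) a'] isolates the viscosity mismatch as the
    only source term. *)
Lemma inner_weak_form_diff {R : realType} (al nu mu N : R) (vs us f a a' b b' phi : vfield R) :
  L2v vs -> L2v us -> L2v f -> L2v a -> L2v a' -> L2v b -> L2v b' -> L2v phi ->
  eqH (al *: a + b + mu *: PN N vs) (f + mu *: PN N us) ->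
  eqH (nu *: a' + b') f ->
  al * (inner a phi - inner a' phi) + mu * inner (PN N (vs - us)) phi
    + (al - nu) * inner a' phi + (inner b phi - inner b' phi) = 0.
Proof.
move=> Lvs Lus Lf La La' Lb Lb' Lphi e e'.
have Lp := L2v_PN N Lvs; have Lp' := L2v_PN N Lus.
have Laa := L2vZ al La; have Laa' := L2vZ nu La'; have Lpp := L2vZ mu Lp;
  have Lpp' := L2vZ mu Lp'.
have := inner_eqH (L2vD (L2vD Laa Lb) Lpp) (L2vD Lf Lpp') Lphi e.
have := inner_eqH (L2vD Laa' Lb') Lf Lphi e'.
rewrite (innerDl (L2vD Laa Lb) Lpp Lphi) (innerDl Laa Lb Lphi) (innerZl al La Lphi).
rewrite (innerZl mu Lp Lphi) (innerDl Lf Lpp' Lphi) (innerZl mu Lp' Lphi).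
rewrite (innerDl Laa' Lb' Lphi) (innerZl nu La' Lphi) (inner_PNB N Lvs Lus Lphi).
move: (inner a phi) (inner a' phi) (inner b phi) (inner b' phi) (inner f phi)
  (inner (PN N vs) phi) (inner (PN N us) phi) => *; nra.
Qed.

(* If D > s/4 then s < 4D and d <= r^2 D, so each perturbation term is a small
   multiple of nu0 D^2; the value of r is chosen so that they add up to less
   than nu0 D^2. *)
Lemma stability_arith {R : realType} (cA nu0 al mu rho r s x d D us_V I1 T1 T2 T3 T4 T5 : R) :
  0 < cA -> 0 < nu0 -> nu0 <= al -> 0 < mu -> 0 <= rho -> rho <= r ^+ 2 / 8 ->
  r = nu0 / (4 * cA * s + 4 * nu0) -> 0 <= s -> 0 <= x -> 0 <= d -> 0 <= D ->
  d <= x -> x <= 2 * rho * s -> us_V <= s -> 0 <= us_V ->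
  0 <= T1 -> `|T2| <= rho * nu0 * (s * D) -> `|T3| <= cA * s * x * D ->
  `|T4| <= cA * Num.sqrt D * Num.sqrt d * us_V * D ->
  `|T5| <= cA * Num.sqrt D * Num.sqrt d * x * D ->
  al * I1 + mu * T1 + T2 + (T3 + (T4 + T5)) = 0 -> I1 = D ^+ 2 ->
  D <= s / 4.
Proof.
move=> cA0 nu00 al0 mu0 rho0 rhor rE s0 x0 d0 D0 dx xs us us0 T10 t2 t3 t4 t5 eqn I1E.
rewrite {}I1E in eqn.
rewrite leNgt; apply/negP => sD.
have Dp : 0 < D by apply: le_lt_trans sD; rewrite divr_ge0.
have den0 : 0 < 4 * cA * s + 4 * nu0.
  by rewrite ltr_wpDl ?mulr_gt0// !mulr_ge0// ltW.
have cAs0 : 0 <= cA * s by rewrite mulr_ge0// ltW.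
have r0 : 0 < r by rewrite rE divr_gt0.
have rden : r * (4 * cA * s + 4 * nu0) = nu0 by rewrite rE divfK// gt_eqF.
(* The two summands in the denominator of [r] give this bound and the next: [r <= 1/4] and
   [r cA s <= nu0 / 4]. *)
have r4 : r <= 4^-1.
  by rewrite -(@ler_pM2r _ (4 * nu0)) ?mulr_gt0// (mulrC 4^-1) -[leRHS]mulrA;
    have := mulr_ge0 (ltW r0) cAs0; nra.
have rcs : r * (cA * s) <= nu0 / 4.
  have := mulr_ge0 (ltW r0) (ltW nu00); nra.
have rr : r ^+ 2 <= r / 4 by rewrite expr2 ler_wpM2l// ltW.
have dD : D * d <= (r * D) ^+ 2.
  have : d <= r ^+ 2 * D.
    apply: (le_trans dx); apply: (le_trans xs).
    apply: (@le_trans _ _ (2 * (r ^+ 2 / 8) * s)); first by rewrite ler_wpM2r// ler_wpM2l.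
    by have := sqr_ge0 r; nra.
  by move=> dr; rewrite exprMn [D ^+ 2]expr2 mulrA mulrC ler_wpM2r// ltW.
have sqD : Num.sqrt D * Num.sqrt d <= r * D.
  rewrite -sqrtrM//; apply: (@le_trans _ _ (Num.sqrt ((r * D) ^+ 2)));
    first by rewrite ler_wsqrtr.
  by rewrite sqrtr_sqr ger0_norm// mulr_ge0// ltW.
have Q0 : 0 <= Num.sqrt D * Num.sqrt d by rewrite mulr_ge0 ?sqrtr_ge0.
have rho1 : rho <= r / 32 by apply: (le_trans rhor); lra.
have rho2 : rho <= 1 / 128 by lra.
have xle : x <= s / 64.
  by apply: (le_trans xs); have := ler_wpM2r s0 rho2; lra.
have b2 : rho * nu0 * (s * D) <= nu0 / 32 * D ^+ 2.
  apply: (@le_trans _ _ (1 / 128 * nu0 * (4 * D * D))); last by rewrite expr2; lra.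
  apply: ler_pM; rewrite ?mulr_ge0 ?(ltW nu00)//.
    by rewrite ler_wpM2r// ltW.
  by rewrite ler_wpM2r//; lra.
have b3 : cA * s * x * D <= nu0 / 16 * D ^+ 2.
  rewrite expr2 mulrA ler_wpM2r//.
  apply: (@le_trans _ _ (cA * s * (r * D / 4))).
    rewrite ler_wpM2l//; apply: (le_trans xs).
    have h := ler_wpM2r s0 rho1.
    have h2 : r * s <= r * (4 * D) by rewrite ler_wpM2l ?(ltW r0)//; lra.
    lra.
  have := ler_wpM2r D0 rcs; lra.
have cQ : cA * Num.sqrt D * Num.sqrt d <= cA * (r * D) by rewrite -mulrA ler_wpM2l// ltW.
have cQ0 : 0 <= cA * Num.sqrt D * Num.sqrt d by rewrite -mulrA mulr_ge0// ltW.
have crsD : cA * (r * D) * s * D <= nu0 / 4 * D ^+ 2.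
  have := ler_wpM2r (sqr_ge0 D) rcs.
  by rewrite (_ : cA * (r * D) * s * D = r * (cA * s) * D ^+ 2); last by ring.
have b4 : cA * Num.sqrt D * Num.sqrt d * us_V * D <= nu0 / 4 * D ^+ 2.
  by apply: le_trans crsD; rewrite ler_wpM2r//; apply: ler_pM.
have b5 : cA * Num.sqrt D * Num.sqrt d * x * D <= nu0 / 4 * D ^+ 2.
  by apply: le_trans crsD; rewrite ler_wpM2r//; apply: ler_pM => //; lra.
have aD : nu0 * D ^+ 2 <= al * D ^+ 2 by rewrite ler_wpM2r ?sqr_ge0.
have nD : 0 < nu0 * D ^+ 2 by rewrite mulr_gt0// exprn_gt0.
have mT : 0 <= mu * T1 by rewrite mulr_ge0// ltW.
have m2 : - T2 <= `|T2| by rewrite -normrN ler_norm.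
have m3 : - T3 <= `|T3| by rewrite -normrN ler_norm.
have m4 : - T4 <= `|T4| by rewrite -normrN ler_norm.
have m5 : - T5 <= `|T5| by rewrite -normrN ler_norm.
(* [T1] has the good sign, and the other terms add up to at most
   [(1/32 + 1/16 + 1/4 + 1/4) nu0 D^2], less than [nu0 D^2]. *)
lra.
Qed.

(** With [d = vs - us]: [t3] is (B(us,d),d) = 0, and [t4 + t5], that is (B(d,us),d) + (B(d,d),d),
    equals [t8] = (B(d,vs),d) = -(B(d,d),vs). The last is absorbed by half of the energy of [d]. *)
Lemma difference_energy_arith {R : realType} (al mu x2 p2 I1 I2 X r t3 t4 t5 t7 t8 : R) :
  al * I1 + mu * I2 + X + (t3 + (t4 + t5)) = 0 -> I1 = x2 -> I2 = p2 -> t3 = 0 ->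
  t5 = t8 - t4 -> t7 = - t8 -> `|t7| <= (al * x2 + mu * p2) / 2 -> 0 <= mu * p2 ->
  `|X| <= r -> al * x2 / 2 <= r.
Proof.
move=> e e1 e2 e3 e5 e7 t7le mp Xr; rewrite e1 e2 e3 e5 in e.
have c3 := ler_norm t7; have c2 : - X <= `|X| by rewrite -normrN ler_norm.
lra.
Qed.

Lemma difference_norm_arith {R : realType} (al nu0 rho s x : R) :
  0 < nu0 -> nu0 <= al -> 0 <= rho -> 0 <= x -> 0 <= s ->
  al * x ^+ 2 / 2 <= rho * nu0 * (s * x) -> x <= 2 * rho * s.
Proof.
move=> nu00 al0 rho0 x0 sp key.
have [->|xn] := eqVneq x 0; first by rewrite !mulr_ge0.
have xp : 0 < x by rewrite lt_neqAle eq_sym xn.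
rewrite -(@ler_pM2r _ (nu0 * x / 2)) ?divr_gt0 ?mulr_gt0//.
apply: (@le_trans _ _ (al * x ^+ 2 / 2)).
  rewrite expr2 (_ : x * (nu0 * x / 2) = nu0 * (x * x) / 2); last by ring.
  by rewrite ler_pM2r// ler_wpM2r// mulr_ge0.
apply: (le_trans key); lra.
Qed.

Lemma low_modes_ge_arith {R : realType} (a a' q pu pu' pv pd pd' d : R) :
  a = a' -> a' <= q + pu -> pu = pu' -> pu' <= pv + pd' -> pd' = pd -> pd <= d ->
  q <= a / 4 -> d <= a / 4 -> a / 2 <= pv.
Proof. by move=> *; lra. Qed.

Lemma weak_difference_arith {R : realType} (al nu mu x1 x2 x3 x4 x5 x6 x7 x8 x9 y1 y2 y3 y4 :
  R) :
  al * (x2 - x3) + mu * x6 + (al - nu) * x3 + (x4 - x5) = 0 ->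
  x4 = y4 -> x5 = y2 -> x1 = x2 - x3 -> x7 = y3 - y2 -> x9 = y1 - x8 -> y1 = y4 - y3 ->
  al * x1 + mu * x6 + (al - nu) * x3 + (x7 + (x8 + x9)) = 0.
Proof. by move=> e e4 e5 e1 e7 e9 e10; rewrite e1 e7 e9; lra. Qed.

(** * The linearized equation and the comparison of the two stationary solutions *)

Section Sensitivity.
Context {R : realType}.
Implicit Types (u v w phi f us vs : vfield R).
Variables (cA nu0 nu al mu N M : R) (f us vs : vfield R).
Hypotheses (cA0 : 0 < cA) (agA : agmon cA).
Hypotheses (nu00 : 0 < nu0) (al0 : nu0 <= al) (mu0 : 0 < mu) (N0 : 0 < N).
Hypotheses (M0 : 0 <= M) (MN : 4 * M <= al * N) (MM : 16 * M ^+ 2 <= mu * al)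
  (bvs : ae_bounded M vs).
Hypotheses (Hf : inH f) (usD : inDA us) (vsD : inDA vs).
Hypothesis eq_us : eqH (nu *: A us + B us us) f.
Hypothesis eq_vs : eqH (al *: A vs + B vs vs + mu *: PN N vs) (f + mu *: PN N us).

Let alp : 0 < al := lt_le_trans nu00 al0.
Let Lus := inDA_L2v usD.
Let Lvs := inDA_L2v vsD.

Let boundedA u (uD : inDA u) : ae_bounded (cA * normH (A u)) u := agmon_ae_bounded_A cA0 agA uD.
Let MA u : 0 <= cA * normH (A u). Proof. by rewrite mulr_ge0 ?normH_ge0// ltW. Qed.

Lemma weak_linearized w phi : inDA w ->
  eqH (al *: A w + mu *: PN N w + DB vs w) (- A vs) -> inH phi ->
  al * inner (A w) phi + mu * inner (PN N w) phi + (trilinear vs w phi + trilinear w vs phi)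
  = - inner (A vs) phi.
Proof.
move=> wD eq_w Hphi; have Lphi := inH_L2v Hphi.
have [HB1 B1] := B_spec w M0 bvs Lvs.
have [HB2 B2] := B_spec vs (MA w) (boundedA wD) (inDA_L2v wD).
have LB1 := inH_L2v HB1; have LB2 := inH_L2v HB2; have LP := L2v_PN N (inDA_L2v wD).
have LA := L2v_A w; have LAv := L2v_A vs.
have b1 := B1 _ Hphi; have b2 := B2 _ Hphi.
rewrite -b1 -b2; exact: inner_weak_form.
Qed.

Lemma linearized_energy w : inDA w ->
  eqH (al *: A w + mu *: PN N w + DB vs w) (- A vs) ->
  energy al mu N w / 2 <= - inner (A vs) w.
Proof.
move=> wD eq_w; have Lw := inDA_L2v wD.
rewrite -(weak_linearized wD eq_w (inDA_inH wD)).
rewrite (trilinear_self bvs (inDA_inH vsD) (inDA_Hs1 wD)) add0r.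
rewrite (trilinear_antisym (boundedA wD) (inDA_inH wD) (inDA_Hs1 vsD) (inDA_Hs1 wD)).
rewrite inner_A// inner_PN// -normH_sqr -/(energy al mu N w).
have := ler_norm (trilinear w w vs);
  have := trilinear_le_energy M0 alp mu0 N0 MN MM bvs Lvs wD; lra.
Qed.

(** Both trilinear terms are estimated with the supremum of [vs]: directly where [vs] advects, and
    after antisymmetry in the other, where the derivative falls on [P_N A vs] and costs a factor
    [N]. *)
Lemma low_modes_le (K : R) w : 1 <= K -> al * N ^+ 2 <= K * mu -> inDA w ->
  eqH (al *: A w + mu *: PN N w + DB vs w) (- A vs) ->
  normH (PN N (A vs)) ^+ 2 <= 8 * K ^+ 2 * mu * energy al mu N w.
Proof.
move=> K1 KN wD eq_w; have Lw := inDA_L2v wD; have LA := L2v_A vs.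
pose phi := PN N (A vs); have Hphi : inH phi := PN_inH N (inH_A vsD).
have Lphi := inH_L2v Hphi; have H1phi : forall i, Hs 1 (phi i) := PN_Hs1 N0 LA.
have eqn0 := weak_linearized wD eq_w Hphi.
have anti := trilinear_antisym (boundedA wD) (inDA_inH wD) (inDA_Hs1 vsD) H1phi.
have iA : inner (A vs) phi = normH phi ^+ 2.
  by rewrite normH_sqr innerC; exact: (inner_PN N LA LA).
have iAw : inner (A w) phi = inner (PN N (A w)) phi.
  by rewrite innerC [RHS]innerC; exact: (inner_PN N LA (L2v_A w)).
have t1 : `|inner (PN N (A w)) phi| <= N * normV w * normH phi.
  apply: le_trans (inner_CS (L2v_PN N (L2v_A w)) Lphi) _.
  by rewrite ler_wpM2r ?normH_ge0// normH_PN_A.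
have t2 := inner_CS (L2v_PN N Lw) Lphi.
have t3 := trilinear_bound1 w M0 bvs Lvs Lphi.
have t4 : `|trilinear w phi vs| <= M * (N * normH phi) * normH w.
  apply: le_trans (trilinear_bound3 phi M0 bvs Lw Lvs) _.
  by rewrite ler_wpM2r ?normH_ge0// ler_wpM2l//; exact: normV_PN.
have dle := normH_split N0 (inDA_inH wD) (inDA_Hs1 wD).
(* Explicit equational terms: [rewrite] would compare unrelated fields up to conversion. *)
have eqn : al * inner (PN N (A w)) phi + mu * inner (PN N w) phi +
    (trilinear vs w phi + - trilinear w phi vs) = - normH phi ^+ 2.
  refine (etrans (congr1 (fun t => al * t + mu * inner (PN N w) phi +
    (trilinear vs w phi + - trilinear w phi vs)) (esym iAw)) _).
  refine (etrans (congr1 (fun t => al * inner (A w) phi + mu * inner (PN N w) phi +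
    (trilinear vs w phi + t)) (esym anti)) _).
  exact: etrans eqn0 (congr1 -%R iA).
exact: (low_modes_arith alp mu0 N0 M0 MN K1 KN (normV_ge0 w) (normH_ge0 (PN N w))
  (normH_ge0 phi) dle t1 t2 t3 t4 eqn).
Qed.

Let deD : inDA (vs - us). Proof. exact: inDAB. Qed.
Let Lde : L2v (vs - us) := inDA_L2v deD.

Lemma A_sub_coefs i k : fcos (A (vs - us) i) k = fcos (A vs i) k - fcos (A us i) k /\
  fsin (A (vs - us) i) k = fsin (A vs i) k - fsin (A us i) k.
Proof.
have [d1 d2] := A_coefs deD i k; have [v1 v2] := A_coefs vsD i k;
  have [u1 u2] := A_coefs usD i k.
have b1 := fcosB k (Lvs i) (Lus i); have b2 := fsinB k (Lvs i) (Lus i).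
split.
  apply: (etrans d1); apply: (etrans (congr1 ( *%R (ksq k)) b1));
    apply: (etrans (mulrBr _ _ _)).
  exact: (congr2 (fun x y => x - y) (esym v1) (esym u1)).
apply: (etrans d2); apply: (etrans (congr1 ( *%R (ksq k)) b2)); apply: (etrans (mulrBr _ _ _)).
exact: (congr2 (fun x y => x - y) (esym v2) (esym u2)).
Qed.

Lemma A_sub_inner phi : L2v phi ->
  inner (A (vs - us)) phi = inner (A vs) phi - inner (A us) phi.
Proof.
move=> Lphi; apply: (etrans _ (innerBl (L2v_A vs) (L2v_A us) Lphi)).
apply: (has_boxsum_eq (has_boxsum_inner (L2v_A _) Lphi) (has_boxsum_inner (L2vB (L2v_A vs)
  (L2v_A us)) Lphi)) => k.
apply: eq_bigr => i _; have [c1 c2] := A_sub_coefs i k.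
have b1 := fcosB k (L2v_A vs i) (L2v_A us i); have b2 := fsinB k (L2v_A vs i) (L2v_A us i).
exact: (congr2 (fun x y => x * fcos (phi i) k + y * fsin (phi i) k)
  (etrans c1 (esym b1)) (etrans c2 (esym b2))).
Qed.

(** Expansion around [us], with [d = vs - us]: B(vs,vs) - B(us,us) = B(us,d) + B(d,us) + B(d,d). *)
Lemma weak_difference phi : inH phi ->
  al * inner (A (vs - us)) phi + mu * inner (PN N (vs - us)) phi
    + (al - nu) * inner (A us) phi
    + (trilinear us (vs - us) phi + (trilinear (vs - us) us phi + trilinear (vs - us)
      (vs - us) phi)) = 0.
Proof.
move=> Hphi; have Lphi := inH_L2v Hphi.
have [HB1 B1] := B_spec vs M0 bvs Lvs.
have [HB2 B2] := B_spec us (MA us) (boundedA usD) Lus.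
have e := inner_weak_form_diff Lvs Lus (inH_L2v Hf) (L2v_A vs) (L2v_A us)
  (inH_L2v HB1) (inH_L2v HB2) Lphi eq_vs eq_us.
have d1 := B1 _ Hphi; have d2 := B2 _ Hphi; have a1 := A_sub_inner Lphi.
have r1 := trilinearBr (boundedA usD) Lus Lphi (inDA_Hs1 vsD) (inDA_Hs1 usD).
have r2 := trilinearBr (boundedA deD) Lde Lphi (inDA_Hs1 vsD) (inDA_Hs1 usD).
have l1 := trilinearBl vs bvs (boundedA usD) Lvs Lus Lphi.
exact: (weak_difference_arith e d1 d2 a1 r1 r2 l1).
Qed.

(** The source is the viscosity mismatch times [A us], paired with [vs - us] through Poincare's
    inequality; the nudging term enters the energy that absorbs the convection. *)
Lemma difference_V (rho : R) : 0 <= rho -> `|al - nu| <= rho * nu0 ->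
  normV (vs - us) <= 2 * rho * normH (A us).
Proof.
move=> rho0 aln; have Hde := inDA_inH deD; have H1de := inDA_Hs1 deD.
have e := weak_difference Hde.
have s0 := trilinear_self (boundedA usD) (inDA_inH usD) H1de.
have bt := trilinear_le_energy M0 alp mu0 N0 MN MM bvs Lvs deD.
have anti2 := trilinear_antisym (boundedA deD) Hde H1de (inDA_Hs1 vsD).
have iA := inner_A deD.
have iP : inner (PN N (vs - us)) (vs - us) = normH (PN N (vs - us)) ^+ 2.
  exact: (etrans (inner_PN N Lde Lde) (esym (normH_sqr _))).
have cs := inner_CS (L2v_A us) Lde.
have po := poincare Hde H1de.
have r4 := trilinearBr (boundedA deD) Lde Lde (inDA_Hs1 vsD) (inDA_Hs1 usD).
have key : al * normV (vs - us) ^+ 2 / 2 <= rho * nu0 * (normH (A us) * normV (vs - us)).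
  have c1 : `|(al - nu) * inner (A us) (vs - us)| <= rho * nu0 * (normH (A us)
    * normV (vs - us)).
    rewrite normrM; apply: ler_pM => //; apply: (le_trans cs).
    by rewrite ler_wpM2l ?normH_ge0.
  have en : 0 <= mu * normH (PN N (vs - us)) ^+ 2 by rewrite mulr_ge0 ?sqr_ge0// ltW.
  exact: (difference_energy_arith e iA iP s0 r4 anti2 bt en c1).
exact: (difference_norm_arith nu00 al0 rho0 (normV_ge0 _) (normH_ge0 _) key).
Qed.

(** The nudging term is non-negative, [PN] and [A] acting mode by mode. Where [vs - us] advects, the
    multiplicative form of Agmon's inequality is essential: it exploits the smallness of |vs - us|
    from [difference_V]. Where [us] advects, the gradient bound acts directly. *)
Lemma difference_A (rho : R) : 0 <= rho ->
  rho <= (nu0 / (4 * cA * normH (A us) + 4 * nu0)) ^+ 2 / 8 -> `|al - nu| <= rho * nu0 ->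
  normH (A (vs - us)) <= normH (A us) / 4.
Proof.
move=> rho0 rhor aln; have Hde := inDA_inH deD; have H1de := inDA_Hs1 deD.
have HA := inH_A deD; have LA := L2v_A (vs - us).
have e := weak_difference HA.
have c1 : `|(al - nu) * inner (A us) (A (vs - us))| <= rho * nu0 * (normH (A us)
  * normH (A (vs - us))).
  by rewrite normrM; apply: ler_pM => //; exact: inner_CS (L2v_A us) LA.
have c2 : `|trilinear us (vs - us) (A (vs - us))| <= cA * normH (A us) * normV (vs - us)
  * normH (A (vs - us)).
  exact: trilinear_bound1 (MA us) (boundedA usD) Lus LA.
have M0' : 0 <= cA * Num.sqrt (normH (A (vs - us))) * Num.sqrt (normH (vs - us)).
  by rewrite !mulr_ge0 ?sqrtr_ge0// ltW.
have ab := agmon_ae_bounded agA deD.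
have c3 := trilinear_bound1 us M0' ab Lde LA.
have c4 := trilinear_bound1 (vs - us) M0' ab Lde LA.
have pos := inner_PN_A_ge0 N deD.
have po := poincare Hde H1de; have dV := difference_V rho0 aln.
have uV := normV_le_A usD.
exact: (stability_arith cA0 nu00 al0 mu0 rho0 rhor erefl (normH_ge0 _) (normV_ge0 _)
  (normH_ge0 _) (normH_ge0 _) po dV uV (normV_ge0 _) pos c1 c2 c3 c4 e
  (esym (normH_sqr _))).
Qed.

Lemma PN_A_us_coefs i k :
  fcos (PN N (A us) i) k = fcos ((PN N (A vs) + (-1) *: PN N (A (vs - us))) i) k /\
  fsin (PN N (A us) i) k = fsin ((PN N (A vs) + (-1) *: PN N (A (vs - us))) i) k.
Proof.
have [Lpu cu] := PN_coefs N (L2v_A us); have [Lpv cv] := PN_coefs N (L2v_A vs).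
have [Lpd cd] := PN_coefs N (L2v_A (vs - us)); have Lpd' := L2vZ (-1) Lpd.
have [c1 c2] := A_sub_coefs i k.
have [u1 u2] := cu i k; have [v1 v2] := cv i k; have [d1 d2] := cd i k.
have e1 := etrans (fcosD k (Lpv i) (Lpd' i)) (congr2 +%R v1
  (etrans (fcosZ (-1) k (Lpd i)) (congr1 ( *%R (-1)) (etrans d1 (congr1 _ c1))))).
have e2 := etrans (fsinD k (Lpv i) (Lpd' i)) (congr2 +%R v2
  (etrans (fsinZ (-1) k (Lpd i)) (congr1 ( *%R (-1)) (etrans d2 (congr1 _ c2))))).
split; [apply: (etrans u1); apply: (etrans _ (esym e1))|
        apply: (etrans u2); apply: (etrans _ (esym e2))].
  by generalize (fcos (A us i) k) (fcos (A vs i) k) => x y; ring.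
by generalize (fsin (A us i) k) (fsin (A vs i) k) => x y; ring.
Qed.

Lemma low_modes_ge : normH (A (vs - us)) <= normH (A us) / 4 ->
  normH (A us - PN N (A us)) <= normH (A us) / 4 ->
  normH (A us) / 2 <= normH (PN N (A vs)).
Proof.
move=> dA tail.
have LAu := L2v_A us; have LAv := L2v_A vs; have LAd := L2v_A (vs - us).
have LPu := L2v_PN N LAu; have LPv := L2v_PN N LAv; have LPd := L2v_PN N LAd.
have LQ := L2vB LAu LPu.
have LNd := L2vZ (-1) LPd; have LS := L2vD LPv LNd.
have eN : normH ((-1) *: PN N (A (vs - us))) = normH (PN N (A (vs - us))).
  congr Num.sqrt; rewrite (innerZl (-1) LPd LNd) innerC (innerZl (-1) LPd LPd) mulrA.
  by rewrite mulrNN !mul1r.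
have eS : normH (PN N (A us)) = normH (PN N (A vs) + (-1) *: PN N (A (vs - us))).
  congr Num.sqrt; apply: (has_boxsum_eq (has_boxsum_inner LPu LPu) (has_boxsum_inner LS LS))
    => k.
  rewrite -[RHS]mul1r -[1]mulr1; apply: cross_scale => i; rewrite !mul1r.
    exact: PN_A_us_coefs.
  exact: PN_A_us_coefs.
have eT : normH (A us) = normH (A us - PN N (A us) + PN N (A us)).
  by congr normH; apply/esym/subrK.
have t1 := normHD LQ LPu; have t2 := normHD LPv LNd; have t3 := normH_PN_le N LAd.
exact: (low_modes_ge_arith eT t1 eS t2 eN t3 tail dA).
Qed.

End Sensitivity.

(** * Choice of thresholds and conclusion *)

Lemma normH_sub_PN_le {R : realType} (N : R) (u : vfield R) : L2v u ->
  normH (u - PN N u) <= normH u.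
Proof.
move=> Lu; have [Lp cp] := PN_coefs N Lu; apply: ler_sqr_ge0; rewrite ?normH_ge0//.
apply: has_boxsum_le (has_boxsum_normH (L2vB Lu Lp)) (has_boxsum_normH Lu) _ => k.
have cd i : fcos ((u - PN N u) i) k = (1 - (knorm k <= N)%R%:R) * fcos (u i) k /\
            fsin ((u - PN N u) i) k = (1 - (knorm k <= N)%R%:R) * fsin (u i) k.
  by rewrite (fcosB _ (Lu i) (Lp i)) (fsinB _ (Lu i) (Lp i))
    (cp i k).1 (cp i k).2 !mulrBl !mul1r.
rewrite (cross_scale cd cd).
by case: (knorm k <= N); rewrite ?subrr ?subr0 ?mul0r ?mul1r ?cross_ge0.
Qed.

Lemma PN_tail_quarter {R : realType} (u : vfield R) : L2v u -> exists N0 : R, 0 < N0 /\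
  forall N, N0 <= N -> normH (u - PN N u) <= normH u / 4.
Proof.
(* [PN_tail] needs a positive tolerance, so a vanishing field is treated apart. *)
move=> Lu; have := normH_ge0 u; rewrite le_eqVlt => /predU1P[u0|u0].
  exists 1; split => // N _; rewrite -u0 mul0r [leRHS]u0; exact: normH_sub_PN_le.
have [|N0 N0P] := @PN_tail R u (normH u / 4) Lu; first by rewrite divr_gt0.
by exists N0.
Qed.

(** The chain [s^2 / 4 <= p^2 <= 8 K^2 mu E <= 16 K^2 mu X] explains the factor 64. *)
Lemma conclusion_arith {R : realType} (K s p mu E X : R) :
  1 <= K -> 0 < mu -> 0 <= s -> s / 2 <= p -> p ^+ 2 <= 8 * K ^+ 2 * mu * E -> E / 2 <= X ->
  (64 * K ^+ 2)^-1 * s ^+ 2 / mu <= X.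
Proof.
move=> K1 mu0 s0 sp pE EX.
have K0 : 0 < K by rewrite (lt_le_trans ltr01).
have C0 : 0 < 64 * K ^+ 2 * mu by rewrite !mulr_gt0// exprn_gt0.
rewrite (_ : _ / mu = s ^+ 2 / (64 * K ^+ 2 * mu)); last by field; rewrite !gt_eqF.
rewrite ler_pdivrMr//.
have sp2 : (s / 2) ^+ 2 <= p ^+ 2.
  by rewrite ler_pXn2r ?nnegrE ?(le_trans _ sp) ?divr_ge0.
have EX' : 8 * K ^+ 2 * mu * E <= 8 * K ^+ 2 * mu * (2 * X).
  by rewrite ler_wpM2l ?mulr_ge0 ?sqr_ge0 ?(ltW mu0) ?(ltW K0)//; lra.
have := le_trans sp2 (le_trans pE EX'); rewrite expr_div_n -[2 ^+ 2]/(2 * 2); lra.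
Qed.

(** With [M = c V sqrt L], the Brezis-Gallouet bound on [vs], the second entries of the two maxima
    are exactly the conditions of [trilinear_le_energy]. *)
Lemma thresholds_arith {R : realType} (c V L nuh mu N B1 B2 : R) :
  0 < nuh -> 0 <= L ->
  Num.max B1 (16 * c ^+ 2 * V ^+ 2 / nuh * L) <= mu ->
  Num.max B2 (4 * c * V / nuh * Num.sqrt L) <= N ->
  16 * (c * V * Num.sqrt L) ^+ 2 <= mu * nuh /\ 4 * (c * V * Num.sqrt L) <= nuh * N.
Proof.
move=> n0 L0; rewrite !ge_max => /andP[_ h1] /andP[_ h2]; split.
  rewrite -ler_pdivrMr// !exprMn sqr_sqrtr//; apply: le_trans h1.
  by rewrite le_eqVlt; apply/orP; left; apply/eqP; ring.
move: h2.
rewrite (_ : 4 * c * V / nuh * Num.sqrt L = (4 * (c * V * Num.sqrt L)) / nuh); last by ring.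
by rewrite ler_pdivrMr// (mulrC N).
Qed.

Theorem proposition4p7 (R : realType) :
  exists c : R -> R, (forall K : R, 1 <= K -> 0 < c K) /\
  forall cL cA cBG : R,
  0 < cL -> ladyzhenskaya cL ->
  0 < cA -> agmon cA ->
  0 < cBG -> brezis_gallouet cBG ->
  forall (nu0 nu : R) (f us : vfield R),
  0 < nu0 -> nu0 <= nu ->
  inH f -> normH f <= nu ^+ 2 / (2 * cL) ->
  inDA us -> eqH (nu *: A us + B us us) f ->
  exists rhos Nf : R, 0 < rhos /\ 0 < Nf /\
  forall rho N : R, rho <= rhos -> Nf <= N ->
  forall (nuh mu : R) (u0 v0 vs vhs : vfield R) (u v : R -> vfield R) (V1 : R),
  nu0 <= nu <= (1 + rho) * nu0 ->
  nu0 <= nuh <= (1 + rho) * nu0 ->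
  0 < mu ->
  inV u0 -> strong_solution nu (fun=> f) u0 u ->
  inV v0 ->
  strong_solution nuh (fun t => f - mu *: PN N (v t) + mu *: PN N (u t)) v0 v ->
  inDA vs -> ~ eqH vs 0 ->
  eqH (nuh *: A vs + B vs vs + mu *: PN N vs) (f + mu *: PN N us) ->
  inDA vhs ->
  eqH (nuh *: A vhs + mu *: PN N vhs + DB vs vhs) (- A vs) ->
  V1%:E = ereal_sup [set (normV (v t))%:E | t in [set t : R | 0 <= t]] ->
  2 * cL ^+ 2 * V1 ^+ 2 / nu0 <= mu ->
  2 * cL * V1 / nu0 <= N ->
  20 * cL ^+ 2 * V1 ^+ 2 / nu0 <= mu ->
  4 * Num.sqrt 2 * cL * V1 / nu0 <= N ->
  2 * cA ^+ 2 * normH (A us) ^+ 2 / nu0 <= mu ->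
  2 * Num.sqrt 2 * cA * normH (A us) / nu0 <= N ^+ 2 ->
  Num.max (32 * cL ^+ 2 * normV vs ^+ 2 / nuh)
          (16 * cBG ^+ 2 * normV vs ^+ 2 / nuh
             * (1 + ln (normH (A vs) / normH vs))) <= mu ->
  Num.max (8 * cL * normV vs / nuh)
          (4 * cBG * normV vs / nuh
             * Num.sqrt (1 + ln (normH (A vs) / normH vs))) <= N ->
  forall K : R, 1 <= K ->
  K^-1 * nuh * N ^+ 2 <= mu <= K * nuh * N ^+ 2 ->
  c K * normH (A us) ^+ 2 / mu <= - inner (A vs) vhs.
Proof.
exists (fun K => (64 * K ^+ 2)^-1); split.
  by move=> K K1; rewrite invr_gt0 mulr_gt0// exprn_gt0// (lt_le_trans ltr01).
move=> cL cA cBG _ _ cA0 agA cBG0 bg nu0 nu f us nu00 _ Hf _ usD eq_us.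
have [Nf [Nf0 NfP]] := PN_tail_quarter (L2v_A us).
have den0 : 0 < 4 * cA * normH (A us) + 4 * nu0.
  by rewrite ltr_wpDl ?mulr_gt0// !mulr_ge0 ?normH_ge0// ltW.
(* The first witness is the smallness required by [difference_A]; the second is the radius beyond
   which the tail of [A us] is at most a quarter of its norm. *)
exists ((nu0 / (4 * cA * normH (A us) + 4 * nu0)) ^+ 2 / 8), Nf; split.
  by rewrite divr_gt0// exprn_gt0// divr_gt0.
split=> // rho N rhole NfN nuh mu _ _ vs vhs _ _ _ nu_itv nuh_itv mu0 _ _ _ _ vsD vs0 eq_vs vhsD
  eq_vhs _ _ _ _ _ _ _ mu_ge N_ge K K1 muK.
have /andP[nu1 nu2] := nu_itv; have /andP[nuh1 nuh2] := nuh_itv; have /andP[muK1 _] := muK.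
have N0 : 0 < N := lt_le_trans Nf0 NfN.
have nuh0 : 0 < nuh := lt_le_trans nu00 nuh1.
(* The interval from [nu0] to [(1 + rho) nu0] contains [nu], which forces the sign of [rho]. *)
have rho0 : 0 <= rho.
  by have := le_trans nu1 nu2; rewrite mulrDl mul1r lerDl pmulr_lge0.
have dnu : `|nuh - nu| <= rho * nu0.
  by rewrite ler_norml; move: nu2 nuh2; rewrite !mulrDl !mul1r => *; apply/andP; split; lra.
have [L0 bvs] := brezis_gallouet_ae_bounded cBG0 bg vsD vs0.
have [MM MN] := thresholds_arith nuh0 L0 mu_ge N_ge.
have M0 : 0 <= cBG * normV vs * Num.sqrt (1 + ln (normH (A vs) / normH vs)).
  by rewrite !mulr_ge0 ?sqrtr_ge0 ?normV_ge0// ltW.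
have KN : nuh * N ^+ 2 <= K * mu.
  have K0 : 0 < K := lt_le_trans ltr01 K1.
  by move: muK1; rewrite -mulrA ler_pdivrMl.
have dA := difference_A cA0 agA nu00 nuh1 mu0 N0 M0 MN MM bvs Hf usD vsD eq_us eq_vs rho0
  rhole dnu.
have sp := low_modes_ge usD vsD dA (NfP N NfN).
have pE := low_modes_le cA0 agA nu00 nuh1 mu0 N0 M0 MN bvs vsD K1 KN vhsD eq_vhs.
have EX := linearized_energy cA0 agA nu00 nuh1 mu0 N0 M0 MN MM bvs vsD vhsD eq_vhs.
exact: (conclusion_arith K1 mu0 (normH_ge0 _) sp pE EX).
Qed.
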